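(* Let $n \in \mathbb{N}$ and let $A \subset \mathbb{R}^n$ be a finite, convex independent set. Let $u \in \mathrm{BV}^2_{\mathrm{loc}}(\mathbb{R}^n)$ with $\nabla u(x) \in A$ for almost every $x \in \mathbb{R}^n$. Then the singular set $\mathcal{S}(u)$ is countably $\mathcal{H}^{n-1}$-rectifiable.
   Context: A set $A \subset \mathbb{R}^n$ is convex independent if no $a \in A$ belongs to the convex hull of $A \setminus \{a\}$. $\mathrm{BV}^2_{\mathrm{loc}}(\mathbb{R}^n)$ is the space of functions $u: \mathbb{R}^n \to \mathbb{R}$ whose weak gradient satisfies $\nabla u \in \mathrm{BV}_{\mathrm{loc}}(\mathbb{R}^n;\mathbb{R}^n)$. Functions $u$ with $\nabla u \in A$ almost everywhere ($A$ finite) are always identified with their continuous (Lipschitz) representative. $B_r(x)$ is the open ball of radius $r$ centred at $x$. The regular set $\mathcal{R}(u)$ of $u:\mathbb{R}^n \to \mathbb{R}$ consists of all $x \in \mathbb{R}^n$ for which there exist $a, b \in \mathbb{R}^n$, $c \in \mathbb{R}$ and $r > 0$ such that either $u(\tilde x) = \min\{a \cdot (\tilde x - x),\, b \cdot (\tilde x - x)\} + c$ for all $\tilde x \in B_r(x)$, or $u(\tilde x) = \max\{a \cdot (\tilde x - x),\, b \cdot (\tilde x - x)\} + c$ for all $\tilde x \in B_r(x)$ (the case $a=b$ is allowed). The singular set is $\mathcal{S}(u) = \mathbb{R}^n \setminus \mathcal{R}(u)$. $\mathcal{H}^s$ denotes $s$-dimensional Hausdorff measure. A set $S \subseteq \mathbb{R}^n$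 is countably $\mathcal{H}^{k}$-rectifiable if there are countably many Lipschitz maps $f_j: \mathbb{R}^k \to \mathbb{R}^n$ with $\mathcal{H}^k\bigl(S \setminus \bigcup_j f_j(\mathbb{R}^k)\bigr) = 0$. *)

(* Defs.v *)
(* R^n is 'rV[R]_n for an arbitrary R : realType.  The topology on 'rV[R]_n is
   the library's; the library norm there is the sup norm, so metric notions
   (balls, diameters, Lipschitz maps) are defined from the Euclidean norm. *)
From HB Require Import structures.
From mathcomp Require Import all_boot all_order all_algebra.
From mathcomp Require Import all_classical all_reals all_analysis.

Set Implicit Arguments.
Unset Strict Implicit.
Unset Printing Implicit Defensive.

Import Order.TTheory GRing.Theory Num.Theory.
Import numFieldNormedType.Exports.

Local Open Scope classical_set_scope.
Local Open Scope ring_scope.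

Section euclidean.
Context {R : realType}.

Definition dotr n (a b : 'rV[R]_n) : R := \sum_(i < n) a 0 i * b 0 i.

Definition enorm n (x : 'rV[R]_n) : R := Num.sqrt (dotr x x).

Definition eball n (x : 'rV[R]_n) (r : R) : set 'rV[R]_n :=
  [set y | enorm (y - x) < r].

Definition convex_hull n (A : set 'rV[R]_n) : set 'rV[R]_n :=
  [set x | exists (m : nat) (w : 'I_m -> R) (p : 'I_m -> 'rV[R]_n),
     [/\ forall k, 0 <= w k, \sum_(k < m) w k = 1,
         forall k, A (p k) & x = \sum_(k < m) w k *: p k]].

Definition convex_independent n (A : set 'rV[R]_n) :=
  forall a, A a -> ~ convex_hull (A `\ a) a.

Definition regular_set n (u : 'rV[R]_n -> R) : set 'rV[R]_n :=
  [set x | exists (a b : 'rV[R]_n) (c r : R), 0 < r /\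
     ((forall y, eball x r y ->
         u y = Num.min (dotr a (y - x)) (dotr b (y - x)) + c) \/
      (forall y, eball x r y ->
         u y = Num.max (dotr a (y - x)) (dotr b (y - x)) + c))].

Definition singular_set n (u : 'rV[R]_n -> R) : set 'rV[R]_n :=
  ~` regular_set u.

End euclidean.

(* The product (= Borel) sigma-algebra on 'rV[R]_n, generated by the
   coordinate maps, as the library does for tuples. *)
Definition rV_display : measure_display.
Proof. exact: default_measure_display. Qed.

Section measurable_rV.
Context {R : realType} (n : nat).

Let coor : 'I_n -> 'rV[R]_n -> measurableTypeR R := fun i x => x 0 i.

Let rV_set0 : g_sigma_preimage coor set0.
Proof. exact: sigma_algebra0. Qed.

Let rV_setC A : g_sigma_preimage coor A -> g_sigma_preimage coor (~` A).
Proof. exact: sigma_algebraC. Qed.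

Let rV_bigcup (F : _^nat) : (forall i, g_sigma_preimage coor (F i)) ->
  g_sigma_preimage coor (\bigcup_i (F i)).
Proof. exact: sigma_algebra_bigcup. Qed.

HB.instance Definition _ := @isMeasurable.Build rV_display
  'rV[R]_n (g_sigma_preimage coor) rV_set0 rV_setC rV_bigcup.

End measurable_rV.

Section measurable_rV_lemmas.
Context {R : realType}.

Lemma measurable_coor n (i : 'I_n) :
  measurable_fun setT (fun x : 'rV[R]_n => x 0 i : measurableTypeR R).
Proof.
move=> _ Y mY; rewrite setTI; apply: sub_sigma_algebra => /=.
rewrite -bigcup_seq/=; exists i => /=; first by rewrite mem_index_enum.
by exists Y => //; rewrite setTI.
Qed.

Lemma measurable_fun_rV d (T : measurableType d) n (f : T -> 'rV[R]_n) :
  (forall i, measurable_fun setT (fun t => f t 0 i : measurableTypeR R)) ->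
  measurable_fun setT f.
Proof.
move=> mf _ Y mY; rewrite setTI; move: Y mY.
set P := [set Y : set 'rV[R]_n | measurable (f @^-1` Y)].
suff : measurable `<=` P by move=> h Y /h.
apply: smallest_sub.
  split; first by rewrite /P/= preimage_set0.
  - by move=> Y PY; rewrite /P/= setTD -preimage_setC; apply: measurableC.
  - move=> F PF; rewrite /P/= preimage_bigcup.
    by apply: bigcup_measurable => k _; exact: PF.
rewrite -bigcup_seq/=; apply: bigcup_sub => i _ _ [Y mY <-].
by rewrite /P/= setTI; have := mf i measurableT _ mY; rewrite setTI.
Qed.

(* (t, y) |-> (t, y_1, ..., y_n) and its inverse *)
Definition rV_cons n (p : measurableTypeR R * 'rV[R]_n) : 'rV[R]_n.+1 :=
  row_mx ((p.1 : R)%:M : 'rV[R]_1) p.2.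

Definition rV_uncons n (x : 'rV[R]_n.+1) : measurableTypeR R * 'rV[R]_n :=
  (x 0 0, \row_j x 0 (lift 0 j)).

Lemma rV_cons0 n (p : measurableTypeR R * 'rV[R]_n) : rV_cons p 0 0 = p.1.
Proof.
have -> : (0 : 'I_n.+1) = lshift n (0 : 'I_1) by exact: val_inj.
by rewrite /rV_cons (row_mxEl (m := 1) (n1 := 1)) mxE eqxx.
Qed.

Lemma rV_cons_lift n (p : measurableTypeR R * 'rV[R]_n) j :
  rV_cons p 0 (lift 0 j) = p.2 0 j.
Proof.
have -> : lift 0 j = rshift 1 j by exact: val_inj.
by rewrite /rV_cons (row_mxEr (m := 1) (n1 := 1)).
Qed.

Lemma rV_consK n : cancel (@rV_cons n) (@rV_uncons n).
Proof.
case=> t y; rewrite /rV_uncons rV_cons0; congr (_, _).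
by apply/rowP => j; rewrite mxE rV_cons_lift.
Qed.

Lemma rV_unconsK n : cancel (@rV_uncons n) (@rV_cons n).
Proof.
move=> x; apply/rowP => i; case: (unliftP 0 i) => [j ->|->].
  by rewrite rV_cons_lift mxE.
by rewrite rV_cons0.
Qed.

Lemma measurable_rV_cons n : measurable_fun setT (@rV_cons n).
Proof.
apply: measurable_fun_rV => i; case: (unliftP 0 i) => [j ->|->].
  under eq_fun do rewrite rV_cons_lift.
  by apply: measurableT_comp (measurable_coor j) _; exact: measurable_snd.
by under eq_fun do rewrite rV_cons0; exact: measurable_fst.
Qed.

Lemma measurable_rV_uncons n : measurable_fun setT (@rV_uncons n).
Proof.
apply/measurable_fun_pairP; split => /=; first exact: measurable_coor.
apply: measurable_fun_rV => i /=.
by under eq_fun do rewrite mxE; exact: measurable_coor.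
Qed.

End measurable_rV_lemmas.

(* Lebesgue measure on 'rV[R]_n by recursion on n:
   the Dirac mass at the unique point for n = 0, and the image of
   lebesgue_measure \x lebesgue_rV n under rV_cons for n.+1. *)
Section lebesgue_rV.
Context {R : realType}.
Local Open Scope ereal_scope.

Definition prod_rV n (m : {sigma_finite_measure set 'rV[R]_n -> \bar R}) :
    set 'rV[R]_n.+1 -> \bar R :=
  pushforward (@lebesgue_measure R \x m) (@rV_cons R n).


Section prod_rV.
Variables (n : nat) (m : {sigma_finite_measure set 'rV[R]_n -> \bar R}).

Let mcons := @measurable_rV_cons R n.

Let prod_rV0 : prod_rV m set0 = 0.
Proof. by rewrite /prod_rV /pushforward preimage_set0 measure0. Qed.

Let prod_rV_ge0 A : 0 <= prod_rV m A.
Proof. exact: measure_ge0. Qed.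

Let prod_rV_sigma_additive : semi_sigma_additive (prod_rV m).
Proof.
exact: (@measure_semi_sigma_additive _ _ _
  (measure_function_pushforward__canonical__measure_function_Measure
    (@lebesgue_measure R \x m) mcons)).
Qed.

HB.instance Definition _ := isMeasure.Build _ _ _ (prod_rV m)
  prod_rV0 prod_rV_ge0 prod_rV_sigma_additive.

Let prod_rV_sigma_finite : sigma_finite setT (prod_rV m).
Proof.
have /sigma_finiteP[F [FT ndF Foo]] := sigma_finiteT (@lebesgue_measure R).
have /sigma_finiteP[G [GT ndG Goo]] := sigma_finiteT m.
exists (fun k => @rV_uncons R n @^-1` (F k `*` G k)).
  rewrite -preimage_bigcup -(@preimage_setT _ _ (@rV_uncons R n)); congr preimage.
  apply/esym/seteqP; split=> [//|[x y] _].
  have [i _ Fix] : (\bigcup_k F k) x by rewrite -FT.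
  have [j _ Gjy] : (\bigcup_k G k) y by rewrite -GT.
  exists (maxn i j) => //; split => /=.
    by move: x Fix; exact/subsetPset/ndF/leq_maxl.
  by move: y Gjy; exact/subsetPset/ndG/leq_maxr.
move=> k; have [mFk Fkoo] := Foo k; have [mGk Gkoo] := Goo k.
have mFG : measurable (F k `*` G k) by exact: measurableX.
split.
  by rewrite -[X in measurable X]setTI; exact: measurable_rV_uncons.
rewrite /prod_rV /pushforward -comp_preimage.
rewrite (_ : _ \o _ = id); last by apply/funext => p /=; rewrite rV_consK.
by rewrite preimage_id product_measure1E// lte_mul_pinfty// ge0_fin_numE.
Qed.

HB.instance Definition _ := Measure_isSigmaFinite.Build _ _ _ (prod_rV m)
  prod_rV_sigma_finite.

End prod_rV.

Fixpoint lebesgue_rV n : {sigma_finite_measure set 'rV[R]_n -> \bar R} :=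
  if n is k.+1 then prod_rV (lebesgue_rV k) else \d_(0%R : 'rV[R]_0).

Lemma lebesgue_rV_box n (a b : 'I_n -> R) : (forall i, a i <= b i)%R ->
  lebesgue_rV n [set x : 'rV[R]_n | forall i, (a i <= x 0%R i <= b i)%R] =
  (\prod_(i < n) (b i - a i))%:E.
Proof.
elim: n => [|n IHn] in a b *.
  move=> _ /=; rewrite big_ord0 diracE mem_set//; by case.
move=> ab; pose a' i := a (lift ord0 i); pose b' i := b (lift ord0 i).
rewrite /= /prod_rV /pushforward.
set I := [set` `[a ord0, b ord0]] : set (measurableTypeR R).
set B := [set x : 'rV[R]_n | forall i, (a' i <= x 0%R i <= b' i)%R].
rewrite (_ : _ @^-1` _ = I `*` B); last first.
  apply/seteqP; split=> -[t y] /=.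
    move=> h; split; first by have := h ord0; rewrite rV_cons0 /I/= in_itv.
    by move=> i; have := h (lift ord0 i); rewrite rV_cons_lift.
  move=> [/= It By] i; case: (unliftP ord0 i) => [j ->|->].
    by rewrite rV_cons_lift; exact: By.
  by rewrite rV_cons0; move: It; rewrite /I/= in_itv.
have mB : measurable B.
  rewrite (_ : B = \bigcap_(i in [set: 'I_n])
      ((fun x : 'rV[R]_n => x 0%R i) @^-1` [set` `[a' i, b' i]])).
    apply: (@fin_bigcap_measurable _ (matrix R 1 n)); first exact: finite_finset.
    move=> i _.
    have := @measurable_coor R n i measurableT _ (measurable_itv `[a' i, b' i]).
    by rewrite setTI.
  apply/seteqP; split=> [x Bx i _|x Bx i].
    by rewrite /= in_itv/=; exact: Bx.
  by have /= := Bx i Logic.I; rewrite in_itv.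
rewrite product_measure1E//; last exact: measurable_itv.
rewrite IHn; last by move=> i; exact: ab.
rewrite big_ord_recl EFinM; congr (_ * _)%E.
transitivity (lebesgue_measure `[a ord0, b ord0]%classic); first by [].
rewrite lebesgue_measure_itv /= lte_fin.
have := ab ord0; rewrite le_eqVlt => /predU1P[->|->]; rewrite ?ltxx ?subrr//.
Qed.

End lebesgue_rV.

Section weak_derivatives.
Context {R : realType}.

Definition partial n (i : 'I_n) (f : 'rV[R]_n -> R) (x : 'rV[R]_n) : R :=
  'D_(delta_mx 0 i) f x.

(* C^1_c(V); C^1 means that all partial derivatives exist and are continuous. *)
Definition C1c n (V : set 'rV[R]_n) (phi : 'rV[R]_n -> R) :=
  (forall i : 'I_n, (forall x, derivable phi x (delta_mx 0 i)) /\
                    continuous (partial i phi)) /\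
  exists K : set 'rV[R]_n, [/\ compact K, K `<=` V &
    forall x, ~ K x -> phi x = 0].

Definition loc_integrable n (f : 'rV[R]_n -> R) :=
  measurable_fun setT f /\
  forall K, compact K -> (lebesgue_rV n).-integrable K (EFin \o f).

(* u and Du are Borel representatives; Du is determined by u only almost
   everywhere. *)
Definition weak_gradient n (u : 'rV[R]_n -> R) (Du : 'rV[R]_n -> 'rV[R]_n) :=
  [/\ loc_integrable u,
      forall i, loc_integrable (fun x => Du x 0 i) &
      forall (i : 'I_n) (phi : 'rV[R]_n -> R), C1c setT phi ->
        (\int[lebesgue_rV n]_x (u x * partial i phi x)%:E =
         - \int[lebesgue_rV n]_x (Du x 0%R i * phi x)%:E)%E].

(* Total variation of the distributional derivative of g in the open set V:
   the supremum of the integrals of sum_i g_i div phi_i over matrix fields phi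
   with Frobenius norm at most 1. *)
Definition variation n m (g : 'rV[R]_n -> 'rV[R]_m) (V : set 'rV[R]_n) :
    \bar R :=
  ereal_sup [set z | exists phi : 'I_m -> 'I_n -> 'rV[R]_n -> R,
    [/\ forall i j, C1c V (phi i j),
        forall x, \sum_(i < m) \sum_(j < n) phi i j x ^+ 2 <= 1 &
        z = (\int[lebesgue_rV n]_(x in V)
              (\sum_(i < m) g x 0 i * \sum_(j < n) partial j (phi i j) x)%:E)%E]].

Definition BV_loc n m (g : 'rV[R]_n -> 'rV[R]_m) :=
  (forall i, loc_integrable (fun x => g x 0 i)) /\
  forall V, open V -> compact (closure V) -> (variation g V < +oo)%E.

End weak_derivatives.

Section hausdorff.
Context {R : realType}.
Local Open Scope ereal_scope.

Definition ediam n (E : set 'rV[R]_n) : \bar R :=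
  ereal_sup [set (enorm (p.1 - p.2))%:E | p in E `*` E].

(* diam(E)^s, with the conventions 0^0 = 1 for nonempty E and 0 for E empty *)
Definition diam_pow n (s : R) (E : set 'rV[R]_n) : \bar R :=
  if E == set0 then 0 else ediam E `^ s.

Definition hausdorff_pre n (s delta : R) (S : set 'rV[R]_n) : \bar R :=
  ereal_inf [set \sum_(0 <= k <oo) diam_pow s (E k) |
    E in [set E : (set 'rV[R]_n)^nat |
      S `<=` \bigcup_k E k /\ forall k, ediam (E k) <= delta%:E]].

(* Without the normalising constant, i.e. up to a positive factor depending
   only on s, which does not affect null sets. *)
Definition hausdorff n (s : R) (S : set 'rV[R]_n) : \bar R :=
  ereal_sup [set hausdorff_pre s delta S | delta in [set d : R | (0 < d)%R]].

Definition elipschitz k n (f : 'rV[R]_k -> 'rV[R]_n) :=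
  exists L : R, forall x y, (enorm (f x - f y) <= L * enorm (x - y))%R.

Definition countably_rectifiable n (k : nat) (S : set 'rV[R]_n) :=
  exists f : nat -> 'rV[R]_k -> 'rV[R]_n,
    (forall j, elipschitz (f j)) /\
    hausdorff k%:R (S `\` \bigcup_j range (f j)) = 0.

End hausdorff.

(* Main.v *)
(* For a value a of the gradient put v_a(x) = u(x) - a.x.  Convex independence
   separates a from the other values, so v_a is monotone along an open cone of
   directions around some e_a: if v_a takes the same value at both ends of a
   segment in the direction e_a, then it is constant on a neighbourhood of the
   midpoint.  Hence if x is singular, v_a moves at x along e_a or along -e_a,
   and the points of a fixed level set at which this happens form a Lipschitz
   graph over a hyperplane.  Taking the countably many levels v_a(q), q
   rational, it remains to show that the set N of singular points lying on none
   of these level sets is negligible.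

   On a nontrivial segment in the direction e_a the function v_a can be constant
   only with a value v_a(q), because it is then constant near the midpoint.
   As the gradient has bounded variation, the ends of the maximal segments of
   this kind have finite total projected measure, so those with level outside
   {v_a(q_0), ..., v_a(q_(p-1))} have small total measure when p is large.
   Almost every point lies on such a segment for some a, but a segment cannot
   cross a small ball around a singular point near its centre.  A ball of radius
   r around a point of N therefore contains ends of measure at least c r^(n-1),
   and all of them have levels outside the finite list if the ball is small.
   Vitali's covering argument gives H^(n-1)(N) = 0.

   No slicing is needed: the measure of the ends is replaced by h^-1 times the
   volume of the set of points x with v_a(x + h e_a) <> v_a(x), for dyadic h. *)
Require Import Defs.
From HB Require Import structures.
From mathcomp Require Import all_boot all_order all_algebra.
From mathcomp Require Import all_classical all_reals all_analysis.
From mathcomp Require Import measurable_realfun.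
From mathcomp Require Import ring lra.
Import Order.TTheory GRing.Theory Num.Theory.
Import numFieldNormedType.Exports.
Set Implicit Arguments.
Unset Strict Implicit.
Unset Printing Implicit Defensive.
Local Open Scope classical_set_scope.
Local Open Scope ring_scope.

(** * Boxes and translation invariance *)

(** On the plateau, the quotient vol([moves h])/h can replace a measure of ends because it does not
    decrease under refinement, up to a slight enlargement of the region: by [vol_chain] the volume
    for a step N h is at most N times the volume for the step h. Balls of different radii are
    therefore compared at the finest scale among them, where disjointness makes volumes add up;
    powers of 1/2 make all ratios of scales integers. The quotient is bounded because a finite set
    of gradient values has a gap: bounded variation makes integrated increments of the gradient
    O(h), and the gap turns this into a bound O(h) on the volume where the gradient changes at all.
    The obstacle is that u is only weakly differentiable, so nothing can be integrated along a
    single line. Facts about [tilt u a] come from integrating a Riemann sum over a set: one step of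
    length k costs O(k^2), so N steps across a fixed length cost O(1/N), and N tends to infinity. *)

Definition box {R : realType} n (a b : 'I_n -> R) : set 'rV[R]_n :=
  [set x | forall i, a i <= x 0 i <= b i].

Section boxes.
Context {R : realType}.

Lemma rV_normP n (x : 'rV[R]_n) (r : R) : 0 <= r ->
  (`|x| <= r) <-> (forall i, `|x 0 i| <= r).
Proof.
have -> : `|x| = mx_norm x by [].
move=> r0; rewrite mx_normrE; split.
  by move=> /bigmax_leP[_ H] i; exact: (H (0, i) isT).
by move=> H; apply/bigmax_leP; split => // -[i j] _ /=; rewrite ord1.
Qed.

Lemma coor_le_norm n (x : 'rV[R]_n) i : `|x 0 i| <= `|x|.
Proof. exact: (rV_normP x (normr_ge0 x)).1. Qed.

Lemma measurable_coor_le n (i : 'I_n) (a b : R) :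
  measurable [set x : 'rV[R]_n | a <= x 0 i <= b].
Proof.
rewrite (_ : [set x | _] =
    (fun x : 'rV[R]_n => x 0%R i) @^-1` [set` `[a, b]]); last first.
  by apply/seteqP; split => x /=; rewrite in_itv.
have := @measurable_coor R n i measurableT _ (measurable_itv `[a, b]).
by rewrite setTI.
Qed.

Lemma measurable_box n (a b : 'I_n -> R) : measurable (box a b).
Proof.
rewrite (_ : box a b = \bigcap_(i in [set: 'I_n])
    [set x : 'rV[R]_n | a i <= x 0 i <= b i]).
  apply: (@fin_bigcap_measurable _ (matrix R 1 n)); first exact: finite_finset.
  by move=> i _; exact: measurable_coor_le.
by apply/seteqP; split=> [x Bx i _|x Bx i]; exact: Bx.
Qed.

(** The empty set makes the family stable under intersection; the inequalities make
    [lebesgue_rV_box] applicable to every other member. *)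
Definition boxes n : set (set 'rV[R]_n) :=
  [set B | B = set0 \/ exists a b, (forall i, a i <= b i) /\ B = box a b].

Lemma setI_closed_boxes n : setI_closed (@boxes n).
Proof.
move=> A B [->|[a [b [ab ->]]]]; first by left; rewrite set0I.
move=> [->|[c [d [cd ->]]]]; first by left; rewrite setI0.
have -> : box a b `&` box c d =
    box (fun i => Num.max (a i) (c i)) (fun i => Num.min (b i) (d i)).
  apply/seteqP; split => [x [h1 h2] i|x h]; rewrite /box /=.
    move: (h1 i) (h2 i) => /andP[A1 A2] /andP[B1 B2].
    by rewrite ge_max le_min A1 A2 B1 B2.
  split => i; have := h i; rewrite ge_max le_min;
    by move=> /andP[/andP[H1 H2] /andP[H3 H4]]; apply/andP.
have [h|/existsNP[i /negP]] := pselect (forall i,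
    Num.max (a i) (c i) <= Num.min (b i) (d i)).
  by right; exists (fun i => Num.max (a i) (c i)), (fun i => Num.min (b i) (d i)).
rewrite -ltNge => h; left; rewrite -subset0 => x /(_ i) /andP[h1 h2].
by move: (le_trans h1 h2); rewrite leNgt h.
Qed.

Lemma boxes_generate n : @measurable _ 'rV[R]_n = <<s @boxes n >>.
Proof.
apply/seteqP; split; last first.
  apply: smallest_sub; first exact: sigma_algebra_measurable.
  by move=> _ [->|[a [b [_ ->]]]] //; exact: measurable_box.
apply: smallest_sub; first exact: smallest_sigma_algebra.
rewrite -bigcup_seq/=; apply: bigcup_sub => i _ _ [Y mY <-].
rewrite setTI.
have : @measurable _ (measurableTypeR R) `<=`
    [set Y | <<s @boxes n >> ((fun x : 'rV[R]_n => x 0 i) @^-1` Y)].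
  rewrite [X in X `<=` _](RGenCInfty.measurableE R); apply: smallest_sub.
    split; first by rewrite /= preimage_set0; exact: sigma_algebra0.
    - by move=> A /= mA; rewrite setTD -preimage_setC; exact: sigma_algebraC.
    - move=> F mF /=; rewrite preimage_bigcup.
      by apply: sigma_algebra_bigcup => k; exact: mF.
  move=> _ /= [c ->] /=.
  rewrite (_ : _ @^-1` _ = \bigcup_k box
      (fun j => if j == i then c else - k%:R)
      (fun j => if j == i then c + k%:R else k%:R)); last first.
    apply/seteqP; split => x /=; rewrite in_itv /= andbT.
      (* The i-th side of the k-th box is [c, c + k], so [k] must exceed x_i - c as well as |x|; |x|
         + |c| bounds both. *)
      move=> cx; exists (Num.truncn (`|x| + `|c|)).+1 => // j.
      have h : `|x| + `|c| <= (Num.truncn (`|x| + `|c|)).+1%:R.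
        exact/ltW/truncnS_gt.
      have := coor_le_norm x j; rewrite ler_norml => /andP[h1 h2].
      case: eqP => [->|_].
        rewrite cx /=; have := coor_le_norm x i.
        move: h (ler_norm (x 0 i)) (ler_norm (- c)); rewrite normrN; lra.
      by have := normr_ge0 c; lra.
    by move=> [k _ /(_ i)]; rewrite eqxx => /andP[].
  apply: sigma_algebra_bigcup => k; apply: sub_sigma_algebra; right.
  exists (fun j => if j == i then c else - k%:R), (fun j => if j == i then c + k%:R else k%:R); split=> // j.
  by case: ifP => _; [rewrite lerDl| rewrite (@le_trans _ _ 0)// oppr_le0].
by move=> /(_ Y mY).
Qed.

End boxes.

Section lebesgue_translation.
Context {R : realType} (n : nat).
Notation mu := (@lebesgue_rV R n).

Lemma measurable_shift (c : 'rV[R]_n) :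
  measurable_fun setT (fun x : 'rV[R]_n => x + c).
Proof.
apply: measurable_fun_rV => i; under eq_fun do rewrite mxE.
by apply: measurable_funD => //; exact: measurable_coor.
Qed.

Lemma lebesgue_box (a b : 'I_n -> R) : (forall i, a i <= b i) ->
  mu (box a b) = (\prod_(i < n) (b i - a i))%:E.
Proof. exact: lebesgue_rV_box. Qed.

Lemma lebesgue_rV_box_fin (a b : 'I_n -> R) : (mu (box a b) < +oo)%E.
Proof.
have [h|/existsNP[i /negP]] := pselect (forall i, a i <= b i).
  by rewrite lebesgue_box// ltry.
rewrite -ltNge => h; rewrite (_ : box a b = set0) ?measure0//.
rewrite -subset0 => x /(_ i) /andP[h1 h2].
by move: (le_trans h1 h2); rewrite leNgt h.
Qed.

(** Both sides are measures in [B] that agree on boxes. These generate the sigma-algebra and are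
    stable under intersection, and cubes of finite measure exhaust the space, so the measures
    coincide. *)
Lemma lebesgue_rV_shift (c : 'rV[R]_n) (B : set 'rV[R]_n) : measurable B ->
  mu ((fun x => x + c) @^-1` B) = mu B.
Proof.
move=> mB; apply/esym.
pose m2 : {measure set 'rV[R]_n -> \bar R} :=
  (measure_function_pushforward__canonical__measure_function_Measure
    mu (measurable_shift c)).
apply: (@measure_unique _ R _ (@boxes R n)
  (fun k => box (fun=> - k%:R) (fun=> k%:R)) _ _ _ _ mu m2) => //.
- exact: boxes_generate.
- exact: setI_closed_boxes.
- move=> k; right; exists (fun=> - k%:R), (fun=> k%:R); split => // i.
  by rewrite (@le_trans _ _ 0)// oppr_le0.
- apply/seteqP; split => // x _.
  exists (Num.truncn `|x|).+1 => // i.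
  have := coor_le_norm x i; have := truncnS_gt `|x|.
  by rewrite ler_norml => h1 /andP[h2 h3]; apply/andP; split; lra.
- move=> _ [->|[a [b [ab ->]]]]; first by rewrite !measure0.
  rewrite /m2 /= /pushforward lebesgue_rV_box//.
  have -> : (fun x : 'rV[R]_n => x + c) @^-1` box a b =
     box (fun i => a i - c 0 i) (fun i => b i - c 0 i).
    by apply/seteqP; split => x h i; have := h i; rewrite !mxE lerBlDr lerBrDr.
  rewrite lebesgue_box; last by move=> i; rewrite lerB.
  by congr (_%:E); apply: eq_bigr => i _; ring.
- by move=> k; exact: lebesgue_rV_box_fin.
Qed.

End lebesgue_translation.

(** * Smooth test functions *)

(** Big-O with one constant on all of [X]. With [X] a type of pairs (base point, increment) it
    expresses Lipschitz and Taylor bounds uniform in the base point. *)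
Definition dominated {R : realType} {X : Type} (f g : X -> R) :=
  exists2 C, 0 <= C & forall x, `|f x| <= C * g x.

Section dominated.
Context {R : realType} {X : Type}.
Implicit Types f g : X -> R.

Lemma eq_dominated f f' g : f =1 f' -> dominated f g -> dominated f' g.
Proof. by move=> ff' [C C0 fg]; exists C => // x; rewrite -ff'. Qed.

Lemma dominatedD f1 f2 g : dominated f1 g -> dominated f2 g ->
  dominated (fun x => f1 x + f2 x) g.
Proof.
move=> [C C0 H] [D D0 K]; exists (C + D) => [|x]; first exact: addr_ge0.
by rewrite (le_trans (ler_normD _ _))// mulrDl lerD.
Qed.

Lemma dominatedM f1 f2 g1 g2 : dominated f1 g1 -> dominated f2 g2 ->
  dominated (fun x => f1 x * f2 x) (fun x => g1 x * g2 x).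
Proof.
move=> [C C0 H] [D D0 K]; exists (C * D) => [|x]; first exact: mulr_ge0.
by rewrite normrM mulrACA ler_pM.
Qed.

Lemma dominatedN f g : dominated f g -> dominated (fun x => - f x) g.
Proof. by move=> [C C0 H]; exists C => // x; rewrite normrN. Qed.

Lemma dominated0 g : (forall x, 0 <= g x) -> dominated (fun=> 0) g.
Proof. by move=> g0; exists 0 => // x; rewrite normr0 mul0r. Qed.

Lemma dominated_cst (c : R) : dominated (fun _ : X => c) (fun=> 1).
Proof. by exists `|c| => // x; rewrite mulr1. Qed.

Lemma dominated_sum (I : Type) (r : seq I) (F : I -> X -> R) g :
  (forall x, 0 <= g x) -> (forall i, dominated (F i) g) ->
  dominated (fun x => \sum_(i <- r) F i x) g.
Proof.
move=> g0 H; elim: r => [|i r IH].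
  by apply: eq_dominated (dominated0 g0) => x; rewrite big_nil.
by apply: eq_dominated (dominatedD (H i) IH) => x; rewrite big_cons.
Qed.

Lemma dominated_comp (Y : Type) (h : Y -> X) f g :
  dominated f g -> dominated (f \o h) (g \o h).
Proof. by move=> [C C0 H]; exists C => // x /=; exact: H. Qed.

End dominated.

Section smooth.
Context {R : realType} (n : nat).
Implicit Types (phi psi : 'rV[R]_n -> R) (dphi dpsi : 'I_n -> 'rV[R]_n -> R).

(* C^{1,1} functions, with error bounds uniform in the base point: increments of
   integrals against them are then estimated without differentiating under the
   integral sign. *)
Record smooth phi dphi : Prop := Smooth {
  smooth_meas : measurable_fun setT phi;
  smooth_dmeas : forall i, measurable_fun setT (dphi i);
  smooth_bdd : dominated phi (fun=> 1);
  smooth_dbdd : forall i, dominated (dphi i) (fun=> 1);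
  smooth_lip : dominated (fun p : 'rV[R]_n * 'rV[R]_n =>
    phi (p.1 + p.2) - phi p.1) (fun p => `|p.2|);
  smooth_dlip : forall i, dominated (fun p : 'rV[R]_n * 'rV[R]_n =>
    dphi i (p.1 + p.2) - dphi i p.1) (fun p => `|p.2|);
  smooth_taylor : dominated (fun p : 'rV[R]_n * 'rV[R]_n =>
    phi (p.1 + p.2) - phi p.1 - \sum_i p.2 0 i * dphi i p.1)
    (fun p => `|p.2| * `|p.2|) }.

Lemma smooth_cst (c : R) : smooth (fun=> c) (fun _ _ => 0).
Proof.
split=> //; try (by move=> *; exact: dominated_cst).
- by apply: eq_dominated (dominated0 _) => // x; rewrite subrr.
- by move=> i; apply: eq_dominated (dominated0 _) => // x; rewrite subrr.
- apply: eq_dominated (dominated0 _) => x; last by rewrite mulr_ge0.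
  by rewrite subrr sub0r big1 ?oppr0// => i _; rewrite mulr0.
Qed.

Lemma smoothM phi dphi psi dpsi : smooth phi dphi -> smooth psi dpsi ->
  smooth (fun x => phi x * psi x)
    (fun i x => phi x * dpsi i x + psi x * dphi i x).
Proof.
move=> sp sq; have [mp mdp bp bdp lp ldp tp] := sp.
have [mq mdq bq bdq lq ldq tq] := sq.
have n0 : forall p : 'rV[R]_n * 'rV[R]_n, 0 <= `|p.2| by [].
have lipM (a b : 'rV[R]_n -> R) : dominated a (fun=> 1) ->
    dominated b (fun=> 1) ->
    dominated (fun p : 'rV[R]_n * 'rV[R]_n => a (p.1 + p.2) - a p.1)
      (fun p => `|p.2|) ->
    dominated (fun p : 'rV[R]_n * 'rV[R]_n => b (p.1 + p.2) - b p.1)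
      (fun p => `|p.2|) ->
    dominated (fun p : 'rV[R]_n * 'rV[R]_n =>
      a (p.1 + p.2) * b (p.1 + p.2) - a p.1 * b p.1) (fun p => `|p.2|).
  move=> ba bb la lb.
  have h1 := dominatedM (dominated_comp (fun p : 'rV[R]_n * 'rV[R]_n => p.1 + p.2) ba) lb.
  have h2 := dominatedM (dominated_comp (fun p : 'rV[R]_n * 'rV[R]_n => p.1) bb) la.
  have [C C0 H] := dominatedD (eq_dominated (frefl _) h1) h2.
  by exists C => // p; have := H p; rewrite /= !mul1r; congr (`|_| <= _); ring.
have one : (fun _ : 'rV[R]_n => 1 * 1 : R) = (fun=> 1).
  by apply/funext => x; rewrite mulr1.
split.
- exact: measurable_funM.
- by move=> i; apply: measurable_funD; exact: measurable_funM.
- by have := dominatedM bp bq; rewrite one.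
- move=> i; apply: dominatedD.
    by have := dominatedM bp (bdq i); rewrite one.
  by have := dominatedM bq (bdp i); rewrite one.
- exact: lipM.
- move=> i.
  have h1 := lipM _ _ bp (bdq i) lp (ldq i).
  have h2 := lipM _ _ bq (bdp i) lq (ldp i).
  by apply: eq_dominated (dominatedD h1 h2) => p; ring.
- have hL : dominated (fun p : 'rV[R]_n * 'rV[R]_n =>
      \sum_i p.2 0 i * dpsi i p.1) (fun p => `|p.2|).
    apply: dominated_sum => // i.
    have h : dominated (fun p : 'rV[R]_n * 'rV[R]_n => p.2 0 i) (fun p => `|p.2|).
      by exists 1 => // p; rewrite mul1r coor_le_norm.
    have [C C0 H] := dominatedM h (dominated_comp (fun p : 'rV[R]_n * 'rV[R]_n => p.1) (bdq i)).
    by exists C => // p; have := H p; rewrite /= mulr1.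
  (* The Taylor remainder of the product is phi(x + y) times that of psi, plus psi(x) times that of
     phi, plus the increment of phi times the linear part of psi; each term is quadratic in y. *)
  have h1 := dominatedM (dominated_comp (fun p : 'rV[R]_n * 'rV[R]_n => p.1 + p.2) bp) tq.
  have h2 := dominatedM (dominated_comp (fun p : 'rV[R]_n * 'rV[R]_n => p.1) bq) tp.
  have h3 := dominatedM lp hL.
  have e1 : (fun p : 'rV[R]_n * 'rV[R]_n => 1 * (`|p.2| * `|p.2|)) =
    (fun p => `|p.2| * `|p.2|) by apply/funext => p; rewrite mul1r.
  rewrite e1 in h1 h2.
  apply: eq_dominated (dominatedD (dominatedD h1 h2) h3) => p /=.
  have -> : \sum_i p.2 0 i * (phi p.1 * dpsi i p.1 + psi p.1 * dphi i p.1) =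
    phi p.1 * (\sum_i p.2 0 i * dpsi i p.1) +
    psi p.1 * (\sum_i p.2 0 i * dphi i p.1).
    by rewrite !mulr_sumr -big_split /=; apply: eq_bigr => i _; ring.
  by ring.
Qed.

Lemma smooth_compl phi dphi : smooth phi dphi ->
  smooth (fun x => 1 - phi x) (fun i x => - dphi i x).
Proof.
move=> [mp mdp bp bdp lp ldp tp]; split.
- exact: measurable_funB.
- by move=> i; exact: measurableT_comp.
- exact: (dominatedD (dominated_cst 1) (dominatedN bp)).
- by move=> i; exact: dominatedN.
- by apply: eq_dominated (dominatedN lp) => p; ring.
- by move=> i; apply: eq_dominated (dominatedN (ldp i)) => p; ring.
- apply: eq_dominated (dominatedN tp) => p.
  by under [in RHS]eq_bigr do rewrite mulrN; rewrite sumrN; ring.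
Qed.

Lemma smooth_shift phi dphi (c : 'rV[R]_n) : smooth phi dphi ->
  smooth (fun x => phi (x + c)) (fun i x => dphi i (x + c)).
Proof.
move=> [mp mdp bp bdp lp ldp tp]; split.
- exact: measurableT_comp mp (measurable_shift c).
- by move=> i; exact: measurableT_comp (mdp i) (measurable_shift c).
- exact: (dominated_comp (fun x => x + c) bp).
- by move=> i; exact: (dominated_comp (fun x => x + c) (bdp i)).
- apply: eq_dominated (dominated_comp (fun p => (p.1 + c, p.2)) lp) => p /=.
  by rewrite addrAC.
- move=> i; apply: eq_dominated (dominated_comp (fun p => (p.1 + c, p.2)) (ldp i)) => p /=.
  by rewrite addrAC.
- apply: eq_dominated (dominated_comp (fun p => (p.1 + c, p.2)) tp) => p /=.
  by rewrite (addrAC p.1 c).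
Qed.

End smooth.

Section ramp.
Context {R : realType}.

Definition sqpos (t : R) := Num.max t 0 ^+ 2.
(** A C^{1,1} step from 0 to 1 across [0, 1]: the primitive of the hat function [dramp], which peaks
    at 1/2 with value 2. Squared positive parts reduce all estimates to [sqpos_taylor] and
    [maxr0_lip]. *)
Definition ramp (t : R) := 2 * sqpos t - 4 * sqpos (t - 2^-1) + 2 * sqpos (t - 1).
Definition dramp (t : R) :=
  4 * Num.max t 0 - 8 * Num.max (t - 2^-1) 0 + 4 * Num.max (t - 1) 0.

Lemma sqpos_taylor (t k : R) :
  `|sqpos (t + k) - sqpos t - k * (2 * Num.max t 0)| <= k * k.
Proof.
rewrite /sqpos ler_norml.
by case: (leP t 0) => h1; case: (leP (t + k) 0) => h2; apply/andP; split; nra.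
Qed.

Lemma maxr0_lip (t k : R) : `|Num.max (t + k) 0 - Num.max t 0| <= `|k|.
Proof.
have := ler_norm k; have := ler_norm (- k); rewrite normrN ler_norml.
by case: (leP t 0) => h1; case: (leP (t + k) 0) => h2 ? ?; apply/andP; split; lra.
Qed.

Lemma ramp_le0 (t : R) : t <= 0 -> ramp t = 0.
Proof.
move=> t0; rewrite /ramp /sqpos !max_r; [|lra|lra|by []].
by rewrite expr0n /= !mulr0 subrr addr0.
Qed.

Lemma ramp_ge1 (t : R) : 1 <= t -> ramp t = 1.
Proof.
move=> t1; rewrite /ramp /sqpos !max_l; lra.
Qed.

Lemma ramp_itv (t : R) : 0 <= ramp t <= 1.
Proof.
rewrite /ramp /sqpos; apply/andP.
case: (leP t 0) => h1; case: (leP (t - 2^-1) 0) => h2;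
  case: (leP (t - 1) 0) => h3; split; nra.
Qed.

Lemma dramp_itv (t : R) : 0 <= dramp t <= 2.
Proof.
rewrite /dramp; apply/andP.
case: (leP t 0) => h1; case: (leP (t - 2^-1) 0) => h2;
  case: (leP (t - 1) 0) => h3; split; lra.
Qed.

Lemma ramp_taylor (t k : R) : `|ramp (t + k) - ramp t - k * dramp t| <= 8 * (k * k).
Proof.
have := sqpos_taylor t k; have := sqpos_taylor (t - 2^-1) k.
have := sqpos_taylor (t - 1) k.
rewrite /ramp /dramp ![t + k - _]addrAC.
rewrite !ler_norml => /andP[a1 a2] /andP[b1 b2] /andP[c1 c2].
by apply/andP; split; lra.
Qed.

Lemma dramp_lip (t k : R) : `|dramp (t + k) - dramp t| <= 16 * `|k|.
Proof.
have := maxr0_lip t k; have := maxr0_lip (t - 2^-1) k.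
have := maxr0_lip (t - 1) k.
rewrite /dramp ![t + k - _]addrAC.
rewrite !ler_norml => /andP[a1 a2] /andP[b1 b2] /andP[c1 c2].
by apply/andP; split; lra.
Qed.

(** For |k| <= 1 the Taylor bound gives 8 k^2 + 2 |k|, which is at most 10 |k|; for larger k the
    increment is at most 1 because [ramp] stays in [0, 1]. *)
Lemma ramp_lip (t k : R) : `|ramp (t + k) - ramp t| <= 16 * `|k|.
Proof.
have [k1|k1] := leP `|k| 1; last first.
  have := ramp_itv (t + k); have := ramp_itv t => /andP[? ?] /andP[? ?].
  by rewrite ler_norml; apply/andP; split; lra.
have h := ramp_taylor t k; have /andP[d0 d2] := dramp_itv t.
have : `|k * dramp t| <= 2 * `|k|.
  by rewrite normrM mulrC ler_wpM2r// ger0_norm.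
have : k * k <= `|k|.
  by rewrite (le_trans (ler_norm _))// normrM ler_piMl.
move: h; rewrite !ler_norml => /andP[? ?] ? /andP[? ?]; apply/andP; split; lra.
Qed.

Lemma measurable_ramp : measurable_fun setT ramp.
Proof.
have m c : measurable_fun setT (fun t : R => sqpos (t - c)).
  apply: (measurable_funX 2); apply: measurable_maxr => //.
  exact: measurable_funB.
have m0 : measurable_fun setT sqpos.
  by rewrite (_ : sqpos = fun t => sqpos (t - 0)) //; apply/funext => t; rewrite subr0.
by apply: measurable_funD; [apply: measurable_funB|]; apply: measurable_funM.
Qed.

Lemma measurable_dramp : measurable_fun setT dramp.
Proof.
have m c : measurable_fun setT (fun t : R => Num.max (t - c) 0).
  by apply: measurable_maxr => //; exact: measurable_funB.
have m0 : measurable_fun setT (fun t : R => Num.max t 0).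
  by rewrite (_ : (fun t => _) = fun t : R => Num.max (t - 0) 0) //;
    apply/funext => t; rewrite subr0.
by apply: measurable_funD; [apply: measurable_funB|]; apply: measurable_funM.
Qed.

Lemma smooth_ramp n (i : 'I_n) (m c : R) :
  smooth (fun x : 'rV[R]_n => ramp (m * (x 0 i - c)))
         (fun j x => (j == i)%:R * (m * dramp (m * (x 0 i - c)))).
Proof.
have maff : measurable_fun setT (fun x : 'rV[R]_n => m * (x 0 i - c)).
  apply: measurable_funM => //; apply: measurable_funB => //.
  exact: measurable_coor.
have aff (x y : 'rV[R]_n) :
    m * ((x + y) 0 i - c) = m * (x 0 i - c) + m * y 0 i.
  by rewrite mxE; ring.
have mk (y : 'rV[R]_n) : `|m * y 0 i| <= `|m| * `|y|.
  by rewrite normrM ler_wpM2l// coor_le_norm.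
split.
- exact: measurableT_comp measurable_ramp maff.
- move=> j; apply: measurable_funM => //; apply: measurable_funM => //.
  exact: measurableT_comp measurable_dramp maff.
- exists 1 => // x; have /andP[h1 h2] := ramp_itv (m * (x 0 i - c)).
  by rewrite mulr1 ger0_norm.
- move=> j; exists (`|m| * 2) => [|x]; first by rewrite mulr_ge0.
  rewrite mulr1 !normrM.
  have /andP[h1 h2] := dramp_itv (m * (x 0 i - c)).
  rewrite (ger0_norm h1) -[leRHS]mul1r ler_pM// ?mulr_ge0//.
    by case: (j == i); rewrite ?normr1// normr0 ler01.
  by rewrite ler_wpM2l.
- exists (16 * `|m|) => [|[x y]/=]; first by rewrite mulr_ge0.
  by rewrite aff (le_trans (ramp_lip _ _))// -mulrA ler_wpM2l.
- move=> j; exists (`|m| * (16 * `|m|)) => [|[x y]/=]; first by rewrite !mulr_ge0.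
  rewrite aff -mulrBr -mulrBr !normrM -!mulrA -[leRHS]mul1r ler_pM//.
    by case: (j == i); rewrite ?normr1// normr0 ler01.
  by rewrite ler_wpM2l// (le_trans (dramp_lip _ _))// ler_wpM2l.
- exists (8 * (`|m| * `|m|)) => [|[x y]/=]; first by rewrite !mulr_ge0.
  rewrite aff (bigD1 i)//= eqxx mul1r big1 ?addr0; last first.
    by move=> j /negbTE ->; rewrite mul0r mulr0.
  have := ramp_taylor (m * (x 0 i - c)) (m * y 0 i).
  have -> : y 0 i * (m * dramp (m * (x 0 i - c))) =
    m * y 0 i * dramp (m * (x 0 i - c)) by ring.
  move=> /le_trans; apply; rewrite -[leRHS]mulrA ler_wpM2l//.
  rewrite (le_trans (ler_norm _))// normrM mulrACA.
  by rewrite ler_pM.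
Qed.

End ramp.

Definition cube {R : realType} n (r : R) : set 'rV[R]_n := [set x | `|x| <= r].

Section cubes.
Context {R : realType} (n : nat).
Notation mu := (@lebesgue_rV R n).

Lemma cube_box (r : R) : 0 <= r -> @cube R n r = box (fun=> - r) (fun=> r).
Proof.
move=> r0; apply/seteqP; split => x /=.
  by move=> /(rV_normP x r0) h i; rewrite -ler_norml.
by move=> h; apply/(rV_normP x r0) => i; rewrite ler_norml; exact: h.
Qed.

Lemma measurable_cube (r : R) : measurable (@cube R n r).
Proof.
have [r0|r0] := leP 0 r; first by rewrite cube_box//; exact: measurable_box.
rewrite (_ : cube r = set0)// -subset0 => x; rewrite /cube/= => h.
by have := le_lt_trans (le_trans (normr_ge0 x) h) r0; rewrite ltxx.
Qed.

Lemma cube_fin (r : R) : (mu (cube r) < +oo)%E.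
Proof.
have [r0|r0] := leP 0 r; first by rewrite cube_box//; exact: lebesgue_rV_box_fin.
rewrite (_ : cube r = set0) ?measure0// -subset0 => x; rewrite /cube/= => h.
by have := le_lt_trans (le_trans (normr_ge0 x) h) r0; rewrite ltxx.
Qed.

Lemma cube_compact (r : R) : compact (@cube R n r).
Proof.
apply: bounded_closed_compact.
  by exists r; split => [|M rM x /= h]; [exact: num_real|exact: le_trans (ltW rM)].
rewrite (_ : cube r = (fun x : 'rV[R]_n => `|x|) @^-1` [set y | y <= r])//.
by apply: closed_comp; [move=> x _; exact: norm_continuous|exact: closed_le].
Qed.

Lemma measure_cubeI_fin (r : R) (E : set 'rV[R]_n) : measurable E ->
  (mu (E `&` cube r) < +oo)%E.
Proof.
move=> mE; apply: le_lt_trans (cube_fin r); apply: le_measure.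
- by rewrite inE; apply: measurableI => //; exact: measurable_cube.
- by rewrite inE; exact: measurable_cube.
- exact: subIsetr.
Qed.

Lemma measure_cube_vanish (r e : R) (F : (set 'rV[R]_n)^nat) : 0 < e ->
  (forall k, measurable (F k)) -> nonincreasing_seq F -> \bigcap_k F k = set0 ->
  exists k, (mu (F k `&` cube r) <= e%:E)%E.
Proof.
move=> e0 mF ndF F0.
have h : mu (F k `&` cube r) @[k --> \oo] --> 0%E.
  have -> : 0%E = mu (\bigcap_k (F k `&` cube r)).
    rewrite (_ : \bigcap_k _ = set0) ?measure0// -subset0 -F0.
    by move=> x H k _; have [] := H k I.
  apply: nonincreasing_cvg_mu => //.
  - exact: measure_cubeI_fin.
  - by move=> k; apply: measurableI => //; exact: measurable_cube.
  - by apply: bigcap_measurable => // k _; apply: measurableI => //; exact: measurable_cube.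
  - move=> i j ij; apply/subsetPset; apply: setSI.
    by apply/subsetPset; exact: ndF.
have : \forall k \near \oo, (mu (F k `&` cube r) < e%:E)%E.
  by apply: (h [set x | x < e%:E]%E); apply: open_nbhs_nbhs; split; [exact: open_ereal_lt_ereal|by rewrite /= lte_fin].
by case=> k _ H; exists k; apply/ltW/H => /=.
Qed.

End cubes.

(** * Approximation of indicators by smooth functions *)

Section approximation.
Context {R : realType} (n : nat).
Notation mu := (@lebesgue_rV R n).

(** Equality off a set of small measure, rather than closeness in L^1: complements, products and
    countable unions then only require a bound on the exceptional sets, and these [B] form a
    sigma-algebra. *)
Definition approximable (r : R) (B : set 'rV[R]_n) := measurable B /\
  forall e : R, 0 < e -> exists phi dphi (E : set 'rV[R]_n), [/\ smooth phi dphi,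
    forall x, 0 <= phi x <= 1, measurable E,
    (mu (E `&` cube r) <= e%:E)%E & forall x, ~ E x -> phi x = \1_B x].

Lemma approximableC r B : approximable r B -> approximable r (~` B).
Proof.
move=> [mB H]; split => [|e e0]; first exact: measurableC.
have [phi [dphi [E [sp p01 mE Ee h]]]] := H e e0.
exists (fun x => 1 - phi x), (fun i x => - dphi i x), E; split => //.
- exact: smooth_compl.
- by move=> x; have /andP[? ?] := p01 x; apply/andP; split; lra.
- move=> x /h ->; rewrite !indicE in_setC.
  by case: (x \in B) => /=; lra.
Qed.

Lemma approximableI r A B :
  approximable r A -> approximable r B -> approximable r (A `&` B).
Proof.
move=> [mA HA] [mB HB]; split => [|e e0]; first exact: measurableI.
have e2 : 0 < e / 2 by rewrite divr_gt0.
have [phi [dphi [E [sp p01 mE Ee h]]]] := HA _ e2.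
have [psi [dpsi [F [sq q01 mF Fe k]]]] := HB _ e2.
exists (fun x => phi x * psi x), (fun i x => phi x * dpsi i x + psi x * dphi i x).
exists (E `|` F); split.
- exact: smoothM.
- move=> x; have /andP[? ?] := p01 x; have /andP[? ?] := q01 x.
  by rewrite mulr_ge0//= mulr_ile1.
- exact: measurableU.
- have mc := @measurable_cube R n r.
  rewrite setIUl; apply: le_trans.
    by apply: measureU2; exact: measurableI.
  by rewrite [e in X in (_ <= X)%E]splitr EFinD leeD.
- move=> x /not_orP[/h -> /k ->]; rewrite !indicE in_setI.
  by case: (x \in A); case: (x \in B) => /=; rewrite ?mulr0 ?mul0r ?mulr1.
Qed.

Lemma approximable0 r : approximable r set0.
Proof.
split => [//|e e0]; exists (fun=> 0), (fun _ _ => 0), set0; split => //.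
- exact: smooth_cst.
- by move=> _; rewrite lexx ler01.
- by rewrite set0I measure0 lee_fin ltW.
- by move=> x _; rewrite indicE in_set0.
Qed.

Lemma approximableU r A B :
  approximable r A -> approximable r B -> approximable r (A `|` B).
Proof.
move=> /approximableC hA /approximableC hB.
by rewrite -[A `|` B]setCK setCU; apply/approximableC/approximableI.
Qed.

Lemma approximable_bigcup r (F : (set 'rV[R]_n)^nat) :
  (forall k, approximable r (F k)) -> approximable r (\bigcup_k F k).
Proof.
move=> HF; have mF k : measurable (F k) by have [] := HF k.
split => [|e e0]; first exact: bigcup_measurable.
have e2 : 0 < e / 2 by rewrite divr_gt0.
(* What the first k sets miss. It decreases to the empty set, so for some k it is small in the cube
   and the finite union can be approximated instead. *)
pose G k := \bigcup_k F k `\` \big[setU/set0]_(i < k) F i.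
have mFF k : measurable (\big[setU/set0]_(i < k) F i).
  exact: bigsetU_measurable.
have mG k : measurable (G k).
  by apply: measurableD => //; exact: bigcup_measurable.
have [k Gk] : exists k, (mu (G k `&` cube r) <= (e / 2)%:E)%E.
  apply: measure_cube_vanish => //.
    move=> i j ij; apply/subsetPset; apply: setDS.
    exact: subset_bigsetU.
  rewrite -subset0 => x H; have [[i _ Fix] _] := H 0%N I.
  have [_ ] := H i.+1 I; apply; rewrite big_ord_recr /=; by right.
have [_ /(_ _ e2)] : approximable r (\big[setU/set0]_(i < k) F i).
  elim/big_ind : _ => //; [exact: approximable0|exact: approximableU].
move=> [phi [dphi [E [sp p01 mE Ee h]]]].
exists phi, dphi, (E `|` G k); split => //.
- exact: measurableU.
- have mc := @measurable_cube R n r.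
  rewrite setIUl; apply: le_trans.
    by apply: measureU2; exact: measurableI.
  by rewrite [e in X in (_ <= X)%E]splitr EFinD leeD.
- move=> x /not_orP[/h -> nG]; rewrite !indicE; congr ((nat_of_bool _)%:R).
  apply/idP/idP; rewrite !inE; last first.
    by move=> bF; apply: contrapT => nF; apply: nG.
  rewrite -bigcup_mkord => -[i _ Fi]; by exists i.
Qed.

(** As the approximable sets form a sigma-algebra, only the half-spaces x_i > c have to be treated,
    and for these steep ramps do. *)
Lemma approximable_measurable r B : measurable B -> approximable r B.
Proof.
suff : @measurable _ 'rV[R]_n `<=` approximable r by exact.
have sig : forall (g : 'rV[R]_n -> R), sigma_algebra [set: R]
    [set Y | approximable r (g @^-1` Y)].
  move=> g; split => /=.
  - by rewrite preimage_set0; exact: approximable0.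
  - by move=> A; rewrite setTD => ?; rewrite -preimage_setC; exact: approximableC.
  - by move=> F ?; rewrite preimage_bigcup; exact: approximable_bigcup.
apply: smallest_sub.
  split; first exact: approximable0.
  - by move=> A; rewrite setTD; exact: approximableC.
  - by move=> F; exact: approximable_bigcup.
rewrite -bigcup_seq/=; apply: bigcup_sub => i _ _ [Y mY <-]; rewrite setTI.
suff : @measurable _ (measurableTypeR R) `<=`
    [set Y | approximable r ((fun x : 'rV[R]_n => x 0 i) @^-1` Y)] by exact.
rewrite [X in X `<=` _](RGenOInfty.measurableE R); apply: smallest_sub => //.
move=> _ /= [c ->]; split.
  have := @measurable_coor R n i measurableT _ (measurable_itv `]c, +oo[).
  by rewrite setTI.
move=> e e0.
(* The strip where the ramp of slope factor k + 1 may differ from the indicator; both faces are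
   excluded, so the strips shrink to the empty set. *)
pose F k := [set x : 'rV[R]_n | c < x 0 i < c + k.+1%:R^-1].
have mF k : measurable (F k).
  rewrite (_ : F k = (fun x : 'rV[R]_n => x 0 i) @^-1` [set` `]c, (c + k.+1%:R^-1)[]).
    have := @measurable_coor R n i measurableT _ (measurable_itv `]c, (c + k.+1%:R^-1)[).
    by rewrite setTI.
  by apply/seteqP; split => x /=; rewrite in_itv.
have [k Fk] : exists k, (mu (F k `&` cube r) <= e%:E)%E.
  apply: measure_cube_vanish => //.
    move=> a b ab; apply/subsetPset => x /= /andP[h1 h2].
    rewrite /F /= h1 (lt_le_trans h2)// lerD2l lef_pV2 ?posrE//.
    by rewrite ler_nat ltnS.
  rewrite -subset0 => x H.
  have /andP[xc _] := H 0%N I.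
  have d0 : 0 < x 0 i - c by rewrite subr_gt0.
  have /andP[_] := H (Num.truncn (x 0 i - c)^-1) I.
  rewrite ltNge => /negP; apply.
  rewrite -lerBrDl invf_ple ?posrE//.
  exact/ltW/truncnS_gt.
exists (fun x => ramp (k.+1%:R * (x 0 i - c))).
exists (fun j x => (j == i)%:R * (k.+1%:R * dramp (k.+1%:R * (x 0 i - c)))).
exists (F k); split => //.
- exact: smooth_ramp.
- by move=> x; exact: ramp_itv.
- move=> x /negP; rewrite negb_and -!leNgt indicE => h.
  have [xc|cx] := leP (x 0 i) c.
    rewrite ramp_le0; last by rewrite mulr_ge0_le0// subr_le0.
    by rewrite memNset//= in_itv/= andbT ltNge xc.
  rewrite mem_set/=; last by rewrite in_itv/= andbT.
  rewrite ramp_ge1//; move: h; rewrite leNgt cx /= => h.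
  by rewrite mulrC -ler_pdivrMr// mul1r lerBrDl.
Qed.

Lemma smooth_cutoff (r : R) : 0 <= r -> exists phi dphi, [/\ @smooth R n phi dphi,
  forall x, 0 <= phi x <= 1, forall x, cube r x -> phi x = 1 &
  forall x, ~ cube (r + 1) x -> phi x = 0].
Proof.
move=> r0.
have [phi [dphi [sp p01 p1 p0]]] : exists phi dphi, [/\ @smooth R n phi dphi,
  forall x, 0 <= phi x <= 1,
  forall x : 'rV[R]_n, (forall i, i \in enum 'I_n -> `|x 0 i| <= r) -> phi x = 1 &
  forall (x : 'rV[R]_n) i, i \in enum 'I_n -> r + 1 < `|x 0 i| -> phi x = 0].
  elim: (enum 'I_n) => [|i s [phi [dphi [sp p01 p1 p0]]]].
    exists (fun=> 1), (fun _ _ => 0); split => //; first exact: smooth_cst.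
    by move=> _; rewrite lexx ler01.
  (* The first ramp is 1 for x_i >= -r and 0 for x_i <= -(r + 1), the second is its mirror image;
     the cutoff is the product over all coordinates. *)
  have s1 := smooth_ramp i 1 (- (r + 1)); have s2 := smooth_ramp i (-1) (r + 1).
  have s3 := smoothM (smoothM s1 s2) sp.
  eexists; eexists; split; first exact: s3.
  - move=> x; have /andP[? ?] := p01 x; rewrite /=.
    have /andP[? ?] := ramp_itv (1 * (x 0 i - - (r + 1))).
    have /andP[? ?] := ramp_itv (-1 * (x 0 i - (r + 1))).
    by rewrite !mulr_ge0//= !mulr_ile1// mulr_ge0.
  - move=> x h; rewrite /= p1 ?mulr1; last first.
      by move=> j js; apply: h; rewrite inE js orbT.
    have := h i; rewrite inE eqxx => /(_ isT); rewrite ler_norml => /andP[? ?].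
    by rewrite !ramp_ge1 ?mulr1//; lra.
  - move=> x j; rewrite inE => /predU1P[->|js h]; last first.
      by rewrite /= (p0 _ _ js)// mulr0.
    rewrite lter_normr => /orP[h|h].
      by rewrite /= (@ramp_le0 _ (-1 * _)) ?(mulr0, mul0r)//; lra.
    by rewrite /= (@ramp_le0 _ (1 * _)) ?(mulr0, mul0r)//; lra.
exists phi, dphi; split => //.
  by move=> x cx; apply: p1 => i _; exact: le_trans (coor_le_norm x i) cx.
move=> x ncx.
have /existsNP[i /negP] : ~ forall i, `|x 0 i| <= r + 1.
  by move=> h; apply: ncx; apply/rV_normP => //; rewrite addr_ge0.
by rewrite -ltNge => hi; apply: (p0 _ i) => //; rewrite mem_enum.
Qed.

End approximation.

(** * Pairing weights with test functions *)

Definition supp_in {R : realType} n (r : R) (psi : 'rV[R]_n -> R) :=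
  forall x, ~ cube r x -> psi x = 0.

Definition pairing {R : realType} n (w psi : 'rV[R]_n -> R) : R :=
  \int[@lebesgue_rV R n]_x (w x * psi x).

Section pairing.
Context {R : realType} (n : nat).
Notation mu := (@lebesgue_rV R n).
Implicit Types (w f psi : 'rV[R]_n -> R).

Lemma sub_cube (r s : R) : r <= s -> @cube R n r `<=` cube s.
Proof. by move=> rs x /= /le_trans; apply. Qed.

Lemma cubeD (r s : R) (x y : 'rV[R]_n) : cube r x -> `|y| <= s -> cube (r + s) (x + y).
Proof. by move=> rx ys; rewrite /cube/= (le_trans (ler_normD _ _))// lerD. Qed.

Lemma supp_in_shift r s psi (c : 'rV[R]_n) : `|c| <= s -> supp_in r psi ->
  supp_in (r + s) (fun x => psi (x + c)).
Proof.
move=> cs H x h; apply: H => rx; apply: h.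
by rewrite -(addrK c x); apply: cubeD rx _; rewrite normrN.
Qed.

Definition testable psi := [/\ measurable_fun setT psi,
  dominated psi (fun=> 1) & exists r, supp_in r psi].

Definition cube_integrable w := measurable_fun setT w /\
  forall r, mu.-integrable (cube r) (EFin \o w).

Lemma loc_integrable_cube w : loc_integrable w -> cube_integrable w.
Proof. by move=> [mw iw]; split => // r; apply: iw; exact: cube_compact. Qed.

Lemma cube_integrable_bounded w : measurable_fun setT w ->
  (forall r, exists C, forall x, cube r x -> `|w x| <= C) -> cube_integrable w.
Proof.
move=> mw bw; split => // r; have [C wC] := bw r.
apply: measurable_bounded_integrable.
- exact: measurable_cube.
- exact: cube_fin.
- exact: measurable_funTS.
- exists C; split => [|M CM x cx /=]; first exact: num_real.
  exact: le_trans (wC x cx) (ltW CM).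
Qed.

Lemma cube_integrableD w1 w2 : cube_integrable w1 -> cube_integrable w2 ->
  cube_integrable (fun x => w1 x + w2 x).
Proof.
move=> [m1 i1] [m2 i2]; split; first exact: measurable_funD.
by move=> r; exact: (integrableD (@measurable_cube R n r) (i1 r) (i2 r)).
Qed.

Lemma cube_integrableZ (c : R) w : cube_integrable w ->
  cube_integrable (fun x => c * w x).
Proof.
move=> [m1 i1]; split; first exact: measurable_funM.
by move=> r; exact: (integrableZl (@measurable_cube R n r) c (i1 r)).
Qed.

Lemma cube_integrable_sum (I : Type) (s : seq I) (F : I -> 'rV[R]_n -> R) :
  (forall i, cube_integrable (F i)) ->
  cube_integrable (fun x => \sum_(i <- s) F i x).
Proof.
move=> H; elim: s => [|i s IH].
  under eq_fun do rewrite big_nil; apply: cube_integrable_bounded => //.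
  by move=> r; exists 0 => x _; rewrite normr0.
by under eq_fun do rewrite big_cons; exact: cube_integrableD.
Qed.

Lemma integrable_shift (f : 'rV[R]_n -> \bar R) (c : 'rV[R]_n) :
  mu.-integrable setT f -> mu.-integrable setT (fun x => f (x + c)).
Proof.
move=> /integrableP[mf If]; have mS := measurable_shift c.
apply/integrableP; split; first exact: measurableT_comp mf mS.
pose m2 : {measure set 'rV[R]_n -> \bar R} :=
  (measure_function_pushforward__canonical__measure_function_Measure mu mS).
apply: le_lt_trans If; rewrite le_eqVlt; apply/orP; left; apply/eqP.
transitivity (\int[m2]_y `|f y|)%E; last first.
  by apply: eq_measure_integral => A mA _; exact: lebesgue_rV_shift.
rewrite /m2 ge0_integral_pushforward//=.
exact: measurableT_comp.
Qed.

Lemma integral_shift (f : 'rV[R]_n -> \bar R) (c : 'rV[R]_n) :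
  mu.-integrable setT f -> (\int[mu]_x f (x + c)%R = \int[mu]_x f x)%E.
Proof.
move=> If; have mS := measurable_shift c.
pose m2 : {measure set 'rV[R]_n -> \bar R} :=
  (measure_function_pushforward__canonical__measure_function_Measure mu mS).
transitivity (\int[m2]_y f y)%E; last first.
  by apply: eq_measure_integral => A mA _; exact: lebesgue_rV_shift.
rewrite /m2 integral_pushforward//=.
- exact: measurable_int If.
- exact: integrable_shift.
Qed.

Lemma cube_integrable_shift w (c : 'rV[R]_n) : cube_integrable w ->
  cube_integrable (fun x => w (x + c)).
Proof.
move=> [mw iw]; split; first exact: measurableT_comp mw (measurable_shift c).
move=> r; have mc s := @measurable_cube R n s.
have h := integrable_shift c ((integrable_mkcond _ (mc (r + `|c|))).1 (iw (r + `|c|))).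
apply: (@eq_integrable _ _ _ mu _ (mc r)
    (fun x => ((EFin \o w) \_ (cube (r + `|c|))) (x + c))).
  by move=> x; rewrite inE => cx; rewrite patchE mem_set//; exact: cubeD.
by apply: integrableS h => //; exact: mc.
Qed.

Lemma integrable_pairing w psi : cube_integrable w -> testable psi ->
  mu.-integrable setT (EFin \o (fun x => w x * psi x)).
Proof.
move=> [mw iw] [mpsi [C C0 bpsi] [r spsi]].
have mc := @measurable_cube R n r.
have -> : EFin \o (fun x => w x * psi x) =
    ((EFin \o w) \* (EFin \o psi))%E \_ (cube r).
  apply/funext => x; rewrite /patch /=; case: ifPn => [//|].
  by rewrite notin_setE => /spsi ->; rewrite mulr0.
apply/(integrable_mkcond _ mc).1.
apply: integrableMl => //.
- exact: measurable_funTS.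
- exists C; split => [|M CM x _ /=]; first exact: num_real.
  by have := bpsi x; rewrite mulr1 => /le_trans; apply; exact: ltW.
Qed.

Lemma pairingDr w psi1 psi2 : cube_integrable w -> testable psi1 -> testable psi2 ->
  pairing w (fun x => psi1 x + psi2 x) = pairing w psi1 + pairing w psi2.
Proof.
move=> lw t1 t2; rewrite /pairing -RintegralD//; try exact: integrable_pairing.
by apply: eq_Rintegral => x _; rewrite mulrDr.
Qed.

Lemma testableD psi1 psi2 : testable psi1 -> testable psi2 ->
  testable (fun x => psi1 x + psi2 x).
Proof.
move=> [m1 b1 [r s1]] [m2 b2 [s s2]]; split.
- exact: measurable_funD.
- exact: dominatedD.
- exists (Num.max r s) => x h; rewrite s1 ?s2 ?addr0//.
    by apply: contra_not h; apply: sub_cube; rewrite le_max lexx orbT.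
  by apply: contra_not h; apply: sub_cube; rewrite le_max lexx.
Qed.

Lemma testableZ (c : R) psi : testable psi -> testable (fun x => c * psi x).
Proof.
move=> [m1 [C C0 b1] [r s1]]; split.
- exact: measurable_funM.
- exists (`|c| * C) => [|x]; first exact: mulr_ge0.
  by rewrite normrM -mulrA ler_wpM2l.
- by exists r => x /s1 ->; rewrite mulr0.
Qed.

Lemma testable0 : testable (fun=> 0).
Proof.
by split => //; [exact: dominated0|exists 0].
Qed.

Lemma testable_sum (I : Type) (s : seq I) (F : I -> 'rV[R]_n -> R) :
  (forall i, testable (F i)) -> testable (fun x => \sum_(i <- s) F i x).
Proof.
move=> H; elim: s => [|i s IH].
  by under eq_fun do rewrite big_nil; exact: testable0.
by under eq_fun do rewrite big_cons; exact: testableD.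
Qed.

Lemma testable_shift psi (c : 'rV[R]_n) : testable psi ->
  testable (fun x => psi (x + c)).
Proof.
move=> [m1 [C C0 b1] [r s1]]; split.
- exact: measurableT_comp m1 (measurable_shift c).
- by exists C.
- by exists (r + `|c|); exact: supp_in_shift.
Qed.

Lemma testable_indic r (B : set 'rV[R]_n) : measurable B -> B `<=` cube r ->
  testable \1_B.
Proof.
move=> mB Br; split => //.
- exists 1 => // x; rewrite mulr1 indicE.
  by case: (x \in B); rewrite ?normr1// normr0 ler01.
- by exists r => x nrx; rewrite indicE memNset// => /Br.
Qed.

Lemma pairingZr w (c : R) psi : cube_integrable w -> testable psi ->
  pairing w (fun x => c * psi x) = c * pairing w psi.
Proof.
move=> lw t; rewrite /pairing -RintegralZl//; last exact: integrable_pairing.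
by apply: eq_Rintegral => x _; rewrite mulrCA.
Qed.

Lemma pairing0r w : pairing w (fun=> 0) = 0.
Proof.
rewrite /pairing /Rintegral (_ : (fun x => _) = fun=> 0%E); last first.
  by apply/funext => x; rewrite mulr0.
by rewrite integral0.
Qed.

Lemma pairing_sum w (I : Type) (s : seq I) (F : I -> 'rV[R]_n -> R) :
  cube_integrable w -> (forall i, testable (F i)) ->
  pairing w (fun x => \sum_(i <- s) F i x) = \sum_(i <- s) pairing w (F i).
Proof.
move=> lw H; elim: s => [|i s IH].
  by rewrite big_nil; under [X in pairing _ X]eq_fun do rewrite big_nil; exact: pairing0r.
rewrite big_cons -IH -pairingDr//; last exact: testable_sum.
by congr pairing; apply/funext => x; rewrite big_cons.
Qed.

Lemma le_pairing w1 psi1 w2 psi2 : cube_integrable w1 -> testable psi1 ->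
  cube_integrable w2 -> testable psi2 ->
  (forall x, w1 x * psi1 x <= w2 x * psi2 x) ->
  pairing w1 psi1 <= pairing w2 psi2.
Proof.
by move=> l1 t1 l2 t2 H; apply: le_Rintegral => //; exact: integrable_pairing.
Qed.

Lemma pairing_shift w psi (c : 'rV[R]_n) : cube_integrable w -> testable psi ->
  pairing (fun x => w (x + c)) psi = pairing w (fun x => psi (x - c)).
Proof.
move=> lw tpsi.
have := integral_shift c (integrable_pairing lw (testable_shift (- c) tpsi)).
rewrite /pairing /Rintegral => /= <-; congr fine.
by apply: eq_integral => x _; rewrite addrK.
Qed.

Lemma pairingDl w1 w2 psi : cube_integrable w1 -> cube_integrable w2 ->
  testable psi ->
  pairing (fun x => w1 x + w2 x) psi = pairing w1 psi + pairing w2 psi.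
Proof.
move=> l1 l2 t; rewrite /pairing -RintegralD//; try exact: integrable_pairing.
by apply: eq_Rintegral => x _; rewrite mulrDl.
Qed.

Lemma pairingZl w (c : R) psi : cube_integrable w -> testable psi ->
  pairing (fun x => c * w x) psi = c * pairing w psi.
Proof.
move=> lw t; rewrite /pairing -RintegralZl//; last exact: integrable_pairing.
by apply: eq_Rintegral => x _; rewrite mulrA.
Qed.

Lemma pairing0l psi : pairing (fun=> 0) psi = 0.
Proof.
rewrite /pairing /Rintegral (_ : (fun x => _) = fun=> 0%E); last first.
  by apply/funext => x; rewrite mul0r.
by rewrite integral0.
Qed.

Lemma pairing_suml (I : Type) (s : seq I) (F : I -> 'rV[R]_n -> R) psi :
  (forall i, cube_integrable (F i)) -> testable psi ->
  pairing (fun x => \sum_(i <- s) F i x) psi = \sum_(i <- s) pairing (F i) psi.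
Proof.
move=> H t; elim: s => [|i s IH].
  by rewrite big_nil; under [X in pairing X]eq_fun do rewrite big_nil; exact: pairing0l.
rewrite big_cons -IH -pairingDl//; last exact: cube_integrable_sum.
by congr pairing; apply/funext => x; rewrite big_cons.
Qed.

(** [K] is the integral of |w| over the cube. It does not depend on [psi], so test functions that
    vary with a parameter get a uniform bound. *)
Lemma pairing_bounded w r : cube_integrable w -> exists2 K, 0 <= K &
  forall psi C, testable psi -> 0 <= C -> supp_in r psi ->
  (forall x, `|psi x| <= C) -> `|pairing w psi| <= C * K.
Proof.
move=> lw.
have mc := @measurable_cube R n r.
have lw' : cube_integrable (fun x => `|w x|).
  case: lw => mw iw; split; first exact: measurableT_comp.
  by move=> s; have := integrable_norm (iw s); exact.
have t1 := testable_indic mc (@subset_refl _ _).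
exists (pairing (fun x => `|w x|) \1_(cube r)).
  by apply: Rintegral_ge0 => x _; rewrite mulr_ge0.
move=> psi C tpsi C0 spsi bpsi.
have H x : `|w x * psi x| <= C * (`|w x| * \1_(cube r) x).
  rewrite normrM indicE; have [xr|xr] := pselect (cube r x).
    by rewrite mem_set// mulr1 mulrC ler_wpM2r.
  by rewrite spsi// memNset// normr0 !mulr0.
rewrite -pairingZl//.
have l2 := cube_integrableZ C lw'.
rewrite ler_norml; apply/andP; split.
  have t2 : testable (fun x => -1 * \1_(cube r) x) := testableZ (-1) t1.
  rewrite -mulN1r -pairingZr//; apply: le_pairing => // x.
  rewrite mulrCA -mulrA mulN1r lerNl (le_trans _ (H x))//.
  by rewrite -normrN ler_norm.
apply: le_pairing => // x.
by rewrite -mulrA (le_trans _ (H x))// ler_norm.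
Qed.

End pairing.

Section smooth_derivatives.
Context {R : realType} (n : nat).
Implicit Types (phi : 'rV[R]_n -> R) (dphi : 'I_n -> 'rV[R]_n -> R).

Lemma norm_delta_mx (i : 'I_n) : `|delta_mx 0 i : 'rV[R]_n| <= 1.
Proof.
apply/rV_normP => // j; rewrite mxE eqxx /=.
by case: (j == i); rewrite ?normr1// normr0.
Qed.

Definition ddir (dphi : 'I_n -> 'rV[R]_n -> R) (e x : 'rV[R]_n) : R :=
  \sum_i e 0 i * dphi i x.

Lemma smooth_taylor_dir phi dphi : smooth phi dphi -> exists2 C, 0 <= C &
  forall (x e : 'rV[R]_n) (t : R), `|e| <= 1 ->
    `|phi (x + t *: e) - phi x - t * ddir dphi e x| <= C * t ^+ 2.
Proof.
move=> [_ _ _ _ _ _ [C C0 H]]; exists C => // x e t e1.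
have := H (x, t *: e); rewrite /= (_ : \sum_i _ = t * ddir dphi e x); last first.
  by rewrite mulr_sumr; apply: eq_bigr => i _; rewrite mxE mulrA.
move=> /le_trans; apply; rewrite ler_wpM2l// normrZ mulrACA -expr2 -normrX.
rewrite ger0_norm ?sqr_ge0// ler_piMr ?sqr_ge0//.
by rewrite mulr_ile1.
Qed.

Lemma ddir_delta dphi i x : ddir dphi (delta_mx 0 i) x = dphi i x.
Proof.
rewrite /ddir (bigD1 i)//= mxE !eqxx mul1r big1 ?addr0// => j ji.
by rewrite mxE (negbTE ji) andbF mul0r.
Qed.

Lemma smooth_d_supp phi dphi r i : smooth phi dphi -> supp_in r phi ->
  supp_in r (dphi i).
Proof.
move=> sp sr x nx.
have [C C0 H] := smooth_taylor_dir sp.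
have rx : r < `|x| by rewrite ltNge; apply/negP.
apply/eqP; rewrite -normr_le0; apply/ler_addgt0Pr => e e0; rewrite add0r.
(* The first bound keeps x + t e_i outside the closed cube, so both values of [phi] vanish and
   Taylor leaves |t dphi_i(x)| <= C t^2; the second makes C t at most e. *)
pose t := Num.min ((`|x| - r) / 2) (e / (C + 1)).
have C1 : 0 < C + 1 by rewrite ltr_wpDl.
have t0 : 0 < t by rewrite lt_min !divr_gt0// subr_gt0.
have tx : t < `|x| - r.
  rewrite (@le_lt_trans _ _ ((`|x| - r) / 2)) ?ge_min ?lexx//.
  by rewrite ltr_pdivrMr// ltr_pMr ?subr_gt0// ltr1n.
have te : C * t <= e.
  apply: (@le_trans _ _ ((C + 1) * (e / (C + 1)))).
    by apply: ler_pM => //; [exact: ltW|rewrite lerDl|rewrite ge_min lexx orbT].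
  by rewrite mulrCA divff ?mulr1// gt_eqF.
have := H x (delta_mx 0 i) t (norm_delta_mx i); rewrite ddir_delta.
rewrite (sr x nx) (sr (x + _)); last first.
  rewrite /cube /= => h.
  have := ler_normB (x + t *: delta_mx 0 i) (t *: delta_mx 0 i).
  rewrite addrK normrZ (gtr0_norm t0) => h2.
  have : t * `|delta_mx 0 i : 'rV[R]_n| <= t.
    by apply: ler_piMr; [exact: ltW|exact: norm_delta_mx].
  by lra.
rewrite subrr sub0r normrN normrM (gtr0_norm t0) expr2 mulrCA ler_pM2l// => h.
exact: le_trans h te.
Qed.

Lemma smooth_is_derive phi dphi i x : smooth phi dphi ->
  is_derive x (delta_mx 0 i) phi (dphi i x).
Proof.
move=> sp; have [C C0 H] := smooth_taylor_dir sp.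
have cv : h^-1 *: (phi (h *: delta_mx 0 i + x) - phi x) @[h --> 0^'] --> dphi i x.
  have C1 : 0 < C + 1 by rewrite ltr_wpDl.
  apply/cvgrPdist_le => e e0; near=> h.
  have h0 : h != 0 by near: h; exact: nbhs_dnbhs_neq.
  have -> : dphi i x - h^-1 *: (phi (h *: delta_mx 0 i + x) - phi x) =
     - (h^-1 * (phi (x + h *: delta_mx 0 i) - phi x - h * dphi i x)).
    rewrite [h *: _ + x]addrC; set D := phi _ - phi x.
    rewrite (_ : h^-1 *: D = h^-1 * D); last by [].
    by field.
  rewrite normrN normrM normfV ler_pdivrMl ?normr_gt0//.
  have := H x (delta_mx 0 i) h (norm_delta_mx i); rewrite ddir_delta.
  move=> /le_trans; apply; rewrite -(real_normK (num_real h)) expr2 mulrCA ler_wpM2l//.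
  rewrite (@le_trans _ _ ((C + 1) * `|h|)) ?ler_wpM2r ?lerDl//.
  rewrite mulrC -ler_pdivlMr//.
  near: h; apply: dnbhs0_le; exact: divr_gt0.
split; first by apply/cvg_ex; exists (dphi i x).
exact: cvg_lim cv.
Unshelve. all: by end_near. Qed.

Lemma smooth_partial phi dphi i : smooth phi dphi -> partial i phi = dphi i.
Proof.
move=> sp; apply/funext => x; rewrite /partial.
by have [] := smooth_is_derive i x sp.
Qed.

Lemma smooth_C1c phi dphi r V : smooth phi dphi -> supp_in r phi ->
  cube r `<=` V -> C1c V phi.
Proof.
move=> sp sr rV; split; last first.
  by exists (cube r); split => //; exact: cube_compact.
move=> i; split => [x|]; first by have [] := smooth_is_derive i x sp.
rewrite (smooth_partial i sp) => x.
have [C C0 H] := smooth_dlip sp i.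
have C1 : 0 < C + 1 by rewrite ltr_wpDl.
apply/(@cvgrPdist_le _ _ _ _ (nbhs_filter x)) => e e0.
apply/nbhs_ballP; exists (e / (C + 1)) => /=; first exact: divr_gt0.
move=> y; rewrite mx_norm_ball /ball_ /= => xy.
have := H (x, y - x); rewrite /= (addrC x) subrK => h.
rewrite distrC (le_trans h)//.
rewrite (@le_trans _ _ ((C + 1) * `|y - x|)) ?ler_wpM2r ?lerDl//.
by rewrite mulrC -ler_pdivlMr// distrC ltW.
Qed.

Lemma smooth_testable phi dphi r : smooth phi dphi -> supp_in r phi -> testable phi.
Proof. by move=> [mp _ bp _ _ _ _] sr; split => //; exists r. Qed.

Lemma smooth_d_testable phi dphi r i : smooth phi dphi -> supp_in r phi ->
  testable (dphi i).
Proof.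
move=> sp sr; split; [exact: smooth_dmeas sp i|exact: smooth_dbdd sp i|].
by exists r; exact: (smooth_d_supp i sp sr).
Qed.

Lemma ddir_testable phi dphi r e : smooth phi dphi -> supp_in r phi ->
  testable (ddir dphi e).
Proof.
move=> sp sr; apply: (@testable_sum _ _ _ _ (fun i x => e 0 i * dphi i x)) => i.
by apply: testableZ; exact: (smooth_d_testable i sp sr).
Qed.

Lemma ddir_supp phi dphi r e : smooth phi dphi -> supp_in r phi ->
  supp_in r (ddir dphi e).
Proof.
move=> sp sr x h; rewrite /ddir big1// => i _.
by rewrite (smooth_d_supp i sp sr h) mulr0.
Qed.

End smooth_derivatives.

Section telescope.
Context {R : realType}.

(** A mean value inequality without derivatives. Cutting [0, h] into N steps, the quadratic errors
    add up to C h^2 / N, which disappears as N grows, and only the deviation of [D] from [d]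
    remains. *)
Lemma increment_bound (G D : R -> R) (h d B C : R) : 0 <= h -> 0 <= C ->
  (forall s k, 0 <= s -> 0 <= k -> s + k <= h ->
     `|G (s + k) - G s - k * D s| <= C * k ^+ 2) ->
  (forall s, 0 <= s <= h -> `|D s - d| <= B) ->
  `|G h - G 0 - h * d| <= h * B.
Proof.
move=> h0 C0 HG HD.
have step N (j : nat) : (0 < N)%N -> (j <= N)%N ->
    `|G (j%:R * (h / N%:R)) - G 0 - j%:R * (h / N%:R) * d| <=
    j%:R * ((h / N%:R) * B + C * (h / N%:R) ^+ 2).
  move=> N0; set k := h / N%:R; elim: j => [_|j IH jN].
    by rewrite !mul0r subrr subr0 normr0.
  have Npos : 0 < N%:R :> R by rewrite ltr0n.
  have k0 : 0 <= k by rewrite divr_ge0// ltW.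
  have jk : j%:R * k + k <= h.
    rewrite -[X in _ + X]mul1r -mulrDl natr1 /k mulrA ler_pdivrMr//.
    by rewrite [leRHS]mulrC ler_wpM2r// ler_nat.
  have s0 : 0 <= j%:R * k by rewrite mulr_ge0.
  have h1 := HG _ _ s0 k0 jk.
  have h2 : `|D (j%:R * k) - d| <= B.
    by apply: HD; rewrite s0 /= (le_trans _ jk)// lerDl.
  have h3 : `|k * (D (j%:R * k) - d)| <= k * B.
    by rewrite normrM (ger0_norm k0) ler_wpM2l.
  have := IH (ltnW jN).
  have -> : j.+1%:R * k = j%:R * k + k by rewrite -natr1 mulrDl mul1r.
  have -> : G (j%:R * k + k) - G 0 - (j%:R * k + k) * d =
    (G (j%:R * k) - G 0 - j%:R * k * d) +
    ((G (j%:R * k + k) - G (j%:R * k) - k * D (j%:R * k)) +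
     k * (D (j%:R * k) - d)) by ring.
  move=> h4; rewrite (le_trans (ler_normD _ _))// -natr1 mulrDl mul1r lerD//.
  by rewrite (le_trans (ler_normD _ _))// addrC lerD.
apply/ler_addgt0Pr => e e0.
pose N := (Num.truncn (C * h ^+ 2 / e)).+1.
have Npos : 0 < N%:R :> R by rewrite ltr0n.
have := step N N isT (leqnn N).
have -> : N%:R * (h / N%:R) = h by rewrite mulrC divfK// gt_eqF.
move=> /le_trans; apply.
rewrite mulrDr mulrA [N%:R * _]mulrC divfK ?gt_eqF// lerD2l.
have -> : N%:R * (C * (h / N%:R) ^+ 2) = C * h ^+ 2 / N%:R.
  by field; rewrite gt_eqF.
rewrite ler_pdivrMr// [leRHS]mulrC -ler_pdivrMr//.
exact/ltW/truncnS_gt.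
Qed.

End telescope.

Section volume.
Context {R : realType} (n : nat).
Notation mu := (@lebesgue_rV R n).
Implicit Types (A B : set 'rV[R]_n) (w psi : 'rV[R]_n -> R).

(* Only meaningful for [B] of finite measure: [fine] sends +oo to 0. *)
Definition vol B : R := fine (mu B).

Lemma vol_ge0 B : 0 <= vol B.
Proof. exact: fine_ge0. Qed.

Lemma vol_fin r B : measurable B -> B `<=` cube r -> (vol B)%:E = mu B.
Proof.
move=> mB Br; rewrite /vol fineK// ge0_fin_numE//.
apply: le_lt_trans (cube_fin n r); apply: le_measure => //; rewrite inE//.
exact: measurable_cube.
Qed.

Lemma vol0 : vol set0 = 0.
Proof. by rewrite /vol measure0. Qed.

Lemma le_vol r A B : measurable A -> measurable B -> B `<=` cube r ->
  A `<=` B -> vol A <= vol B.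
Proof.
move=> mA mB Br AB; rewrite -lee_fin (vol_fin mB Br).
rewrite (vol_fin mA (subset_trans AB Br)).
by apply: le_measure => //; rewrite inE.
Qed.

Lemma vol_setU_le r A B : measurable A -> measurable B ->
  A `<=` cube r -> B `<=` cube r -> vol (A `|` B) <= vol A + vol B.
Proof.
move=> mA mB Ar Br; have ABr : A `|` B `<=` cube r by rewrite subUset.
rewrite -lee_fin EFinD (vol_fin mA Ar) (vol_fin mB Br).
rewrite (vol_fin (measurableU _ _ mA mB) ABr); exact: measureU2.
Qed.

Lemma vol_setU r A B : measurable A -> measurable B ->
  A `<=` cube r -> B `<=` cube r -> A `&` B = set0 ->
  vol (A `|` B) = vol A + vol B.
Proof.
move=> mA mB Ar Br AB0; have ABr : A `|` B `<=` cube r by rewrite subUset.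
apply: EFin_inj; rewrite EFinD (vol_fin mA Ar) (vol_fin mB Br).
by rewrite (vol_fin (measurableU _ _ mA mB) ABr) measureU.
Qed.

Lemma vol_shift (c : 'rV[R]_n) B : measurable B ->
  vol ((fun x => x + c) @^-1` B) = vol B.
Proof. by move=> mB; rewrite /vol lebesgue_rV_shift. Qed.

Lemma measurable_preimage_shift (c : 'rV[R]_n) B : measurable B ->
  measurable ((fun x => x + c) @^-1` B).
Proof. by move=> mB; rewrite -[X in measurable X]setTI; exact: measurable_shift. Qed.

Lemma pairing_cst_indic (c : R) r B : measurable B -> B `<=` cube r ->
  pairing (fun=> c) \1_B = c * vol B.
Proof.
move=> mB Br; rewrite /pairing /vol -(Rintegral_cst _ mB) [RHS]Rintegral_mkcond.
apply: eq_Rintegral => x _; rewrite patchE indicE.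
by case: (x \in B); rewrite ?mulr1 ?mulr0.
Qed.

Lemma cube_integrable_cst (c : R) : cube_integrable (fun _ : 'rV[R]_n => c).
Proof. by apply: cube_integrable_bounded => // r; exists `|c|. Qed.

Lemma cube_integrable_opp w : cube_integrable w -> cube_integrable (fun x => - w x).
Proof.
move=> lw; rewrite (_ : (fun x => _) = fun x => -1 * w x); last first.
  by apply/funext => x; rewrite mulN1r.
exact: cube_integrableZ.
Qed.

Lemma cube_integrableB w1 w2 : cube_integrable w1 -> cube_integrable w2 ->
  cube_integrable (fun x => w1 x - w2 x).
Proof. by move=> l1 l2; apply: cube_integrableD => //; exact: cube_integrable_opp. Qed.

Lemma pairingNl w psi : cube_integrable w -> testable psi ->
  pairing (fun x => - w x) psi = - pairing w psi.
Proof.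
move=> lw t; rewrite -mulN1r -pairingZl//; congr pairing.
by apply/funext => x; rewrite mulN1r.
Qed.

Lemma pairingBl w1 w2 psi : cube_integrable w1 -> cube_integrable w2 ->
  testable psi ->
  pairing (fun x => w1 x - w2 x) psi = pairing w1 psi - pairing w2 psi.
Proof.
move=> l1 l2 t; rewrite (pairingDl l1 (cube_integrable_opp l2) t).
by rewrite pairingNl.
Qed.

(** Take a smooth [phi] equal to the indicator off a small set [E] and multiply it by a cutoff. The
    product differs from the indicator only on [E] within the larger cube, where |w| <= L, so the
    error is at most L times the measure of that set. [K] is unchanged in the limit. *)
Lemma pairing_indic_le w r L K B : 0 <= r -> 0 <= L -> cube_integrable w ->
  (forall x, cube (r + 1) x -> `|w x| <= L) ->
  (forall phi dphi, smooth phi dphi -> (forall x, 0 <= phi x <= 1) ->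
    supp_in (r + 1) phi -> pairing w phi <= K) ->
  measurable B -> B `<=` cube r -> pairing w \1_B <= K.
Proof.
move=> r0 L0 lw wL H mB Br; apply/ler_addgt0Pr => e e0.
have L1 : 0 < L + 1 by rewrite ltr_wpDl.
have eL : 0 < e / (L + 1) by rewrite divr_gt0.
have [_ /(_ _ eL)] := approximable_measurable (r + 1) mB.
move=> [phi [dphi [E [sp p01 mE Ee h]]]].
have [chi [dchi [sc c01 c1 c0]]] := @smooth_cutoff R n r r0.
have spc := smoothM sp sc.
have pc01 x : 0 <= phi x * chi x <= 1.
  have /andP[? ?] := p01 x; have /andP[? ?] := c01 x.
  by rewrite mulr_ge0//= mulr_ile1.
have supp : supp_in (r + 1) (fun x => phi x * chi x).
  by move=> x /c0 ->; rewrite mulr0.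
have mc := @measurable_cube R n (r + 1).
have mEc : measurable (E `&` cube (r + 1)) by exact: measurableI.
have tE := testable_indic mEc (@subIsetr _ _ _).
have tB := testable_indic mB Br.
have tp := smooth_testable spc supp.
have volE : vol (E `&` cube (r + 1)) <= e / (L + 1).
  by rewrite -lee_fin (vol_fin mEc (@subIsetr _ _ _)).
apply: (@le_trans _ _ (pairing w (fun x => phi x * chi x) +
    L * pairing (fun=> 1) \1_(E `&` cube (r + 1)))); last first.
  rewrite (pairing_cst_indic 1 mEc (@subIsetr _ _ _)) mul1r; apply: lerD.
    exact: H spc _ _.
  apply: (@le_trans _ _ ((L + 1) * (e / (L + 1)))).
    by apply: ler_pM => //; [exact: vol_ge0|rewrite lerDl].
  by rewrite mulrCA divff ?mulr1// gt_eqF.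
rewrite -lerBlDl -pairingZl//; last exact: cube_integrable_cst.
have -> : pairing w \1_B - pairing w (fun x => phi x * chi x) =
    pairing w (fun x => \1_B x + -1 * (phi x * chi x)).
  rewrite pairingDr//; last exact: testableZ.
  by rewrite pairingZr// mulN1r.
apply: le_pairing => //.
- by apply: testableD => //; exact: testableZ.
- exact: cube_integrableZ (cube_integrable_cst 1).
move=> x; rewrite mulr1 mulN1r.
have [cx|ncx] := pselect (cube (r + 1) x); last first.
  rewrite !indicE !memNset; last 2 first.
  - by move=> [].
  - by move=> /Br; apply: contra_not ncx; apply: sub_cube; rewrite lerDl.
  by rewrite supp// subrr !mulr0.
have [Ex|nEx] := pselect (E x).
  rewrite [\1_(_ `&` _) x]indicE mem_set// mulr1.
  rewrite (le_trans (ler_norm _))// normrM -[leRHS]mulr1 ler_pM//; first exact: wL.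
  have /andP[? ?] := pc01 x; rewrite indicE ler_norml.
  by case: (x \in B) => /=; apply/andP; split; lra.
rewrite [\1_(_ `&` _) x]indicE memNset; last by move=> [].
rewrite mulr0 (h x nEx) indicE.
have [Bx|nBx] := pselect (B x); last by rewrite memNset// mul0r subrr mulr0.
by rewrite mem_set// c1 ?mulr1 ?subrr ?mulr0//; exact: Br.
Qed.

Lemma continuous_bounded_cube (f : 'rV[R]_n -> R) r : continuous f ->
  exists2 C, 0 <= C & forall x, cube r x -> `|f x| <= C.
Proof.
move=> cf.
have : compact (f @` cube r).
  apply: continuous_compact; last exact: cube_compact.
  exact: continuous_subspaceT.
move=> /compact_bounded[M [Mr HM]].
exists (`|M| + 1) => [|x cx]; first by rewrite addr_ge0.
apply: (HM (`|M| + 1)); last by exists x.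
by rewrite (le_lt_trans (ler_norm M))// ltrDl.
Qed.

End volume.

Section increments.
Context {R : realType} (n : nat).
Implicit Types (phi w : 'rV[R]_n -> R) (dphi : 'I_n -> 'rV[R]_n -> R)
  (e : 'rV[R]_n).

Lemma coor_le1 e i : `|e| <= 1 -> `|e 0 i| <= 1.
Proof. exact: le_trans (coor_le_norm e i). Qed.

Lemma norm_step_le1 e (s : R) : `|e| <= 1 -> 0 <= s -> s <= 1 -> `|s *: e| <= 1.
Proof. by move=> e1 s0 s1; rewrite normrZ ger0_norm// mulr_ile1. Qed.

Lemma supp_in_step r psi e (s : R) : `|e| <= 1 -> 0 <= s -> s <= 1 ->
  supp_in r psi -> supp_in (r + 1) (fun x => psi (x - s *: e)).
Proof.
move=> e1 s0 s1; apply: supp_in_shift; rewrite normrN; exact: norm_step_le1.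
Qed.

(** The parameter moves only the test function. Its Taylor remainder lives in the cube of half-side
    r + 1 and is uniformly O(k^2), so integrability of [w] is enough; this is the expansion required
    by [increment_bound]. *)
Lemma pairing_step w phi dphi r e : cube_integrable w -> smooth phi dphi ->
  supp_in r phi -> `|e| <= 1 -> exists2 C, 0 <= C & forall s k : R,
  0 <= s -> 0 <= k -> s + k <= 1 ->
  `|pairing w (fun x => phi (x - (s + k) *: e)) -
    pairing w (fun x => phi (x - s *: e)) -
    k * - pairing w (fun x => ddir dphi e (x - s *: e))| <= C * k ^+ 2.
Proof.
move=> lw sp sr e1.
have [C C0 H] := smooth_taylor_dir sp.
have [K K0 HK] := pairing_bounded (r + 1) lw.
exists (C * K) => [|s k s0 k0 sk]; first exact: mulr_ge0.
have s1 : s <= 1 by rewrite (le_trans _ sk)// lerDl.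
have tp c := testable_shift c (smooth_testable sp sr).
have td c := testable_shift c (ddir_testable e sp sr).
pose psi x := phi (x - (s + k) *: e) +
  (-1 * phi (x - s *: e) + k * ddir dphi e (x - s *: e)).
have tpsi : testable psi.
  by apply: testableD => //; apply: testableD; exact: testableZ.
have psiE x : psi x = phi (x - s *: e + (- k) *: e) - phi (x - s *: e) -
    (- k) * ddir dphi e (x - s *: e).
  rewrite /psi (_ : x - (s + k) *: e = x - s *: e + (- k) *: e); first by ring.
  by rewrite scalerDl scaleNr opprD addrA.
have -> : pairing w (fun x => phi (x - (s + k) *: e)) -
    pairing w (fun x => phi (x - s *: e)) -
    k * - pairing w (fun x => ddir dphi e (x - s *: e)) = pairing w psi.
  rewrite /psi pairingDr//; last by apply: testableD; exact: testableZ.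
  rewrite pairingDr//; [|exact: testableZ|exact: testableZ].
  by rewrite !pairingZr//; ring.
rewrite mulrAC; apply: HK => //.
- by rewrite mulr_ge0// sqr_ge0.
- move=> x nx; have sk0 : 0 <= s + k by rewrite addr_ge0.
  rewrite /psi (supp_in_step e1 sk0 sk sr nx) (supp_in_step e1 s0 s1 sr nx).
  by rewrite (supp_in_step e1 s0 s1 (ddir_supp e sp sr) nx) !mulr0 !addr0.
- by move=> x; rewrite psiE -[X in C * X]sqrrN; exact: H.
Qed.

End increments.

(** * Displacement estimates *)

(* [g] is the gradient of [u], modified on a null set so that all its values
   lie in the finite set. *)
Record admissible {R : realType} n (u : 'rV[R]_n -> R) (g : 'rV[R]_n -> 'rV[R]_n) : Prop :=
  Admissible {
    adm_cont : continuous u;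
    adm_meas : measurable_fun setT u;
    adm_gmeas : forall i, measurable_fun setT (fun x => g x 0 i);
    adm_gfin : finite_set (range g);
    adm_grad : forall i phi dphi r, smooth phi dphi -> supp_in r phi ->
      pairing u (dphi i) = - pairing (fun x => g x 0 i) phi;
    adm_bv : forall r, exists2 M, 0 <= M & forall i j phi dphi,
      smooth phi dphi -> supp_in r phi -> (forall x, `|phi x| <= 1) ->
      `|pairing (fun x => g x 0 i) (dphi j)| <= M }.

Section admissible.
Context {R : realType} (n : nat) (u : 'rV[R]_n -> R) (g : 'rV[R]_n -> 'rV[R]_n).
Hypothesis ug : admissible u g.
Implicit Types (B : set 'rV[R]_n) (e c : 'rV[R]_n) (h r s : R).

Lemma adm_bounded : exists2 L, 0 <= L & forall x i, `|g x 0 i| <= L.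
Proof.
have [s gs] := (finite_seqP _).1 (adm_gfin ug).
exists (\sum_(y <- s) `|y|) => [|x i]; first exact: sumr_ge0.
rewrite (le_trans (coor_le_norm _ _))//.
have xs : g x \in s by have : range g (g x) by [exists x]; rewrite gs.
by rewrite (big_rem _ xs)/= lerDl sumr_ge0.
Qed.

(** Finitely many values have finitely many positive coordinate differences. The gap converts bounds
    on integrals of increments into bounds on the volume of the set where [g] changes. *)
Lemma adm_gap : exists2 d, 0 < d & forall x y i,
  g x 0 i < g y 0 i -> d <= g y 0 i - g x 0 i.
Proof.
have fin : finite_set [set t : R | 0 < t /\ exists x y i, t = g y 0 i - g x 0 i].
  apply: (@sub_finite_set _ _ ((fun p : ('rV[R]_n * 'rV[R]_n) * 'I_n =>
    p.1.2 0 p.2 - p.1.1 0 p.2) @` ((range g `*` range g) `*` setT))).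
    move=> t [_ [x [y [i ->]]]]; exists ((g x, g y), i) => //=.
    by split => //; split; [exists x|exists y].
  apply: finite_image; apply: finite_setX; last exact: finite_finset.
  by apply: finite_setX; exact: adm_gfin ug.
have [s gs] := (finite_seqP _).1 fin.
have : exists2 d, 0 < d & forall t, t \in s -> d <= t.
  have : forall t, t \in s -> 0 < t.
    move=> t ts; have : [set` s] t by [].
    by rewrite -gs => -[].
  clear gs; elim: s => [|a l IH] H; first by exists 1.
  have [|d d0 Hd] := IH; first by move=> t tl; apply: H; rewrite inE tl orbT.
  exists (Num.min d a) => [|t]; first by rewrite lt_min d0 H// inE eqxx.
  rewrite inE => /predU1P[->|/Hd]; rewrite ge_min ?lexx ?orbT//.
  by move=> ->.
move=> [d d0 H]; exists d => // x y i xy; apply: H.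
have : [set` s] (g y 0 i - g x 0 i).
  by rewrite -gs; split; [rewrite subr_gt0|exists x, y, i].
by [].
Qed.

Lemma adm_lg i : cube_integrable (fun x => g x 0 i).
Proof.
have [L L0 HL] := adm_bounded; apply: cube_integrable_bounded.
  exact: adm_gmeas ug i.
by move=> r; exists L.
Qed.

Lemma adm_lu : cube_integrable u.
Proof.
apply: cube_integrable_bounded; first exact: adm_meas ug.
by move=> r; have [C _ H] := continuous_bounded_cube r (adm_cont ug); exists C.
Qed.

Lemma adm_ldotg e : cube_integrable (fun x => dotr (g x) e).
Proof.
apply: cube_integrable_sum => i.
rewrite (_ : (fun x => _) = fun x => e 0 i * g x 0 i); last first.
  by apply/funext => x; rewrite mulrC.
by apply: cube_integrableZ; exact: adm_lg.
Qed.

Lemma pairing_dotg e psi : testable psi ->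
  pairing (fun x => dotr (g x) e) psi = \sum_i e 0 i * pairing (fun x => g x 0 i) psi.
Proof.
move=> t; rewrite /dotr pairing_suml//; last first.
  move=> i; rewrite (_ : (fun x => _) = fun x => e 0 i * g x 0 i); last first.
    by apply/funext => x; rewrite mulrC.
  by apply: cube_integrableZ; exact: adm_lg.
apply: eq_bigr => i _; rewrite -pairingZl//; last exact: adm_lg.
by congr pairing; apply/funext => x; rewrite mulrC.
Qed.

Lemma sum_bound (F : 'I_n -> R) K : (forall i, `|F i| <= K) ->
  `|\sum_i F i| <= n%:R * K.
Proof.
move=> H; rewrite (le_trans (ler_norm_sum _ _ _))//.
rewrite (le_trans (ler_sum _ (fun i _ => H i)))//.
by rewrite sumr_const card_ord mulr_natl.
Qed.

(** The translation estimate for BV functions: differentiating the translated test function along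
    [e] gives n partial derivatives with coefficients at most 1, each controlled by the variation
    bound on the cube enlarged by the length of the shift. *)
Lemma adm_grad_shift r : exists2 M, 0 <= M & forall i phi dphi e h,
  smooth phi dphi -> (forall x, `|phi x| <= 1) -> supp_in r phi -> `|e| <= 1 ->
  0 <= h -> h <= 1 ->
  `|pairing (fun x => g x 0 i) (fun x => phi (x - h *: e)) -
    pairing (fun x => g x 0 i) phi| <= M * h.
Proof.
have [M M0 HM] := adm_bv ug (r + 1).
exists (n%:R * M) => [|i phi dphi e h sp p1 sr e1 h0 h1]; first exact: mulr_ge0.
have [C C0 HC] := pairing_step (adm_lg i) sp sr e1.
have := @increment_bound R
  (fun s => pairing (fun x => g x 0 i) (fun x => phi (x - s *: e)))
  (fun s => - pairing (fun x => g x 0 i) (fun x => ddir dphi e (x - s *: e)))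
  h 0 (n%:R * M) C h0 C0.
rewrite mulr0 subr0 scale0r; under [X in _ - pairing _ X]eq_fun do rewrite subr0.
rewrite [h * _]mulrC; apply.
  by move=> s k s0 k0 sk; apply: HC => //; exact: le_trans sk h1.
move=> s /andP[s0 sh]; rewrite subr0 normrN.
have s1 := le_trans sh h1.
have sps := smooth_shift (- (s *: e)) sp.
have srs := supp_in_step e1 s0 s1 sr.
rewrite /ddir (@pairing_sum _ _ _ _ _ (fun j x => e 0 j * dphi j (x - s *: e))); last 2 first.
- exact: adm_lg.
- by move=> j; apply: testableZ; exact: (smooth_d_testable j sps srs).
apply: sum_bound => j; rewrite pairingZr; last 2 first.
- exact: adm_lg.
- exact: (smooth_d_testable j sps srs).
rewrite normrM -[leRHS]mul1r ler_pM//; first exact: coor_le1.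
exact: (HM i j _ _ sps srs).
Qed.

(** The derivative in s of the pairing of u with the translate of [phi] by s e is the pairing of g.e
    with that translate; by [adm_grad_shift] it stays within O(h) of its value at s = 0, and
    integrating over [0, h] gives O(h^2). *)
Lemma adm_u_shift r : exists2 M, 0 <= M & forall phi dphi e h,
  smooth phi dphi -> (forall x, `|phi x| <= 1) -> supp_in r phi -> `|e| <= 1 ->
  0 <= h -> h <= 1 ->
  `|pairing u (fun x => phi (x - h *: e)) - pairing u phi -
    h * pairing (fun x => dotr (g x) e) phi| <= M * h ^+ 2.
Proof.
have [M M0 HM] := adm_grad_shift r.
exists (n%:R * M) => [|phi dphi e h sp p1 sr e1 h0 h1]; first exact: mulr_ge0.
have [C C0 HC] := pairing_step adm_lu sp sr e1.
have tp := smooth_testable sp sr.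
have := @increment_bound R
  (fun s => pairing u (fun x => phi (x - s *: e)))
  (fun s => - pairing u (fun x => ddir dphi e (x - s *: e)))
  h (pairing (fun x => dotr (g x) e) phi) (n%:R * M * h) C h0 C0.
rewrite scale0r; under [X in _ - pairing u X]eq_fun do rewrite subr0.
rewrite (_ : n%:R * M * h ^+ 2 = h * (n%:R * M * h)); last by ring.
apply.
  by move=> s k s0 k0 sk; apply: HC => //; exact: le_trans sk h1.
move=> s /andP[s0 sh].
have s1 := le_trans sh h1.
have sps := smooth_shift (- (s *: e)) sp.
have srs := supp_in_step e1 s0 s1 sr.
rewrite /ddir (@pairing_sum _ _ _ _ _ (fun j x => e 0 j * dphi j (x - s *: e))); last 2 first.
- exact: adm_lu.
- by move=> j; apply: testableZ; exact: (smooth_d_testable j sps srs).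
rewrite pairing_dotg// -sumrN -sumrB -mulrA; apply: sum_bound => j.
rewrite pairingZr; last 2 first.
- exact: adm_lu.
- exact: (smooth_d_testable j sps srs).
rewrite (adm_grad ug j sps srs) mulrN opprK -mulrBr normrM -[leRHS]mul1r.
rewrite ler_pM//; first exact: coor_le1.
by rewrite (le_trans (HM j _ _ _ _ sp p1 sr e1 s0 s1))// ler_wpM2l.
Qed.

End admissible.

Section measurable_comparison.
Context {R : realType} d (T : measurableType d).

Lemma measurable_lt_set (f1 f2 : T -> R) : measurable_fun setT f1 -> measurable_fun setT f2 ->
  measurable [set x | f1 x < f2 x].
Proof.
move=> m1 m2; rewrite (_ : [set x | _] = (fun x => f1 x < f2 x) @^-1` [set true]).
  by rewrite -[X in measurable X]setTI; exact: measurable_fun_ltr.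
by apply/seteqP; split => x /=.
Qed.

Lemma measurable_eq_set (f1 f2 : T -> R) : measurable_fun setT f1 -> measurable_fun setT f2 ->
  measurable [set x | f1 x = f2 x].
Proof.
move=> m1 m2; rewrite (_ : [set x | _] = ~` ([set x | f1 x < f2 x] `|` [set x | f2 x < f1 x])).
  by apply: measurableC; apply: measurableU; exact: measurable_lt_set.
apply/seteqP; split => x /=; first by move=> ->; rewrite ltxx => -[].
by move=> h; case: (ltgtP (f1 x) (f2 x)) => // lt; exfalso; apply: h; [left|right].
Qed.

End measurable_comparison.

Section admissible.
Context {R : realType} (n : nat) (u : 'rV[R]_n -> R) (g : 'rV[R]_n -> 'rV[R]_n).
Hypothesis ug : admissible u g.
Implicit Types (B : set 'rV[R]_n) (e c : 'rV[R]_n) (h r s : R).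

Lemma bdd01 (x : R) : 0 <= x <= 1 -> `|x| <= 1.
Proof. by move=> /andP[x0 x1]; rewrite ger0_norm. Qed.

Lemma adm_g_indic r : 0 <= r -> exists2 M, 0 <= M & forall i e h B,
  `|e| <= 1 -> 0 <= h -> h <= 1 -> measurable B -> B `<=` cube r ->
  `|pairing (fun x => g (x + h *: e) 0 i - g x 0 i) \1_B| <= M * h.
Proof.
move=> r0; have [M M0 HM] := adm_grad_shift ug (r + 1).
have [L L0 HL] := adm_bounded ug.
exists M => // i e h B e1 h0 h1 mB Br.
have lg := adm_lg ug i; have lgs := cube_integrable_shift (h *: e) lg.
have lw := cube_integrableB lgs lg.
have tB := testable_indic mB Br.
have L2 : 0 <= L + L by rewrite addr_ge0.
have bw x : `|g (x + h *: e) 0 i - g x 0 i| <= L + L.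
  by rewrite (le_trans (ler_normB _ _))// lerD.
have key phi dphi : smooth phi dphi -> (forall x, 0 <= phi x <= 1) ->
    supp_in (r + 1) phi ->
    `|pairing (fun x => g (x + h *: e) 0 i - g x 0 i) phi| <= M * h.
  move=> sp p01 sr; have tp := smooth_testable sp sr.
  rewrite (pairingBl lgs lg tp) (pairing_shift _ lg tp).
  by apply: (HM i _ _ _ _ sp) => // x; exact: bdd01.
rewrite ler_norml; apply/andP; split; last first.
  apply: (pairing_indic_le r0 L2 lw) => //.
  by move=> phi dphi sp p01 sr; rewrite (le_trans (ler_norm _))// (key _ dphi).
rewrite lerNl -pairingNl//.
apply: (pairing_indic_le r0 L2 (cube_integrable_opp lw)) => //.
  by move=> x _; rewrite normrN.
move=> phi dphi sp p01 sr; rewrite (pairingNl lw (smooth_testable sp sr)).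
by rewrite (le_trans _ (key _ dphi sp p01 sr))// -normrN ler_norm.
Qed.

Lemma measurable_g_shift i c : measurable_fun setT (fun x : 'rV[R]_n => g (x + c) 0 i).
Proof. exact: measurableT_comp (adm_gmeas ug i) (measurable_shift c). Qed.

Lemma measurable_g_neq c : measurable [set x : 'rV[R]_n | g (x + c) != g x].
Proof.
rewrite (_ : [set x | _] = \bigcup_(i in [set: 'I_n])
    ~` [set x : 'rV[R]_n | g (x + c) 0 i = g x 0 i]).
  apply: fin_bigcup_measurable => [|i _]; first exact: finite_finset.
  apply: measurableC; apply: measurable_eq_set; first exact: measurable_g_shift.
  exact: adm_gmeas ug i.
apply/seteqP; split => x /=.
  move=> /eqP h; apply: contrapT => h2; apply: h; apply/rowP => i.
  by apply: contrapT => h3; apply: h2; exists i.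
by move=> [i _ h]; apply/eqP => h2; apply: h; rewrite /= h2.
Qed.

(** Where g_i increases it does so by at least the gap d, so d times the volume of that set is at
    most the integrated increment, hence O(h). The same holds for decreases, and the 2n sets so
    obtained cover the set where [g] changes. *)
Lemma adm_g_neq r : 0 <= r -> exists2 M, 0 <= M & forall e h,
  `|e| <= 1 -> 0 <= h -> h <= 1 ->
  vol ([set x : 'rV[R]_n | g (x + h *: e) != g x] `&` cube r) <= M * h.
Proof.
move=> r0; have [M M0 HM] := adm_g_indic r0.
have [d d0 Hd] := adm_gap ug.
exists (n%:R * (M / d + M / d)) => [|e h e1 h0 h1].
  by rewrite mulr_ge0// addr_ge0// divr_ge0// ltW.
have mc := @measurable_cube R n r.
pose up i := [set x : 'rV[R]_n | g x 0 i < g (x + h *: e) 0 i] `&` cube r.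
pose dn i := [set x : 'rV[R]_n | g (x + h *: e) 0 i < g x 0 i] `&` cube r.
have mup i : measurable (up i).
  by apply: measurableI => //; apply: measurable_lt_set;
    [exact: adm_gmeas ug i|exact: measurable_g_shift].
have mdn i : measurable (dn i).
  by apply: measurableI => //; apply: measurable_lt_set;
    [exact: measurable_g_shift|exact: adm_gmeas ug i].
have lg i := adm_lg ug i; have lgs i := cube_integrable_shift (h *: e) (lg i).
have vup i : vol (up i) <= M / d * h.
  rewrite mulrAC ler_pdivlMr// mulrC -(pairing_cst_indic d (mup i) (@subIsetr _ _ _)).
  apply: le_trans (HM i e h (up i) e1 h0 h1 (mup i) (@subIsetr _ _ _)).
  apply: le_trans (ler_norm _).
  have t := testable_indic (mup i) (@subIsetr _ _ _).
  apply: le_pairing => //; [exact: cube_integrable_cst|exact: cube_integrableB|].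
  move=> x; rewrite indicE; have [xu|xu] := pselect (up i x).
    by rewrite mem_set// !mulr1; apply: Hd; case: xu.
  by rewrite memNset// !mulr0.
have vdn i : vol (dn i) <= M / d * h.
  rewrite mulrAC ler_pdivlMr// mulrC -(pairing_cst_indic d (mdn i) (@subIsetr _ _ _)).
  apply: le_trans (HM i e h (dn i) e1 h0 h1 (mdn i) (@subIsetr _ _ _)).
  have t := testable_indic (mdn i) (@subIsetr _ _ _).
  rewrite -normrN; apply: le_trans (ler_norm _).
  have lw := cube_integrableB (lgs i) (lg i).
  rewrite -(pairingNl lw t).
  apply: le_pairing => //; [exact: cube_integrable_cst|exact: cube_integrable_opp|].
  move=> x; rewrite indicE; have [xu|xu] := pselect (dn i x).
    by rewrite mem_set// !mulr1 opprB; apply: Hd; case: xu.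
  by rewrite memNset// !mulr0.
have bnd (s : seq 'I_n) : vol (\big[setU/set0]_(i <- s) (up i `|` dn i)) <=
    (size s)%:R * ((M / d + M / d) * h).
  elim: s => [|i s IH]; first by rewrite big_nil vol0 mul0r.
  rewrite big_cons /= -natr1 mulrDl mul1r addrC.
  have mb : measurable (\big[setU/set0]_(i <- s) (up i `|` dn i)).
    by apply: bigsetU_measurable => j _; exact: measurableU.
  have mi : measurable (up i `|` dn i) by exact: measurableU.
  have bc : \big[setU/set0]_(i <- s) (up i `|` dn i) `<=` cube r.
    elim/big_ind : _ => [|A B Ar Br|j _]; [exact: sub0set|by rewrite subUset|].
    by rewrite -setIUl; exact: subIsetr.
  apply: (le_trans (vol_setU_le mi mb _ bc)).
    by rewrite -setIUl; exact: subIsetr.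
  rewrite lerD//.
  apply: (le_trans (vol_setU_le (mup i) (mdn i) (@subIsetr _ _ _) (@subIsetr _ _ _))).
  by rewrite mulrDl lerD.
have := bnd (enum 'I_n).
rewrite size_enum_ord mulrA; apply: le_trans.
apply: (@le_vol _ _ r).
- by apply: measurableI => //; exact: measurable_g_neq.
- by apply: bigsetU_measurable => j _; exact: measurableU.
- elim/big_ind : _ => [|A B Ar Br|j _]; [exact: sub0set|by rewrite subUset|].
  by rewrite -setIUl; exact: subIsetr.
move=> x [/= /eqP gx rx].
have /existsNP[i gi] : ~ forall i, g (x + h *: e) 0 i = g x 0 i.
  by move=> H; apply: gx; apply/rowP.
rewrite -bigcup_seq; exists i => /=; first by rewrite mem_enum.
by case: (ltgtP (g x 0 i) (g (x + h *: e) 0 i)) => lt;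
  [left; split|right; split|case: gi].
Qed.

Lemma adm_u_indic r : 0 <= r -> exists2 M, 0 <= M & forall e h B,
  `|e| <= 1 -> 0 <= h -> h <= 1 -> measurable B -> B `<=` cube r ->
  `|pairing (fun x => u (x + h *: e) - u x - h * dotr (g x) e) \1_B| <= M * h ^+ 2.
Proof.
move=> r0; have [M M0 HM] := adm_u_shift ug (r + 1).
have [L L0 HL] := adm_bounded ug.
have [U U0 HU] := continuous_bounded_cube (r + 1 + 1) (adm_cont ug).
exists M => // e h B e1 h0 h1 mB Br.
have lu := adm_lu ug; have lus := cube_integrable_shift (h *: e) lu.
have lg := adm_ldotg ug e.
have luu := cube_integrableB lus lu; have lhg := cube_integrableZ h lg.
have lw := cube_integrableB luu lhg.
have tB := testable_indic mB Br.
(* A crude bound that enters only the approximation of [\1_B]; the final constant [M] does not see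
   it. *)
pose K := U + U + n%:R * L.
have K0 : 0 <= K by rewrite !addr_ge0// mulr_ge0.
have bw x : cube (r + 1) x ->
    `|u (x + h *: e) - u x - h * dotr (g x) e| <= K.
  move=> cx; rewrite (le_trans (ler_normB _ _))// lerD//.
    rewrite (le_trans (ler_normB _ _))// lerD//.
      by apply: HU; apply: cubeD cx _; exact: norm_step_le1.
    by apply: HU; move: cx; apply: sub_cube; rewrite lerDl.
  rewrite normrM (ger0_norm h0) -[leRHS]mul1r ler_pM//.
  apply: sum_bound => i; rewrite normrM -[leRHS]mulr1 ler_pM//.
  exact: coor_le1.
have key phi dphi : smooth phi dphi -> (forall x, 0 <= phi x <= 1) ->
    supp_in (r + 1) phi ->
    `|pairing (fun x => u (x + h *: e) - u x - h * dotr (g x) e) phi| <= M * h ^+ 2.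
  move=> sp p01 sr; have tp := smooth_testable sp sr.
  rewrite (pairingBl luu lhg tp) (pairingBl lus lu tp) (pairing_shift _ lu tp).
  rewrite (pairingZl _ lg tp).
  by apply: (HM _ _ _ _ sp) => // x; exact: bdd01.
rewrite ler_norml; apply/andP; split; last first.
  apply: (pairing_indic_le r0 K0 lw) => //.
  by move=> phi dphi sp p01 sr; rewrite (le_trans (ler_norm _))// (key _ dphi).
rewrite lerNl -pairingNl//.
apply: (pairing_indic_le r0 K0 (cube_integrable_opp lw)) => //.
  by move=> x cx; rewrite normrN; exact: bw.
move=> phi dphi sp p01 sr; rewrite (pairingNl lw (smooth_testable sp sr)).
by rewrite (le_trans _ (key _ dphi sp p01 sr))// -normrN ler_norm.
Qed.

(* Fundamental theorem of calculus along [e], integrated over [B], with a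
   Riemann sum of step [k] in place of the integral. *)
Lemma adm_riemann r : 0 <= r -> exists2 M, 0 <= M & forall e k (N : nat) B,
  `|e| <= 1 -> 0 <= k -> N%:R * k <= 1 -> measurable B -> B `<=` cube r ->
  `|pairing (fun x => u (x + (N%:R * k) *: e) - u x -
      \sum_(j < N) k * dotr (g (x + (j%:R * k) *: e)) e) \1_B| <= N%:R * (M * k ^+ 2).
Proof.
(* The j-th term is the one-step estimate over [B] translated by j k e, and N k <= 1 keeps the
   translate in the cube of half-side r + 1. *)
move=> r0; have r1 : 0 <= r + 1 by rewrite addr_ge0.
have [M M0 HM] := adm_u_indic r1.
exists M => // e k N B e1 k0 Nk1 mB Br.
have tB := testable_indic mB Br.
have lu := adm_lu ug; have lg := adm_ldotg ug e.
have lus c := cube_integrable_shift c lu.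
have lgs c := cube_integrable_shift c lg.
have lsum m : cube_integrable (fun x =>
    \sum_(j < m) k * dotr (g (x + (j%:R * k) *: e)) e).
  by apply: cube_integrable_sum => j; exact: cube_integrableZ.
elim: N Nk1 => [_|N IH Nk1].
  rewrite !mul0r [X in pairing X](_ : _ = fun=> 0) ?pairing0l ?normr0//.
  by apply/funext => x; rewrite scale0r addr0 subrr big_ord0 subrr.
have Nk : N%:R * k <= 1.
  by apply: le_trans Nk1; rewrite ler_wpM2r// ler_nat.
have {}IH := IH Nk.
have step : `|pairing (fun x => u (x + (N%:R * k) *: e + k *: e) -
    u (x + (N%:R * k) *: e) - k * dotr (g (x + (N%:R * k) *: e)) e) \1_B| <= M * k ^+ 2.
  have l1 := cube_integrableB (cube_integrableB (lus (k *: e)) lu) (cube_integrableZ k lg).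
  rewrite (pairing_shift ((N%:R * k) *: e) l1 tB).
  rewrite (_ : (fun x => \1_B (x - _)) = \1_((fun x => x + - ((N%:R * k) *: e)) @^-1` B)).
    have Nk0 : 0 <= N%:R * k by rewrite mulr_ge0.
    have k1 : k <= 1.
      by rewrite (le_trans _ Nk1)// -[leLHS]mul1r ler_wpM2r// ler1n.
    apply: HM => //; first exact: measurable_preimage_shift.
    move=> x /= /Br cx; rewrite -(subrK ((N%:R * k) *: e) x).
    by apply: cubeD cx _; exact: norm_step_le1.
  by apply/funext => x; rewrite !indicE.
rewrite -natr1 [X in _ <= X]mulrDl mul1r.
apply: le_trans (lerD IH step); apply: le_trans (ler_normD _ _).
have l1 := cube_integrableB (cube_integrableB (lus ((N%:R * k) *: e)) lu) (lsum N).
have l2 : cube_integrable (fun x => u (x + (N%:R * k) *: e + k *: e) -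
    u (x + (N%:R * k) *: e) - k * dotr (g (x + (N%:R * k) *: e)) e).
  apply: cube_integrableB; last exact: cube_integrableZ.
  apply: cube_integrableB => //.
  exact: (cube_integrable_shift ((N%:R * k) *: e) (lus (k *: e))).
rewrite -(pairingDl l1 l2 tB) le_eqVlt; apply/orP; left; apply/eqP.
congr (`|pairing _ _|); apply/funext => x.
rewrite big_ord_recr /= mulrDl mul1r scalerDl addrA; ring.
Qed.

End admissible.

(** * Tilted functions and plateaus *)

Section dotr.
Context {R : realType} (n : nat).
Implicit Types (a x y e : 'rV[R]_n).

Lemma dotrDr a x y : dotr a (x + y) = dotr a x + dotr a y.
Proof. by rewrite -big_split; apply: eq_bigr => i _; rewrite mxE mulrDr. Qed.

Lemma dotrZr (c : R) a x : dotr a (c *: x) = c * dotr a x.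
Proof. by rewrite mulr_sumr; apply: eq_bigr => i _; rewrite mxE mulrCA. Qed.

Lemma dotrNr a x : dotr a (- x) = - dotr a x.
Proof. by rewrite -scaleN1r dotrZr mulN1r. Qed.

Lemma dotrC a x : dotr a x = dotr x a.
Proof. by apply: eq_bigr => i _; rewrite mulrC. Qed.

Lemma dotrBl a b x : dotr (a - b) x = dotr a x - dotr b x.
Proof. by rewrite !(dotrC _ x) dotrDr dotrNr. Qed.

Lemma dotr_bound a x : `|dotr a x| <= n%:R * (`|a| * `|x|).
Proof.
apply: sum_bound => i; rewrite normrM ler_pM//; exact: coor_le_norm.
Qed.

Lemma measurable_dotr a : measurable_fun setT (fun x : 'rV[R]_n => dotr a x).
Proof.
by apply: measurable_sum => i; apply: measurable_funM => //; exact: measurable_coor.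
Qed.

Lemma continuous_dotr a : continuous (fun x : 'rV[R]_n => dotr a x).
Proof.
move=> x; apply/(@cvgrPdist_le _ _ _ _ (nbhs_filter x)) => e e0.
pose C := n%:R * `|a| + 1.
have C0 : 0 < C by rewrite ltr_wpDl// mulr_ge0.
apply/nbhs_ballP; exists (e / C) => /=; first exact: divr_gt0.
move=> y; rewrite mx_norm_ball /ball_ /= => xy.
rewrite -dotrNr -dotrDr (le_trans (dotr_bound _ _))// mulrA.
rewrite (@le_trans _ _ (C * `|x - y|)) ?ler_wpM2r ?lerDl//.
by rewrite mulrC -ler_pdivlMr// ltW.
Qed.

Lemma continuous_shift (f : 'rV[R]_n -> R) (c : 'rV[R]_n) : continuous f ->
  continuous (fun y : 'rV[R]_n => f (y + c)).
Proof.
move=> cf y.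
have cs : (fun z : 'rV[R]_n => z + c) z @[z --> y] --> y + c.
  have FF := nbhs_filter y; exact: (@cvgD _ _ _ _ FF id (fun=> c) y c (@cvg_id _ _) (@cvg_cst _ _ _ _ FF)).

exact: (cvg_comp _ _ cs (cf (y + c))).
Qed.

Lemma continuous_lt_near (f : 'rV[R]_n -> R) x (c : R) : continuous f -> f x < c ->
  exists2 d, 0 < d & forall y, `|y - x| <= d -> f y < c.
Proof.
move=> cf fx; have c0 : 0 < c - f x by rewrite subr_gt0.
have H := proj1 (cvgrPdist_lt (F := nbhs x) f (f x)) (cf x) _ c0.
have [d /= d0 Hd] := proj1 (nbhs_ballP x _) (H _).
exists (d / 2) => [|y xy]; first by rewrite divr_gt0.
have : ball x d y.
  rewrite mx_norm_ball /ball_ /= distrC (le_lt_trans xy)//.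
  by rewrite ltr_pdivrMr// ltr_pMr// ltr1n.
by move=> /Hd /=; rewrite ltr_norml => /andP[H1 H2]; lra.
Qed.

End dotr.

Definition tilt {R : realType} n (u : 'rV[R]_n -> R) (a x : 'rV[R]_n) : R :=
  u x - dotr a x.

Section volume_limits.
Context {R : realType} (n : nat).
Notation mu := (@lebesgue_rV R n).

Lemma le0_inv_nat (x C : R) : (forall N, x <= C / N.+1%:R) -> x <= 0.
Proof.
move=> H; rewrite leNgt; apply/negP => x0.
have C0 : 0 <= C by have := H 0%N; rewrite invr1 mulr1; exact/le_trans/ltW.
have := H (Num.truncn (C / x)); rewrite leNgt => /negP; apply.
by rewrite ltr_pdivrMr// -ltr_pdivrMl// mulrC truncnS_gt.
Qed.

Lemma vol_ball_gt0 (x : 'rV[R]_n) (r : R) : 0 < r ->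
  0 < vol ((fun y => y - x) @^-1` cube r).
Proof.
move=> r0; rewrite vol_shift; last exact: measurable_cube.
rewrite /vol cube_box ?ltW// lebesgue_box /=; last first.
  by move=> i; rewrite (@le_trans _ _ 0) ?oppr_le0 ?ltW.
by apply: prodr_gt0 => i _; rewrite opprK addr_gt0.
Qed.

Lemma vol_bigcup_le r (F : (set 'rV[R]_n)^nat) K : nondecreasing_seq F ->
  (forall k, measurable (F k)) -> (forall k, F k `<=` cube r) ->
  (forall k, vol (F k) <= K) -> vol (\bigcup_k F k) <= K.
Proof.
move=> ndF mF Fr FK.
have mU : measurable (\bigcup_k F k) by exact: bigcup_measurable.
have Ur : \bigcup_k F k `<=` cube r by exact: bigcup_sub.
rewrite -lee_fin (vol_fin mU Ur).
have cv := nondecreasing_cvg_mu (mu := mu) mF mU ndF.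
rewrite -(cvg_lim _ cv)//; apply: lime_le; first by apply/cvg_ex; eexists; exact: cv.
by apply: nearW => k /=; rewrite -(vol_fin (mF k) (Fr k)) lee_fin.
Qed.

Lemma vol_bigcup0 r (F : (set 'rV[R]_n)^nat) :
  (forall k, measurable (F k)) -> (forall k, F k `<=` cube r) ->
  (forall k, vol (F k) = 0) -> vol (\bigcup_k F k) = 0.
Proof.
move=> mF Fr F0; rewrite /vol; suff -> : mu (\bigcup_k F k) = 0%E by [].
have mU : measurable (\bigcup_k F k) by exact: bigcup_measurable.
apply: measure_negligible => //; apply: negligible_bigcup => k.
by apply/negligibleP => //; have /esym := vol_fin (mF k) (Fr k); rewrite F0.
Qed.

Lemma vol_bigsetU_le r (I : Type) (s : seq I) (F : I -> set 'rV[R]_n) :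
  (forall i, measurable (F i)) -> (forall i, F i `<=` cube r) ->
  vol (\big[setU/set0]_(i <- s) F i) <= \sum_(i <- s) vol (F i).
Proof.
move=> mF Fr; elim: s => [|i s IH]; first by rewrite !big_nil vol0.
rewrite !big_cons; have mb : measurable (\big[setU/set0]_(i <- s) F i).
  exact: bigsetU_measurable.
apply: (le_trans (vol_setU_le (mF i) mb (Fr i) _)); last exact: lerD.
by elim/big_ind : _ => // A B Ar Br; rewrite subUset.
Qed.

End volume_limits.

Section tilt.
Context {R : realType} (n : nat) (u : 'rV[R]_n -> R) (g : 'rV[R]_n -> 'rV[R]_n).
Hypothesis ug : admissible u g.
Implicit Types (B : set 'rV[R]_n) (a e c : 'rV[R]_n) (h r s : R).

Lemma tilt_incr a x y : tilt u a (x + y) - tilt u a x = u (x + y) - u x - dotr a y.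
Proof. by rewrite /tilt dotrDr; ring. Qed.

Lemma measurable_tilt a : measurable_fun setT (tilt u a).
Proof. by apply: measurable_funB; [exact: adm_meas ug|exact: measurable_dotr]. Qed.

Lemma continuous_tilt a : continuous (tilt u a).
Proof.
by move=> x; exact: (cvgB (adm_cont ug (x:=x)) (continuous_dotr (x:=x))).
Qed.

Lemma measurable_g_eq a c : measurable [set x : 'rV[R]_n | g (x + c) = a].
Proof.
rewrite (_ : [set x | _] = \bigcap_(i in [set: 'I_n])
    [set x : 'rV[R]_n | g (x + c) 0 i = a 0 i]).
  apply: (@fin_bigcap_measurable _ (matrix R 1 n)); first exact: finite_finset.
  by move=> i _; apply: measurable_eq_set => //; exact: (measurable_g_shift ug).
apply/seteqP; split => x /= => [gx i _ /=|h]; first by rewrite gx.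
by apply/rowP => i; exact: h.
Qed.

(** By continuity a decrease at [x] persists on a small ball [B]. There the increment of u is at
    most h a.e - eta, whereas the Riemann sum is at least h a.e; the error of [adm_riemann] then
    bounds eta vol(B) by O(1/N). *)
Lemma tilt_mono1 a e x h : (forall y, dotr a e <= dotr (g y) e) -> `|e| <= 1 ->
  0 <= h -> h <= 1 -> tilt u a x <= tilt u a (x + h *: e).
Proof.
move=> ae e1 h0 h1; rewrite leNgt; apply/negP => lt.
pose eta := (tilt u a x - tilt u a (x + h *: e)) / 2.
have eta0 : 0 < eta by rewrite divr_gt0// subr_gt0.
have cw : continuous (fun y : 'rV[R]_n => tilt u a (y + h *: e) - tilt u a y).
  have ct := continuous_tilt (a := a).
  by move=> y; exact: (cvgB (continuous_shift (c := h *: e) ct (x := y)) (ct y)).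
have xeta : tilt u a (x + h *: e) - tilt u a x < - eta.
  by rewrite /eta; move: lt; lra.
have [d d0 Hd] := continuous_lt_near cw xeta.
pose rho := Num.min d 1.
have rho0 : 0 < rho by rewrite lt_min d0/=.
pose B := (fun y => y - x) @^-1` @cube R n rho.
have mB : measurable B by apply: measurable_preimage_shift; exact: measurable_cube.
have Br : B `<=` cube (`|x| + 1).
  move=> y By; have -> : y = x + (y - x) by rewrite addrC subrK.
  apply: cubeD; first exact: lexx.
  by rewrite (le_trans By)// ge_min lexx orbT.
have B_lt y : B y -> u (y + h *: e) - u y - h * dotr a e <= - eta.
  move=> By; have : `|y - x| <= d by rewrite (le_trans By)// ge_min lexx.
  by move=> /Hd /ltW; rewrite -dotrZr -tilt_incr.
have r0 : 0 <= `|x| + 1 by rewrite addr_ge0.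
have [M M0 HM] := adm_riemann ug r0.
have tB := testable_indic mB Br.
have lu := adm_lu ug; have lg := adm_ldotg ug e.
have : eta * vol B <= 0.
  apply: (@le0_inv_nat _ _ (M * h ^+ 2)) => N.
  have N0 : (0 : R) < N.+1%:R by rewrite ltr0n.
  have k0 : 0 <= h / N.+1%:R by rewrite divr_ge0.
  have Nk : N.+1%:R * (h / N.+1%:R) = h by rewrite mulrC divfK// gt_eqF.
  have := HM e (h / N.+1%:R) N.+1 B e1 k0 _ mB Br; rewrite Nk => /(_ h1).
  rewrite -normrN => /(le_trans (ler_norm _)).
  have -> : N.+1%:R * (M * (h / N.+1%:R) ^+ 2) = M * h ^+ 2 / N.+1%:R.
    by field; rewrite gt_eqF.
  apply: le_trans; rewrite lerNr -mulNr -(pairing_cst_indic _ mB Br).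
  apply: le_pairing => //.
  - apply: cube_integrableB; last first.
      apply: cube_integrable_sum => j; apply: cube_integrableZ.
      exact: (cube_integrable_shift ((j%:R * (h / N.+1%:R)) *: e) lg).
    by apply: cube_integrableB => //; exact: (cube_integrable_shift (h *: e) lu).
  - exact: cube_integrable_cst.
  move=> y; rewrite indicE; have [By|nBy] := pselect (B y); last first.
    by rewrite memNset// !mulr0.
  rewrite mem_set// !mulr1; apply: le_trans (B_lt y By); rewrite lerD2l lerN2.
  rewrite -[X in X * dotr a e]Nk -mulrA mulr_natl -[X in _ *+ X]card_ord -sumr_const.
  by apply: ler_sum => j _; rewrite ler_wpM2l.
by apply/negP; rewrite -ltNge mulr_gt0//; exact: vol_ball_gt0.
Qed.

Lemma tilt_mono a e x h : (forall y, dotr a e <= dotr (g y) e) ->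
  0 <= h -> tilt u a x <= tilt u a (x + h *: e).
Proof.
move=> ae h0.
(* More than h |e| steps, so that each step vector [e'] has norm at most 1. *)
pose N := (Num.truncn (h * `|e|)).+1.
have N0 : (0 : R) < N%:R by rewrite ltr0n.
pose e' := (h / N%:R) *: e.
have e'1 : `|e'| <= 1.
  rewrite normrZ ger0_norm ?divr_ge0// mulrAC ler_pdivrMr// mul1r.
  exact/ltW/truncnS_gt.
have ae' y : dotr a e' <= dotr (g y) e'.
  by rewrite !dotrZr ler_wpM2l// divr_ge0.
have step m : tilt u a x <= tilt u a (x + m%:R *: e').
  elim: m => [|m IH]; first by rewrite scale0r addr0.
  apply: (le_trans IH); have := tilt_mono1 (x + m%:R *: e') ae' e'1 ler01 (lexx 1).
  by rewrite -addrA -scalerDl natr1.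
have := step N; rewrite scalerA mulrC divfK ?gt_eqF//.
Qed.

(* Sample the segment from [x] to [x + h *: e] at N + 1 points.  Outside a set of
   volume O(h) the gradient equals [a] at all of them, and on the remaining set
   the tilted function moves by O(h^2 / N) on average, by [adm_riemann]. *)
Lemma vol_tilt_moves r : 0 <= r -> exists2 M, 0 <= M & forall a e s h,
  `|e| <= 1 -> 0 <= h -> h <= 1 -> s * s = 1 ->
  (forall x, 0 <= s * (tilt u a (x + h *: e) - tilt u a x)) ->
  vol ([set x : 'rV[R]_n | g x = a /\ tilt u a (x + h *: e) != tilt u a x] `&` cube r) <= M * h.
Proof.
move=> r0; have r1 : 0 <= r + 1 by rewrite addr_ge0.
have [M M0 HM] := adm_g_neq ug r1; have [M' M'0 HM'] := adm_riemann ug r0.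
exists M => // a e s h e1 h0 h1 ss W0.
have mc := @measurable_cube R n r.
have lu := adm_lu ug; have lg := adm_ldotg ug e.
have mW : measurable_fun setT (fun x : 'rV[R]_n => s * (tilt u a (x + h *: e) - tilt u a x)).
  apply: measurable_funM => //; apply: measurable_funB; last exact: measurable_tilt.
  exact: measurableT_comp (measurable_tilt a) (measurable_shift (h *: e)).
(* A threshold for Chebyshev's inequality. The bound reached is the same for all m, and the [Y m]
   increase to the whole set. *)
pose Y m := ([set x | g x = a] `&`
  [set x : 'rV[R]_n | m.+1%:R^-1 < s * (tilt u a (x + h *: e) - tilt u a x)]) `&` cube r.
have mY m : measurable (Y m).
  apply: measurableI => //; apply: measurableI; last exact: measurable_lt_set.
  by have := measurable_g_eq a 0; under [X in measurable X]eq_set do rewrite addr0.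
have Yr m : Y m `<=` cube r by exact: subIsetr.
have -> : [set x : 'rV[R]_n | g x = a /\ tilt u a (x + h *: e) != tilt u a x] `&` cube r =
    \bigcup_m Y m.
  apply/seteqP; split => [x [[/= gx /eqP tx] rx]|x [m _ [[/= gx tx] rx]]].
    have Wx : 0 < s * (tilt u a (x + h *: e) - tilt u a x).
      rewrite lt_neqAle W0 andbT eq_sym mulf_neq0//.
        by apply/eqP => s0; move: ss; rewrite s0 mul0r => /eqP; rewrite eq_sym oner_eq0.
      by rewrite subr_eq0; apply/eqP.
    exists (Num.truncn (s * (tilt u a (x + h *: e) - tilt u a x))^-1) => //.
    split => //; split => //=; rewrite invf_plt ?posrE//; exact: truncnS_gt.
  split => //=; split => //; apply/eqP => tx0; move: tx.
  by rewrite tx0 subrr mulr0 ltNge invr_ge0 ler0n.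
apply: (vol_bigcup_le _ mY Yr).
  move=> i j ij; apply/subsetPset => x [[/= gx ix] rx]; split => //; split => //=.
  by apply: le_lt_trans ix; rewrite lef_pV2 ?posrE// ler_nat ltnS.
move=> m; rewrite -subr_le0; apply: (@le0_inv_nat _ _ (m.+1%:R * (M' * h ^+ 2))) => N.
have N0 : (0 : R) < N.+1%:R by rewrite ltr0n.
set k := h / N.+1%:R.
have k0 : 0 <= k by rewrite divr_ge0.
have Nk : N.+1%:R * k = h by rewrite mulrC divfK// gt_eqF.
have jk1 (j : nat) : (j <= N.+1)%N -> j%:R * k <= 1.
  by move=> jN; rewrite (le_trans _ h1)// -Nk ler_wpM2r// ler_nat.
have jk0 (j : nat) : 0 <= j%:R * k by rewrite mulr_ge0.
have k1 : k <= 1 by rewrite -[k]mul1r; exact: (jk1 1%N).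
(* [Z] keeps the points whose samples all have gradient [a]. The others are caught by some [T j],
   where the gradient changes at step j; each [T j] has volume at most M k, which adds up to M h. *)
pose Z := Y m `&` \bigcap_(j in `I_N.+1) [set x : 'rV[R]_n | g (x + (j%:R * k) *: e) = a].
have mZ : measurable Z.
  apply: measurableI => //; apply: bigcap_measurable; first by exists 0%N.
  by move=> j _; exact: measurable_g_eq.
have Zr : Z `<=` cube r by move=> x [/Yr].
have tZ := testable_indic mZ Zr.
pose T (j : 'I_N.+1) := (fun x : 'rV[R]_n => x + (j%:R * k) *: e) @^-1`
  ([set x : 'rV[R]_n | g (x + k *: e) != g x] `&` cube (r + 1)) `&` cube r.
have mT j : measurable (T j).
  apply: measurableI => //; apply: measurable_preimage_shift.
  by apply: measurableI; [exact: (measurable_g_neq ug)|exact: measurable_cube].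
have Tr j : T j `<=` cube r by exact: subIsetr.
have volT j : vol (T j) <= M * k.
  apply: le_trans (HM e k e1 k0 k1).
  have mS : measurable ([set x : 'rV[R]_n | g (x + k *: e) != g x] `&` cube (r + 1)).
    by apply: measurableI; [exact: (measurable_g_neq ug)|exact: measurable_cube].
  rewrite -(vol_shift ((j%:R * k) *: e) mS); apply: (@le_vol _ _ (r + 1 + 1)) => //.
  - exact: measurable_preimage_shift.
  - move=> x /= [_ cx]; rewrite -(addrK ((j%:R * k) *: e) x); apply: cubeD cx _.
    by rewrite normrN norm_step_le1// jk1// ltnW.
  - by move=> x [].
have YZT : Y m `<=` Z `|` \big[setU/set0]_(j <- enum 'I_N.+1) T j.
  move=> x Yx; have [xT|xT] := pselect ((\big[setU/set0]_(j <- enum 'I_N.+1) T j) x).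
    by right.
  have [[/= gx _] rx] := Yx; left; split => //; elim=> [_|j IH jN] /=.
    by rewrite mul0r scale0r addr0.
  have jN' : (j < N.+1)%N by rewrite ltnW.
  rewrite -[RHS](IH jN') -natr1 mulrDl mul1r scalerDl addrA.
  apply/eqP/negPn/negP => h2; apply: xT; rewrite -bigcup_seq.
  exists (Ordinal jN') => /=; first by rewrite mem_enum.
  split => //; split => //=; apply: cubeD rx _.
  by rewrite norm_step_le1// jk1// ltnW.
have volZ : vol Z <= m.+1%:R * (M' * h ^+ 2) / N.+1%:R.
  have := HM' e k N.+1 Z e1 k0 _ mZ Zr; rewrite Nk => /(_ h1).
  have -> : N.+1%:R * (M' * k ^+ 2) = M' * h ^+ 2 / N.+1%:R.
    by rewrite /k; field; rewrite gt_eqF.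
  set w := (fun x => _).
  have lw : cube_integrable w.
    apply: cube_integrableB; last first.
      apply: cube_integrable_sum => j; apply: cube_integrableZ.
      exact: (cube_integrable_shift ((j%:R * k) *: e) lg).
    by apply: cube_integrableB => //; exact: (cube_integrable_shift (h *: e) lu).
  have s1 : `|s| = 1.
    have /eqP : `|s| * `|s| = 1 by rewrite -normrM ss normr1.
    by rewrite -expr2 sqrf_eq1 => /orP[/eqP//|/eqP h2]; have := normr_ge0 s; rewrite h2 ler0N1.
  have -> : `|pairing w \1_Z| = `|pairing (fun x => s * w x) \1_Z|.
    by rewrite pairingZl// normrM s1 mul1r.
  move=> /(le_trans (ler_norm _)) H; rewrite -mulrA -ler_pdivrMl ?ltr0n//; apply: le_trans H.
  rewrite -(pairing_cst_indic _ mZ Zr).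
  apply: le_pairing => //; [exact: cube_integrable_cst|exact: cube_integrableZ|].
  move=> x; rewrite indicE; have [Zx|nZx] := pselect (Z x); last first.
    by rewrite memNset// !mulr0.
  rewrite mem_set// !mulr1; have [[[_ /= Yx] _] gZ] := Zx.
  apply/ltW; apply: (lt_le_trans Yx); rewrite tilt_incr dotrZr /w.
  rewrite (eq_bigr (fun=> k * dotr a e)); last by move=> j _; rewrite gZ//=.
  by rewrite sumr_const card_ord -mulr_natl mulrA Nk.
rewrite lerBlDr.
have mTT : measurable (\big[setU/set0]_(j <- enum 'I_N.+1) T j).
  exact: bigsetU_measurable.
have TTr : \big[setU/set0]_(j <- enum 'I_N.+1) T j `<=` cube r.
  by elim/big_ind : _ => // A B Ar Br; rewrite subUset.
apply: (@le_trans _ _ (vol (Z `|` \big[setU/set0]_(j <- enum 'I_N.+1) T j))).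
  by apply: (@le_vol _ _ r) => //; [exact: measurableU|rewrite subUset].
apply: (le_trans (vol_setU_le mZ mTT Zr TTr)); apply: lerD => //.
apply: (le_trans (vol_bigsetU_le (enum 'I_N.+1) mT Tr)).
apply: (@le_trans _ _ (\sum_(j <- enum 'I_N.+1) M * k)); first exact: ler_sum.
by rewrite big_enum sumr_const card_ord -mulr_natl mulrCA Nk.
Qed.

(** On [B] the increment of u over a step h is exactly h a.e, while h g.e differs from it by at
    least h d in the direction of the sign [s]. The mean error is O(h^2) by [adm_u_indic], so d
    vol(B) = O(h) for every small h. *)
Lemma vol_tilt_constant r a e s d k B : 0 <= r -> `|e| <= 1 -> 0 < d -> 0 < k ->
  s * s = 1 ->
  (forall x, g x <> a -> d <= s * (dotr (g x) e - dotr a e)) ->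
  measurable B -> B `<=` cube r ->
  (forall x, B x -> g x <> a /\ forall h, 0 <= h -> h <= k ->
     tilt u a (x + h *: e) = tilt u a x) -> vol B = 0.
Proof.
move=> r0 e1 d0 k0 ss ga mB Br HB; apply/eqP; rewrite eq_le vol_ge0 andbT.
have [M M0 HM] := adm_u_indic ug r0.
have lu := adm_lu ug; have lg := adm_ldotg ug e.
have tB := testable_indic mB Br.
rewrite -(pmulr_rle0 _ d0); apply: (@le0_inv_nat _ _ (M * Num.min k 1)) => N.
have N0 : (0 : R) < N.+1%:R by rewrite ltr0n.
have m0 : 0 < Num.min k 1 by rewrite lt_min k0/=.
pose h := Num.min k 1 / N.+1%:R.
have h0 : 0 < h by rewrite divr_gt0.
have hm : h <= Num.min k 1.
  by rewrite ler_pdivrMr//; apply: ler_peMr; [exact: ltW|rewrite ler1n].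
have hk : h <= k by rewrite (le_trans hm)// ge_min lexx.
have h1 : h <= 1 by rewrite (le_trans hm)// ge_min lexx orbT.
have := HM e h B e1 (ltW h0) h1 mB Br; set w := (fun x => _).
have lw : cube_integrable w.
  apply: cube_integrableB; last exact: cube_integrableZ.
  by apply: cube_integrableB => //; exact: (cube_integrable_shift (h *: e) lu).
have s1 : `|- s| = 1.
  have /eqP : `|- s| * `|- s| = 1 by rewrite -normrM mulrNN ss normr1.
  by rewrite -expr2 sqrf_eq1 => /orP[/eqP//|/eqP h2]; have := normr_ge0 (- s); rewrite h2 ler0N1.
have -> : `|pairing w \1_B| = `|pairing (fun x => - s * w x) \1_B|.
  by rewrite pairingZl// normrM s1 mul1r.
move=> /(le_trans (ler_norm _)) H.
have : h * d * vol B <= M * h ^+ 2.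
  apply: le_trans H; rewrite -(pairing_cst_indic _ mB Br).
  apply: le_pairing => //; [exact: cube_integrable_cst|exact: cube_integrableZ|].
  move=> x; rewrite indicE; have [Bx|nBx] := pselect (B x); last first.
    by rewrite memNset// !mulr0.
  rewrite mem_set// !mulr1; have [gx /(_ h (ltW h0) hk) tx] := HB x Bx.
  have := tilt_incr a x (h *: e); rewrite tx subrr dotrZr => /esym/eqP.
  rewrite subr_eq0 /w => /eqP ->.
  have := ga x gx; rewrite -(ler_pM2l h0) => /le_trans; apply.
  by rewrite le_eqVlt; apply/orP; left; apply/eqP; ring.
rewrite expr2 mulrCA -mulrA ler_pM2l// => /le_trans; apply.
by rewrite /h mulrA.
Qed.

End tilt.

(** Cubes and cones are measured in the sup norm; together with [enorm_le] this is the passage to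
    the Euclidean notions of the statement. *)
Lemma norm_le_enorm {R : realType} n (x : 'rV[R]_n) : `|x| <= enorm x.
Proof.
apply/rV_normP => [|i]; first exact: sqrtr_ge0.
rewrite -sqrtr_sqr ler_wsqrtr// /dotr (bigD1 i)//= expr2 lerDl.
by apply: sumr_ge0 => j _; rewrite -expr2 sqr_ge0.
Qed.

(* [e] points strictly into the cone on which the linear form [a] is the
   smallest among the values of [g]. *)
Record direction {R : realType} n (g : 'rV[R]_n -> 'rV[R]_n) (a e : 'rV[R]_n) (rho : R) : Prop :=
  Direction {
    dir_norm : `|e| <= 1;
    dir_rho : 0 < rho;
    dir_cone : forall x y, `|y - e| <= rho -> dotr a y <= dotr (g x) y;
    dir_gap : exists2 d, 0 < d & forall x, g x <> a -> d <= dotr (g x) e - dotr a e }.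

(** For [v] monotone along [e], equal values at the ends of a segment mean constancy on it, so these
    are all the points on nontrivial segments of direction [e] where [v] is constant. *)
Definition plateau {R : realType} n (v : 'rV[R]_n -> R) (e : 'rV[R]_n) : set 'rV[R]_n :=
  [set x | exists2 k, 0 < k & v (x + k *: e) = v x \/ v (x - k *: e) = v x].

Section direction.
Context {R : realType} (n : nat) (u : 'rV[R]_n -> R) (g : 'rV[R]_n -> 'rV[R]_n).
Hypothesis ug : admissible u g.
Variables (a e : 'rV[R]_n) (rho : R).
Hypothesis dae : direction g a e rho.
Implicit Types (B : set 'rV[R]_n) (x y z : 'rV[R]_n) (h r s : R).
Let v := tilt u a.

(** The cone is homogeneous: y / h lies within [rho] of [e], so [tilt_mono] applies to that
    direction with step h. *)
Lemma cone_mono x y h : 0 < h -> `|y - h *: e| <= rho * h -> v x <= v (x + y).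
Proof.
move=> h0 yh; rewrite -(scale1r y) -(divff (lt0r_neq0 h0)) -scalerA.
apply: (tilt_mono ug); last exact: ltW.
move=> z; apply: dir_cone dae _ _ _.
rewrite -[e]scale1r -(mulVf (lt0r_neq0 h0)) -scalerA -scalerBr normrZ.
by rewrite gtr0_norm ?invr_gt0// ler_pdivrMl// mulrC.
Qed.

Lemma dir_mono x h : 0 <= h -> v x <= v (x + h *: e).
Proof.
move=> h0; apply: (tilt_mono ug) => // y; apply: dir_cone dae _ _ _.
by rewrite subrr normr0 ltW// (dir_rho dae).
Qed.

Lemma dir_mono_le x h h' : h <= h' -> v (x + h *: e) <= v (x + h' *: e).
Proof.
move=> hh; have -> : x + h' *: e = x + h *: e + (h' - h) *: e.
  by rewrite -addrA -scalerDl [h + _]addrC subrK.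
by apply: dir_mono; rewrite subr_ge0.
Qed.

Lemma dir_const_fwd x h k : 0 <= h -> h <= k -> v (x + k *: e) = v x ->
  v (x + h *: e) = v x.
Proof.
move=> h0 hk vk; apply/eqP; rewrite eq_le dir_mono// andbT.
by rewrite -[leRHS]vk dir_mono_le.
Qed.

Lemma dir_const_bwd x h k : 0 <= h -> h <= k -> v (x - k *: e) = v x ->
  v (x - h *: e) = v x.
Proof.
move=> h0 hk vk; apply/eqP; rewrite eq_le; apply/andP; split.
  rewrite -[X in _ <= v X](subrK (h *: e)); exact: dir_mono.
by rewrite -[leLHS]vk -!scaleNr dir_mono_le// lerN2.
Qed.

(** [y] lies in the cone issuing from x - h e, and x + h e lies in the cone issuing from [y];
    monotonicity squeezes v(y) between two equal values. *)
Lemma diamond x y h : 0 < h -> v (x - h *: e) = v (x + h *: e) ->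
  `|y - x| <= rho * h -> v y = v (x + h *: e).
Proof.
move=> h0 vx yx; apply/eqP; rewrite eq_le; apply/andP; split.
  have -> : x + h *: e = y + (h *: e - (y - x)).
    by apply/rowP => i; rewrite !mxE; ring.
  apply: (cone_mono _ h0); rewrite [_ - _ - _]addrAC subrr sub0r normrN.
  exact: yx.
rewrite -vx; have -> : y = x - h *: e + (h *: e + (y - x)).
  by apply/rowP => i; rewrite !mxE; ring.
apply: (cone_mono _ h0).
by have -> : h *: e + (y - x) - h *: e = y - x by apply/rowP => i; rewrite !mxE; ring.
Qed.


(** [x] is interior to the diamond centred at [z], on which [v] is constant. So u is affine with
    gradient [a] near [x], and both linear forms in the definition of regularity are [a]. *)
Lemma direction_regular x z h : 0 < h -> `|x - z| < rho * h ->
  v (z - h *: e) = v (z + h *: e) -> regular_set u x.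
Proof.
move=> h0 xz vz.
exists a, a, (u x), (rho * h - `|x - z|); split; first by rewrite subr_gt0.
left => y /= xy; rewrite /Num.min ltxx.
have yz : `|y - z| <= rho * h.
  have -> : y - z = (y - x) + (x - z) by rewrite addrA subrK.
  rewrite (le_trans (ler_normD _ _))// -lerBrDr ltW//.
  exact: le_lt_trans (norm_le_enorm _) xy.
have := diamond h0 vz yz; rewrite -(diamond h0 vz (ltW xz)) /v /tilt => /eqP.
by rewrite dotrDr dotrNr subr_eq => /eqP ->; ring.
Qed.

Definition moves h : set 'rV[R]_n := [set x | v (x + h *: e) <> v x].

Lemma measurable_v_shift (c : 'rV[R]_n) : measurable_fun setT (fun x : 'rV[R]_n => v (x + c)).
Proof. exact: measurableT_comp (measurable_tilt ug a) (measurable_shift c). Qed.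

Lemma measurable_v : measurable_fun setT v.
Proof. exact: (measurable_tilt ug a). Qed.

Lemma measurable_moves h : measurable (moves h).
Proof.
by apply: measurableC; apply: measurable_eq_set;
  [exact: measurable_v_shift|exact: measurable_v].
Qed.

(** By monotonicity a constant segment may be shortened at will, so the lengths 1/(m + 1) suffice
    and the plateau becomes a countable union of measurable sets. *)
Lemma plateauE : plateau v e = \bigcup_m
  (~` moves m.+1%:R^-1 `|` ~` moves (- m.+1%:R^-1)).
Proof.
apply/seteqP; split => [x [k k0 H]|x [m _ H]]; last first.
  exists (m.+1%:R^-1); first by rewrite invr_gt0.
  by case: H => /contrapT; [left|right; rewrite -scaleNr].
exists (Num.truncn k^-1) => //.
have mk : (Num.truncn k^-1).+1%:R^-1 <= k.
  by rewrite invf_ple ?posrE//; exact/ltW/truncnS_gt.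
case: H => vk; [left|right]; apply.
  by apply: dir_const_fwd mk vk; rewrite invr_ge0.
by rewrite scaleNr; apply: dir_const_bwd mk vk; rewrite invr_ge0.
Qed.

Lemma measurable_plateau : measurable (plateau v e).
Proof.
rewrite plateauE; apply: bigcup_measurable => m _.
by apply: measurableU; apply: measurableC; exact: measurable_moves.
Qed.

(** Each of the countably many pieces has a constant segment of fixed length ahead of or behind
    every point; [vol_tilt_constant] applies along e or -e. *)
Lemma vol_plateau_neq r : 0 <= r ->
  vol ((plateau v e `&` ~` [set x | g x = a]) `&` cube r) = 0.
Proof.
move=> r0; have mc := @measurable_cube R n r.
have mg : measurable (~` [set x | g x = a]).
  apply: measurableC; have := measurable_g_eq ug a 0.
  by under [X in measurable X]eq_set do rewrite addr0.
have [d d0 gap] := dir_gap dae.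
pose F k : set 'rV[R]_n := (~` moves k `&` ~` [set x | g x = a]) `&` cube r.
have mF k : measurable (F k).
  by apply: measurableI => //; apply: measurableI => //; apply: measurableC; exact: measurable_moves.
have F0 k s : 0 < k -> s * s = 1 -> vol (F (s * k)) = 0.
  move=> k0 ss.
  have s1 : s = 1 \/ s = -1.
    by move/eqP: ss; rewrite -expr2 sqrf_eq1 => /orP[/eqP|/eqP]; tauto.
  apply: (@vol_tilt_constant _ _ _ _ ug r a (s *: e) s d k) => //.
  - by case: s1 => ->; rewrite ?scale1r ?scaleN1r ?normrN (dir_norm dae).
  - move=> x /gap; rewrite !dotrZr -mulrBr mulrA ss mul1r; exact.
  - exact: subIsetr.
  move=> x [[/contrapT vx gx] _]; split => // h h0 hk.
  case: s1 vx => ->; rewrite ?mul1r ?scale1r ?mulN1r ?scaleN1r => vx.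
    exact: dir_const_fwd hk vx.
  by rewrite scalerN; apply: (dir_const_bwd h0 hk); rewrite -scaleNr.
rewrite plateauE setI_bigcupl setI_bigcupl.
have e1 (m : nat) : 0 < m.+1%:R^-1 :> R by rewrite invr_gt0.
apply: (@vol_bigcup0 _ _ r).
- move=> m; apply: measurableI => //; apply: measurableI => //.
  by apply: measurableU; apply: measurableC; exact: measurable_moves.
- by move=> m; exact: subIsetr.
move=> m; have h1 := F0 _ 1 (e1 m) (mulr1 1).
have h2 := F0 _ (-1) (e1 m); rewrite mulrNN mulr1 mulN1r in h2.
have {}h2 := h2 erefl; rewrite mul1r in h1.
apply/eqP; rewrite eq_le vol_ge0 andbT -[X in _ <= X]addr0 -{1}h1 -h2.
rewrite 2!setIUl.
exact: (vol_setU_le (mF _) (mF _) (@subIsetr _ _ _) (@subIsetr _ _ _)).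
Qed.

Lemma vol_eq_moves r : 0 <= r -> exists2 M, 0 <= M & forall h, 0 <= h -> h <= 1 ->
  vol (([set x | g x = a] `&` moves h) `&` cube r) <= M * h /\
  vol (([set x | g x = a] `&` moves (- h)) `&` cube r) <= M * h.
Proof.
move=> r0; have [M M0 HM] := vol_tilt_moves ug r0; exists M => // h h0 h1.
have E s : [set x | g x = a] `&` moves (s * h) =
    [set x | g x = a /\ v (x + h *: (s *: e)) != v x].
  apply/seteqP; split => x [/= gx vx]; split => //.
    by rewrite scalerA mulrC; apply/eqP.
  by rewrite /moves /= mulrC -scalerA; apply/eqP.
split.
  rewrite -[X in moves X]mul1r E; apply: (HM a _ 1 h) => //.
  - by rewrite scale1r (dir_norm dae).
  - by rewrite mulr1.
  - by move=> x; rewrite mul1r scale1r subr_ge0 dir_mono.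
rewrite -mulN1r E; apply: (HM a _ (-1) h) => //.
- by rewrite scaleN1r normrN (dir_norm dae).
- by rewrite mulrNN mulr1.
- move=> x; rewrite mulN1r oppr_ge0 subr_le0 scalerA mulrN1 scaleNr.
  by rewrite -[X in _ <= _ X](subrK (h *: e)) dir_mono.
Qed.

Lemma measurable_g_eq0 : measurable [set x : 'rV[R]_n | g x = a].
Proof.
have := measurable_g_eq ug a 0.
by under [X in measurable X]eq_set do rewrite addr0.
Qed.

(** This is the finite total measure of ends: up to a null set the plateau lies in {g = a}, where
    [vol_eq_moves] bounds the volume. *)
Lemma vol_plateau_moves r : 0 <= r -> exists2 M, 0 <= M & forall s h,
  s * s = 1 -> 0 <= h -> h <= 1 ->
  vol ((plateau v e `&` moves (s * h)) `&` cube r) <= M * h.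
Proof.
move=> r0; have [M M0 HM] := vol_eq_moves r0; exists M => // s h ss h0 h1.
have mc := @measurable_cube R n r.
have mm := measurable_moves (s * h).
have mP := measurable_plateau; have mg := measurable_g_eq0.
have key : vol (([set x | g x = a] `&` moves (s * h)) `&` cube r) <= M * h.
  have [H1 H2] := HM h h0 h1.
  move/eqP: ss; rewrite -expr2 sqrf_eq1 => /orP[/eqP ->|/eqP ->].
    by rewrite mul1r.
  by rewrite mulN1r.
have m1 : measurable (([set x | g x = a] `&` moves (s * h)) `&` cube r).
  by apply: measurableI => //; exact: measurableI.
have m2 : measurable ((plateau v e `&` ~` [set x | g x = a]) `&` cube r).
  by apply: measurableI => //; apply: measurableI => //; exact: measurableC.
apply: le_trans key; rewrite -[leRHS]addr0 -(vol_plateau_neq r0).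
apply: le_trans (vol_setU_le m1 m2 (@subIsetr _ _ _) (@subIsetr _ _ _)).
apply: (@le_vol _ _ r).
- by apply: measurableI => //; exact: measurableI.
- exact: measurableU.
- by rewrite -setIUl; exact: subIsetr.
move=> x [[Px mx] cx]; have [gx|gx] := pselect (g x = a); first by left.
by right.
Qed.

(** A point off the plateau moves at every step length, so [vol_eq_moves] bounds this volume by M /
    (N + 1) for all N. *)
Lemma vol_eq_plateau r : 0 <= r ->
  vol (([set x | g x = a] `&` ~` plateau v e) `&` cube r) = 0.
Proof.
move=> r0; have [M M0 HM] := vol_eq_moves r0.
have mc := @measurable_cube R n r.
apply/eqP; rewrite eq_le vol_ge0 andbT; apply: (@le0_inv_nat _ _ M) => N.
have e0 : 0 <= N.+1%:R^-1 :> R by rewrite invr_ge0.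
have e1 : N.+1%:R^-1 <= 1 :> R by rewrite invf_le1// ler1n.
have [H _] := HM _ e0 e1; apply: le_trans H; apply: (@le_vol _ _ r).
- apply: measurableI => //; apply: measurableI; first exact: measurable_g_eq0.
  by apply: measurableC; exact: measurable_plateau.
- apply: measurableI => //; apply: measurableI; first exact: measurable_g_eq0.
  exact: measurable_moves.
- exact: subIsetr.
move=> x [[gx nP] cx]; split => //; split => // vx; apply: nP.
by exists N.+1%:R^-1; [rewrite invr_gt0|left].
Qed.

(* A point whose orbit under [N] steps leaves its level set does so at a first
   step, which is taken from the plateau. *)
Lemma vol_chain r s h (N : nat) (X D : set 'rV[R]_n) : s * s = 1 -> 0 < h ->
  measurable X -> measurable D -> X `<=` cube r -> D `<=` cube r ->
  X `<=` plateau v e -> X `<=` moves (s * (N%:R * h)) ->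
  (forall x (i : nat), X x -> (i < N)%N -> v (x + (s * (i%:R * h)) *: e) = v x ->
     D (x + (s * (i%:R * h)) *: e)) ->
  vol X <= N%:R * vol (D `&` (plateau v e `&` moves (s * h))).
Proof.
move=> ss h0 mX mD Xr Dr XP Xm XD.
set W := D `&` _.
have mW : measurable W.
  apply: measurableI => //; apply: measurableI; first exact: measurable_plateau.
  exact: measurable_moves.
have Wr : W `<=` cube r by move=> x [/Dr].
pose T (i : 'I_N) := X `&` (fun x : 'rV[R]_n => x + (s * (i%:R * h)) *: e) @^-1` W.
have mT i : measurable (T i).
  by apply: measurableI => //; exact: measurable_preimage_shift.
have Tr i : T i `<=` cube r by move=> x [/Xr].
have volT i : vol (T i) <= vol W.
  rewrite -[leRHS](vol_shift ((s * (i%:R * h)) *: e) mW).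
  apply: (@le_vol _ _ (r + `|(s * (i%:R * h)) *: e|)) => //.
  - exact: measurable_preimage_shift.
  - move=> x /Wr cx; rewrite -(addrK ((s * (i%:R * h)) *: e) x).
    by apply: cubeD cx _; rewrite normrN.
  - by move=> x [].
apply: (@le_trans _ _ (vol (\big[setU/set0]_(i <- enum 'I_N) T i))); last first.
  apply: (le_trans (vol_bigsetU_le (enum 'I_N) mT Tr)).
  apply: (@le_trans _ _ (\sum_(i <- enum 'I_N) vol W)); first exact: ler_sum.
  by rewrite big_enum sumr_const card_ord mulr_natl.
apply: (@le_vol _ _ r) => //.
- exact: bigsetU_measurable.
- by elim/big_ind : _ => // A B Ar Br; rewrite subUset.
move=> x Xx; rewrite -bigcup_seq.
apply: contrapT => nT; apply: (Xm x Xx).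
suff H (i : nat) : (i <= N)%N -> v (x + (s * (i%:R * h)) *: e) = v x by exact: H.
elim: i => [_|i IH iN]; first by rewrite mul0r mulr0 scale0r addr0.
have vi := IH (ltnW iN).
apply: contrapT => vi1; apply: nT; exists (Ordinal iN) => /=; first by rewrite mem_enum.
split => //=; split; first exact: XD.
split; last first.
  rewrite /moves /= vi (_ : x + _ + _ = x + (s * (i.+1%:R * h)) *: e)//.
  by rewrite -addrA -scalerDl -natr1; congr (_ + _ *: _); ring.
(* The point before the failing step is on the plateau: for i = 0 because [X] is, for later steps
   because [v] has the same value at the start of the orbit. *)
case: i iN {vi1} vi {IH} => [|i] iN vi.
  by rewrite mul0r mulr0 scale0r addr0; exact: XP.
exists (i.+1%:R * h); first by rewrite mulr_gt0.
move/eqP: ss; rewrite -expr2 sqrf_eq1 => /orP[/eqP s1|/eqP s1].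
  by right; rewrite vi s1 mul1r addrK.
by left; rewrite vi s1 mulN1r scaleNr subrK.
Qed.

End direction.

(** * Counting at dyadic scales *)

(** [vol_chain] compares two scales only when their ratio is an integer, which holds for any two
    powers of 1/2. *)
Definition dyad {R : realType} (k : nat) : R := 2^-1 ^+ k.

Section dyad.
Context {R : realType}.

Lemma dyad_gt0 k : 0 < dyad k :> R. Proof. by rewrite exprn_gt0. Qed.

Lemma dyad_le1 k : dyad k <= 1 :> R.
Proof. by rewrite exprn_ile1// invf_le1// ler1n. Qed.

Lemma dyad_step k j : (k <= j)%N -> (2 ^ (j - k))%:R * dyad j = dyad k :> R.
Proof.
move=> kj; rewrite /dyad -[in X in _ ^+ X](subnK kj) exprD mulrA natrX -exprMn.
by rewrite divff ?pnatr_eq0// expr1n mul1r.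
Qed.

Lemma dyad_small (d : R) : 0 < d -> exists k, dyad k < d.
Proof.
move=> d0; exists (Num.truncn d^-1).+1.
rewrite /dyad exprVn invf_plt ?posrE ?exprn_gt0//.
apply: (lt_trans (truncnS_gt _)); rewrite -natrX ltr_nat; exact: ltn_expl.
Qed.

End dyad.

Section tail.
Context {R : realType} (n : nat) (u : 'rV[R]_n -> R) (g : 'rV[R]_n -> 'rV[R]_n).
Hypothesis ug : admissible u g.
Variables (a e : 'rV[R]_n) (rho : R).
Hypothesis dae : direction g a e rho.
Variable theta : nat -> 'rV[R]_n.
Hypothesis dense_theta : forall x d, 0 < d -> exists i, `|theta i - x| <= d.
Implicit Types (B : set 'rV[R]_n) (x y z : 'rV[R]_n) (h r s : R).
Local Notation v := (tilt u a).
Notation moves := (moves u a e).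

Definition low (p : nat) : set 'rV[R]_n :=
  [set x | exists2 i, (i < p)%N & tilt u a x = tilt u a (theta i)].

Lemma measurable_low p : measurable (low p).
Proof.
rewrite (_ : low p = \bigcup_(i in `I_p) [set x | tilt u a x = tilt u a (theta i)]).
  apply: bigcup_measurable => i _; apply: measurable_eq_set => //.
  exact: measurable_tilt ug a.
by apply/seteqP; split => x [i ip xi]; exists i.
Qed.

Lemma low_le p q : (p <= q)%N -> low p `<=` low q.
Proof. by move=> pq x [i ip xi]; exists i => //; exact: leq_trans pq. Qed.

Lemma plateau_low x : plateau v e x -> exists i, v x = v (theta i).
Proof.
have H y h : 0 < h -> v (y + (h + h) *: e) = v y -> exists i, v y = v (theta i).
  move=> h0 vy; have r0 : 0 < rho * h by rewrite mulr_gt0// (dir_rho dae).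
  have [i yi] := dense_theta (y + h *: e) r0; exists i.
  have vyh : v (y + h *: e - h *: e) = v (y + h *: e + h *: e).
    by rewrite addrK -addrA -scalerDl vy.
  have -> : v (theta i) = _ := diamond ug dae h0 vyh yi.
  by rewrite -addrA -scalerDl vy.
move=> [k k0 [vx|vx]].
  by apply: (H _ (k / 2)); rewrite ?divr_gt0// -splitr.
rewrite -vx; apply: (H _ (k / 2)); rewrite ?divr_gt0// -splitr subrK.
by rewrite vx.
Qed.

Definition tail_set s k p : set 'rV[R]_n :=
  (plateau v e `&` moves (s * dyad k)) `&` ~` low p.

Lemma measurable_plateau_moves h : measurable (plateau v e `&` moves h).
Proof.
by apply: measurableI; [exact: (measurable_plateau ug dae)|exact: (measurable_moves ug)].
Qed.

Lemma measurable_tail s k p : measurable (tail_set s k p).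
Proof.
apply: measurableI; first exact: measurable_plateau_moves.
by apply: measurableC; exact: measurable_low.
Qed.

Lemma cube_chain r s h (i N : nat) x : s * s = 1 -> 0 <= h -> N%:R * h <= 1 ->
  (i <= N)%N -> cube r x -> cube (r + 1) (x + (s * (i%:R * h)) *: e).
Proof.
move=> ss h0 Nh iN cx; apply: cubeD cx _; rewrite normrZ !normrM.
have -> : `|s| = 1.
  by move/eqP: ss; rewrite -expr2 sqrf_eq1 => /orP[/eqP ->|/eqP ->];
    rewrite ?normrN normr1.
rewrite mul1r (ger0_norm h0) normr_nat; apply: mulr_ile1 => //.
- by rewrite mulr_ge0.
- by apply: le_trans Nh; rewrite ler_wpM2r// ler_nat.
- exact: dir_norm dae.
Qed.

(* If every tail carried more than [eps], then picking finitely many levels again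
   and again, and counting all of them at a common fine scale, would exceed the
   bound of [vol_plateau_moves]. *)
Lemma vol_tail_small r s (eps : R) : 0 <= r -> 0 < eps -> s * s = 1 ->
  exists p, forall k, vol (tail_set s k p `&` cube r) <= eps * dyad k.
Proof.
move=> r0 eps0 ss; apply: contrapT => /forallNP H.
have {}H p : exists k, eps * dyad k < vol (tail_set s k p `&` cube r).
  have /existsNP[k /negP] := H p; rewrite -ltNge; by exists k.
have mc t := @measurable_cube R n t.
have r1 : 0 <= r + 1 by rewrite addr_ge0.
pose Y j := plateau v e `&` moves (s * dyad j).
have mY j : measurable (Y j) by exact: measurable_plateau_moves.
(* After N rounds, finitely many levels carry volume at least N eps 2^-j at every sufficiently fine
   scale j; more than M / eps rounds exceed the bound M 2^-j. *)
suff gain (N : nat) : exists p j0, forall j, (j0 <= j)%N ->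
    N%:R * (eps * dyad j) <= vol ((Y j `&` low p) `&` cube (r + 1)).
  have [M M0 HM] := vol_plateau_moves ug dae r1.
  pose N := (Num.truncn (M / eps)).+1.
  have [p [j0 Hj]] := gain N; have := Hj j0 (leqnn _).
  have := HM s (dyad j0) ss (ltW (dyad_gt0 _)) (dyad_le1 _) => H1 H2.
  have : N%:R * (eps * dyad j0) <= M * dyad j0.
    apply: (le_trans H2); apply: le_trans H1; apply: (@le_vol _ _ (r + 1)).
    - by apply: measurableI => //; apply: measurableI => //; exact: measurable_low.
    - by apply: measurableI => //; exact: mY.
    - exact: subIsetr.
    - by move=> x [[Yx _] cx].
  rewrite mulrA ler_pM2r ?dyad_gt0// -ler_pdivlMr//.
  by rewrite leNgt truncnS_gt.
elim: N => [|N [p [j0 Hj]]].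
  by exists 0%N, 0%N => j _; rewrite mul0r vol_ge0.
have [k Hk] := H p.
(* By [plateau_low] the sets [low q] exhaust the tail, and continuity of the volume from below
   preserves the strict inequality for some finite q. *)
have [p' Hp'] : exists p', eps * dyad k <
    vol ((tail_set s k p `&` low p') `&` cube r).
  apply: contrapT => /forallNP K; move: Hk; rewrite ltNge => /negP; apply.
  rewrite (_ : tail_set s k p `&` cube r =
      \bigcup_q ((tail_set s k p `&` low q) `&` cube r)); last first.
    apply/seteqP; split => [x [tx cx]|x [q _ [[tx _] cx]]] //.
    have [i xi] := plateau_low tx.1.1.
    by exists i.+1 => //; split => //; split => //; exists i.
  apply: (@vol_bigcup_le _ _ r).
  - move=> i j ij; apply/subsetPset; apply: setSI; apply: setIS; exact: low_le.
  - move=> q; apply: measurableI => //; apply: measurableI; first exact: measurable_tail.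
    exact: measurable_low.
  - by move=> q; exact: subIsetr.
  - by move=> q; rewrite leNgt; apply/negP; exact: K.
exists (maxn p p'), (maxn j0 k) => j; rewrite geq_max => /andP[j0j kj].
(* The new levels only, so that the gain is disjoint from what was gathered. A chain keeps the level
   of its starting point and travels at most 2^-k <= 1, whence the enlarged cube. *)
pose D := (low p' `&` ~` low p) `&` cube (r + 1).
have mD : measurable D.
  apply: measurableI => //; apply: measurableI; first exact: measurable_low.
  by apply: measurableC; exact: measurable_low.
have Dr : D `<=` cube (r + 1) by exact: subIsetr.
pose X := (tail_set s k p `&` low p') `&` cube r.
have mX : measurable X.
  apply: measurableI => //; apply: measurableI; first exact: measurable_tail.
  exact: measurable_low.
have dj := @dyad_gt0 R j.
have chain : vol X <= (2 ^ (j - k))%:R * vol (D `&` Y j).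
  apply: (vol_chain ug dae ss dj mX mD _ Dr).
  - by move=> x [_ cx]; move: cx; apply: sub_cube; rewrite lerDl.
  - by move=> x [[[[]]]].
  - by move=> x [[[[_ mx] _] _] _]; rewrite dyad_step.
  move=> x i [[[_ nl] lx] cx] iN vi; split.
    split; first by case: lx => q qp xq; exists q => //; rewrite -xq.
    by move=> [q qp xq]; apply: nl; exists q => //; rewrite -xq vi.
  apply: cube_chain ss (ltW dj) _ (ltnW iN) cx.
  by rewrite dyad_step// dyad_le1.
have {}chain : eps * dyad j <= vol (D `&` Y j).
  have := le_trans (ltW Hp') chain; rewrite -(@dyad_step R _ _ kj) mulrCA.
  by rewrite ler_pM2l// ltr0n expn_gt0.
rewrite -natr1 mulrDl mul1r; apply: (le_trans (lerD (Hj j j0j) chain)).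
have m1 : measurable ((Y j `&` low p) `&` cube (r + 1)).
  by apply: measurableI => //; apply: measurableI => //; exact: measurable_low.
have m2 : measurable (D `&` Y j) by exact: measurableI.
rewrite -(vol_setU m1 m2 (@subIsetr _ _ _)).
- apply: (@le_vol _ _ (r + 1)).
  + exact: measurableU.
  + by apply: measurableI => //; apply: measurableI => //; exact: measurable_low.
  + exact: subIsetr.
  move=> x [[[Yx lx] cx]|[[[lx _] cx] Yx]]; split => //; split => //.
    by move: lx; apply: low_le; exact: leq_maxl.
  by move: lx; apply: low_le; exact: leq_maxr.
- by move=> x [/Dr].
- by rewrite -subset0 => x [[[_ lx] _] [[[_ nlx] _] _]].
Qed.

Definition cball (x : 'rV[R]_n) (d : R) : set 'rV[R]_n := [set y | `|y - x| <= d].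

Lemma measurable_cball x d : measurable (cball x d).
Proof. exact: (measurable_preimage_shift (- x) (@measurable_cube R n d)). Qed.

(** An entry (x, k) stands for the ball of radius 2^-k about [x]. The doubled balls are kept
    disjoint and off the low levels because [vol_chain] pushes points of the inner ball by up to
    2^-k. *)
Definition packed r p (L : seq ('rV[R]_n * nat)) :=
  [/\ forall q, q \in L -> cball q.1 (2 * dyad q.2) `<=` cube r,
      forall q, q \in L -> cball q.1 (2 * dyad q.2) `&` low p = set0,
      uniq L &
      forall q q', q \in L -> q' \in L -> q != q' ->
        cball q.1 (2 * dyad q.2) `&` cball q'.1 (2 * dyad q'.2) = set0].

Lemma vol_disjoint r (B : set 'rV[R]_n) (I : choiceType) (s : seq I) (F : I -> set 'rV[R]_n) :
  measurable B -> B `<=` cube r -> (forall i, measurable (F i)) -> uniq s ->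
  (forall i j, i \in s -> j \in s -> i != j -> F i `&` F j = set0) ->
  \sum_(i <- s) vol (F i `&` B) <= vol (\big[setU/set0]_(i <- s) F i `&` B).
Proof.
move=> mB Br mF; elim: s => [|i s IH] us ds.
  by rewrite !big_nil set0I vol0.
move: us => /= /andP[nis us]; rewrite !big_cons setIUl.
have mb : measurable (\big[setU/set0]_(i <- s) F i) by exact: bigsetU_measurable.
have m1 : measurable (F i `&` B) by exact: measurableI.
have m2 : measurable (\big[setU/set0]_(i <- s) F i `&` B) by exact: measurableI.
have s1 : F i `&` B `<=` cube r by apply: subset_trans Br; exact: subIsetr.
have s2 : \big[setU/set0]_(i <- s) F i `&` B `<=` cube r.
  by apply: subset_trans Br; exact: subIsetr.
rewrite (vol_setU m1 m2 s1 s2).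
  rewrite lerD2l; apply: IH => // j k js ks; apply: ds; rewrite inE ?js ?ks orbT//.
rewrite -subset0 => x [[Fix _] [+ _]]; rewrite -bigcup_seq => -[j /= js Fjx].
have ij : i != j by apply: contraNneq nis => ->.
have E : F i `&` F j = set0 by apply: ds => //; rewrite inE ?eqxx ?js ?orbT.
by have : (F i `&` F j) x by []; rewrite E.
Qed.

(* [vol_chain] brings all the terms to the finest scale, where they become volumes
   of disjoint subsets of one tail set. *)
Lemma sum_core_le r s p (eps c : R) (L : seq ('rV[R]_n * nat)) :
  0 <= r -> s * s = 1 -> 0 <= c -> c <= 1 ->
  (forall k, vol (tail_set s k p `&` cube r) <= eps * dyad k) -> packed r p L ->
  \sum_(q <- L) vol (cball q.1 (c * dyad q.2) `&` (plateau v e `&` moves (s * dyad q.2)))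
    / dyad q.2 <= eps.
Proof.
move=> r0 ss c0 c1 Htail [Lr Ll uL dL].
have mc := @measurable_cube R n r.
pose j := \max_(q <- L) q.2.
have jL q : q \in L -> (q.2 <= j)%N.
  by move=> qL; rewrite /j (big_rem _ qL) /= leq_maxl.
have dj := @dyad_gt0 R j.
rewrite -(ler_pM2r dj); apply: le_trans (Htail j).
have mT : measurable (tail_set s j p `&` cube r).
  by apply: measurableI => //; exact: measurable_tail.
have mF (q : 'rV[R]_n * nat) : measurable (cball q.1 (2 * dyad q.2)).
  exact: measurable_cball.
apply: (@le_trans _ _ (vol (\big[setU/set0]_(q <- L) cball q.1 (2 * dyad q.2) `&`
    (tail_set s j p `&` cube r)))); last first.
  apply: (@le_vol _ _ r) => //.
  by apply: measurableI => //; apply: bigsetU_measurable => q _; exact: mF.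
apply: le_trans (vol_disjoint mT (@subIsetr _ _ _) mF uL dL).
rewrite mulr_suml big_seq [leRHS]big_seq; apply: ler_sum => q qL.
set X := cball q.1 (c * dyad q.2) `&` _.
have dq := @dyad_gt0 R q.2.
have c2 : c * dyad q.2 <= 2 * dyad q.2.
  by apply: ler_wpM2r; [exact: ltW|rewrite (le_trans c1)// ler1n].
have Xc : X `<=` cball q.1 (2 * dyad q.2).
  by move=> x [/= /le_trans + _]; exact.
have mX : measurable X.
  by apply: measurableI; [exact: measurable_cball|exact: measurable_plateau_moves].
have Xr : X `<=` cube r by apply: subset_trans Xc _; exact: Lr.
have chain := vol_chain ug dae ss dj mX (mF q) Xr (Lr q qL).
set W := vol (_ `&` (tail_set s j p `&` _)).
have -> : vol X / dyad q.2 * dyad j = vol X * dyad j / dyad q.2 by rewrite mulrAC.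
rewrite ler_pdivrMr//.
have -> : W * dyad q.2 = (2 ^ (j - q.2))%:R * W * dyad j.
  by rewrite -(@dyad_step R _ _ (jL q qL)); ring.
rewrite ler_pM2r//.
apply: (le_trans (chain (2 ^ (j - q.2))%N _ _ _)).
- by move=> x [_ []].
- by move=> x [_ [_ mx]]; rewrite dyad_step// jL.
- move=> x i [cx _] iN _; rewrite /cball /= addrAC.
  rewrite (le_trans (ler_normD _ _))// (_ : 2 * dyad q.2 = dyad q.2 + dyad q.2); last by ring.
  apply: lerD.
    by rewrite (le_trans cx)// ler_piMl// ltW.
  have h0 := ltW dj.
  rewrite normrZ !normrM (_ : `|s| = 1); last first.
    by move/eqP: ss; rewrite -expr2 sqrf_eq1 => /orP[/eqP ->|/eqP ->];
      rewrite ?normrN normr1.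
  rewrite mul1r (ger0_norm h0) normr_nat.
  apply: (@le_trans _ _ (i%:R * dyad j)); first by apply: ler_piMr; [rewrite mulr_ge0|exact: dir_norm dae].
  by rewrite -(@dyad_step R _ _ (jL q qL)) ler_wpM2r// ler_nat ltnW.
rewrite ler_wpM2l//.
apply: (@le_vol _ _ r) => //.
- by apply: measurableI => //; exact: measurable_plateau_moves.
- by apply: measurableI.
- by move=> x [/(Lr _ qL)].
move=> x [cx Yx]; split => //; split; last exact: Lr cx.
by split => // lx; have : set0 x by rewrite -(Ll q qL); split.
Qed.

End tail.

(** * The packing bound at singular points, all gradient values together *)

Section family.
Context {R : realType} (n : nat) (u : 'rV[R]_n -> R) (g : 'rV[R]_n -> 'rV[R]_n).
Hypothesis n_gt0 : (0 < n)%N.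
Hypothesis ug : admissible u g.
Variables (m : nat) (p E : 'I_m -> 'rV[R]_n) (rho : R).
Hypothesis rho2 : rho <= 2.
Hypothesis dirs : forall k, direction g (p k) (E k) rho.
Hypothesis g_range : forall x, exists k, g x = p k.
Variable theta : nat -> 'rV[R]_n.
Hypothesis dense_theta : forall x d, 0 < d -> exists i, `|theta i - x| <= d.

Lemma tail_set_le a e s k q q' : (q <= q')%N ->
  tail_set u a e theta s k q' `<=` tail_set u a e theta s k q.
Proof. by move=> qq x [Yx nl]; split => // /(low_le qq). Qed.

Lemma vol_tail_family r (eps : R) : 0 <= r -> 0 < eps -> exists P, forall j (b : bool) k,
  vol (tail_set u (p j) (E j) theta ((-1) ^+ b) k P `&` cube r) <= eps * dyad k.
Proof.
move=> r0 eps0.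
have H (jb : 'I_m * bool) : exists P, forall k,
    vol (tail_set u (p jb.1) (E jb.1) theta ((-1) ^+ jb.2) k P `&` cube r) <= eps * dyad k.
  by apply: (vol_tail_small ug (dirs jb.1)) => //; rewrite -expr2 sqrr_sign.
have [f Hf] := choice H.
exists (\max_jb f jb) => j b k; apply: le_trans (Hf (j, b) k) => /=.
have mT q : measurable (tail_set u (p j) (E j) theta ((-1) ^+ b) k q).
  exact: (measurable_tail ug (dirs j)).
apply: (@le_vol _ _ r); try (by apply: measurableI => //; exact: measurable_cube).
  exact: subIsetr.
by apply: setSI; apply: tail_set_le; exact: leq_bigmax.
Qed.

Lemma vol_cball (x : 'rV[R]_n) d : 0 <= d -> vol (cball x d) = (d + d) ^+ n.
Proof.
move=> d0.
have -> : vol (cball x d) = vol (@cube R n d).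
  exact: (vol_shift (- x) (@measurable_cube R n d)).
rewrite /vol cube_box// lebesgue_box; last first.
  by move=> i; rewrite (@le_trans _ _ 0) ?oppr_le0.
by rewrite /= prodr_const card_ord opprK.
Qed.

(** Almost every point of the ball of radius (rho/2) 2^-k about a singular point lies on the plateau
    of its own gradient value, and it moves under a step 2^-k in one of the two directions. So the
    ball's volume, (rho 2^-k)^n, is at most a sum of 2m volumes controlled by [sum_core_le];
    division by 2^-k leaves the power n - 1. *)
Lemma sum_packed_le r (eps : R) : 0 <= r -> 0 < eps -> exists P, forall L,
  (forall j, packed u (p j) theta r P L) ->
  (forall q, q \in L -> singular_set u q.1) ->
  \sum_(q <- L) dyad q.2 ^+ n.-1 <= eps.
Proof.
move=> r0 eps0.
have mc t := @measurable_cube R n t.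
have [j0 _] := g_range 0.
have rho0 : 0 < rho := dir_rho (dirs j0).
(* Calibrated for the end: each of the 2m pairs (gradient value, sign) contributes at most [eps'],
   and [rho ^+ n] comes from the volume of the inner ball. *)
pose K := m%:R * 2 + 1 : R.
have K0 : 0 < K by rewrite ltr_wpDl// mulr_ge0.
pose eps' := eps * rho ^+ n / K.
have eps'0 : 0 < eps' by rewrite divr_gt0// mulr_gt0// exprn_gt0.
have [P HP] := vol_tail_family r0 eps'0.
exists P => L pL sL.
(* Half of rho gives the strict inequality asked by [direction_regular], and rho <= 2 gives the
   bound c <= 1 asked by [sum_core_le]. *)
have c0 : 0 <= rho / 2 by rewrite divr_ge0// ltW.
have c1 : rho / 2 <= 1 by rewrite ler_pdivrMr// mul1r.
pose X (q : 'rV[R]_n * nat) j (b : bool) := cball q.1 (rho / 2 * dyad q.2) `&`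
  (plateau (tilt u (p j)) (E j) `&` moves u (p j) (E j) ((-1) ^+ b * dyad q.2)).
have H (jb : 'I_m * bool) : \sum_(q <- L) vol (X q jb.1 jb.2) / dyad q.2 <= eps'.
  apply: (sum_core_le ug (dirs jb.1) r0 _ c0 c1 _ (pL jb.1)); last exact: HP.
  by rewrite -expr2 sqrr_sign.
have core q : q \in L -> (rho * dyad q.2) ^+ n <= \sum_(jb : 'I_m * bool) vol (X q jb.1 jb.2).
  move=> qL; have dq := @dyad_gt0 R q.2.
  set C := cball q.1 (rho / 2 * dyad q.2).
  have mC : measurable C by exact: measurable_cball.
  have Cr : C `<=` cube r.
    have [Lr _ _ _] := pL j0; apply: subset_trans (Lr q qL) => x /= /le_trans; apply.
    by rewrite ler_wpM2r ?(ltW dq)// (le_trans c1)// ler1n.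
  have mX j b : measurable (X q j b).
    by apply: measurableI => //; exact: (measurable_plateau_moves ug (dirs j)).
  have Xr j b : X q j b `<=` cube r by move=> x [/Cr].
  pose Z j := ([set x | g x = p j] `&` ~` plateau (tilt u (p j)) (E j)) `&` cube r.
  have mZ j : measurable (Z j).
    apply: measurableI => //; apply: measurableI; first exact: measurable_g_eq0 ug _.
    by apply: measurableC; exact: (measurable_plateau ug (dirs j)).
  have Zr j : Z j `<=` cube r by exact: subIsetr.
  have Z0 j : vol (Z j) = 0 by exact: (vol_eq_plateau ug (dirs j)).
  have -> : (rho * dyad q.2) ^+ n = vol C.
    rewrite vol_cball; last by rewrite mulr_ge0// ltW.
    by rewrite -mulrDl -splitr.
  pose A1 := \big[setU/set0]_(jb <- enum {: 'I_m * bool}) X q jb.1 jb.2.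
  pose A2 := \big[setU/set0]_(j <- enum 'I_m) Z j.
  have mA1 : measurable A1 by apply: bigsetU_measurable => jb _; exact: mX.
  have mA2 : measurable A2 by apply: bigsetU_measurable => j _; exact: mZ.
  have A1r : A1 `<=` cube r.
    by rewrite /A1; elim/big_ind : _ => // A B Ar Br; rewrite subUset.
  have A2r : A2 `<=` cube r.
    by rewrite /A2; elim/big_ind : _ => // A B Ar Br; rewrite subUset.
  have vA1 : vol A1 <= \sum_(jb : 'I_m * bool) vol (X q jb.1 jb.2).
    apply: (le_trans (vol_bigsetU_le _ (fun jb => mX jb.1 jb.2) (fun jb => Xr jb.1 jb.2))).
    by rewrite big_enum.
  have vA2 : vol A2 <= 0.
    apply: (le_trans (vol_bigsetU_le _ mZ Zr)).
    by rewrite big1.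
  rewrite -[leRHS]addr0; apply: le_trans (lerD vA1 vA2).
  apply: le_trans (vol_setU_le mA1 mA2 A1r A2r).
  apply: (@le_vol _ _ r) => //; [exact: measurableU|by rewrite subUset|].
  move=> x Cx; have [j gx] := g_range x.
  have [Px|nPx] := pselect (plateau (tilt u (p j)) (E j) x); last first.
    right; rewrite /A2 -bigcup_seq; exists j => /=; first by rewrite mem_enum.
    by split; [split|exact: Cr].
  left; rewrite /A1 -bigcup_seq.
  suff [b mb] : exists b : bool, moves u (p j) (E j) ((-1) ^+ b * dyad q.2) x.
    by exists (j, b) => /=; [rewrite mem_enum|split].
  (* If neither step moves [x], then [v] agrees at both ends of the segment centred at [x], and the
     diamond there contains the singular point in its interior. *)
  apply: contrapT => /forallNP nm; apply: (sL q qL).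
  have := nm true; have := nm false; rewrite /moves /= expr0 expr1 mul1r mulN1r.
  move=> /contrapT h1 /contrapT h2.
  apply: (direction_regular ug (dirs j) dq (z := x)).
    rewrite distrC (le_lt_trans Cx)// ltr_pM2r// ltr_pdivrMr// ltr_pMr// ltr1n.
    by [].
  by rewrite h1 -scaleNr h2.
have : \sum_(q <- L) rho ^+ n * dyad q.2 ^+ n.-1 <= \sum_(jb : 'I_m * bool) eps'.
  apply: (@le_trans _ _ (\sum_(jb : 'I_m * bool) \sum_(q <- L) vol (X q jb.1 jb.2) / dyad q.2)).
    rewrite exchange_big /= big_seq [leRHS]big_seq; apply: ler_sum => q qL.
    rewrite -mulr_suml ler_pdivlMr ?dyad_gt0//; apply: le_trans (core q qL).
    by rewrite exprMn -mulrA -exprSr prednK.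
  by apply: ler_sum => jb _; exact: H.
rewrite sumr_const card_prod card_ord card_bool -mulr_sumr.
rewrite -ler_pdivlMl ?exprn_gt0// => /le_trans; apply.
rewrite /eps' -mulr_natl natrM.
have -> : (rho ^+ n)^-1 * (m%:R * 2 * (eps * rho ^+ n / K)) = eps * (m%:R * 2 / K).
  by field; rewrite !gt_eqF// exprn_gt0.
rewrite ler_piMr ?(ltW eps0)// ler_pdivrMr// mul1r /K lerDl ler01.
by [].
Qed.

End family.

(** * Hausdorff measure and the covering argument *)

Section hausdorff_cover.
Context {R : realType} (n : nat).
Implicit Types (S : set 'rV[R]_n) (x y z : 'rV[R]_n).

Lemma enorm_le z : enorm z <= n%:R * `|z|.
Proof.
have n0 : 0 <= n%:R * `|z| by rewrite mulr_ge0.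
have dd : 0 <= dotr z z by apply: sumr_ge0 => i _; rewrite -expr2 sqr_ge0.
rewrite -(@ler_pXn2r _ 2)// ?nnegrE ?sqrtr_ge0//.
rewrite sqr_sqrtr// (le_trans (ler_norm _))// (le_trans (dotr_bound _ _))//.
rewrite exprMn -!expr2 ler_wpM2r ?sqr_ge0//.
by rewrite -natrX ler_nat; case: (n) => // k; rewrite leq_pmulr.
Qed.

Lemma ediam_cball x d : (ediam (cball x d) <= (n%:R * (d + d))%:E)%E.
Proof.
apply: ge_ereal_sup => _ [[y z] [/= yx zx] <-] /=; rewrite lee_fin.
rewrite (le_trans (enorm_le _))// ler_wpM2l//.
have -> : y - z = (y - x) - (z - x) by apply/rowP => i; rewrite !mxE; ring.
by rewrite (le_trans (ler_normB _ _))// lerD.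
Qed.

Lemma diam_pow_cball x d (k : nat) : 0 <= d ->
  (diam_pow k%:R (cball x d) <= ((n%:R * (d + d)) ^+ k)%:E)%E.
Proof.
move=> d0; have D0 : 0 <= n%:R * (d + d) by rewrite mulr_ge0// addr_ge0.
rewrite /diam_pow; case: ifPn => _; first by rewrite lee_fin exprn_ge0.
rewrite -powR_mulrn// -poweR_EFin.
have h := ediam_cball x d.
have h0 : (0 <= ediam (cball x d))%E.
  apply: ereal_sup_ubound; exists (x, x) => /=; last first.
    rewrite subrr /enorm /dotr big1 ?sqrtr0// => i _; by rewrite mxE mul0r.
  by split => /=; rewrite /cball /= subrr normr0.
apply: gt0_ler_poweR => //; rewrite in_itv /= ?leey ?andbT// lee_fin//.
Qed.

Lemma diam_pow_ge0 s S : (0 <= diam_pow s S)%E.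
Proof. by rewrite /diam_pow; case: ifPn => // _; exact: poweR_ge0. Qed.

(** Naturals that code no index receive the empty set, which is free of charge: its [diam_pow] is 0
    even for the exponent 0, and its [ediam] is -oo. Partial sums of the series are then finite sums
    over distinct indices. *)
Lemma hausdorff_pre_cover (I : countType) (C : I -> set 'rV[R]_n) (b : I -> R)
    s delta eps S :
  S `<=` \bigcup_i C i -> (forall i, (ediam (C i) <= delta%:E)%E) ->
  (forall i, (diam_pow s (C i) <= (b i)%:E)%E) ->
  (forall t : seq I, uniq t -> \sum_(i <- t) b i <= eps) ->
  (hausdorff_pre s delta S <= eps%:E)%E.
Proof.
move=> SC dC bC teps.
pose E k := if @pickle_inv I k is Some i then C i else set0.
have Ele : (\sum_(0 <= k <oo) diam_pow s (E k) <= eps%:E)%E.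
  apply: lime_le; first by apply: is_cvg_nneseries => k _ _; exact: diam_pow_ge0.
  apply: nearW => N /=.
  apply: (@le_trans _ _ (\sum_(i <- pmap (@pickle_inv I) (iota 0 N)) b i)%:E); last first.
    rewrite lee_fin; apply: teps; apply: (pmap_uniq (@pickle_invK I)).
    exact: iota_uniq.
  rewrite /index_iota subn0; elim: (iota 0 N) => [|k l IH]; first by rewrite !big_nil.
  rewrite big_cons /= /E; case: (pickle_inv k) => [i|] /=.
    by rewrite big_cons EFinD; apply: leeD.
  by rewrite {1}/diam_pow eqxx add0e.
apply: le_trans Ele; apply: ereal_inf_lbound; exists E => //; split.
  move=> x /SC[i _ Cx]; exists (pickle i) => //.
  by rewrite /E pickleK_inv.
move=> k; rewrite /E; case: (pickle_inv k) => [i//|].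
rewrite (_ : ediam set0 = -oo%E) ?leNye// /ediam set0X image_set0.
exact: ereal_sup0.
Qed.

Lemma hausdorff_eq0 s S :
  (forall delta eps : R, 0 < delta -> 0 < eps -> (hausdorff_pre s delta S <= eps%:E)%E) ->
  hausdorff s S = 0%E.
Proof.
move=> H; apply/eqP; rewrite eq_le; apply/andP; split.
  apply: ge_ereal_sup => _ [d d0 <-]; apply/lee_addgt0Pr => e e0.
  by rewrite add0e; exact: H.
apply: (@le_trans _ _ (hausdorff_pre s 1 S)).
  apply: le_ereal_inf_tmp => _ [E _ <-].
  by apply: nneseries_ge0 => k _ _; exact: diam_pow_ge0.
by apply: ereal_sup_ubound; exists 1 => //=.
Qed.

End hausdorff_cover.

Section finite_sums.
Context {R : realType}.

Lemma ler_sum_subset (I : eqType) (s t : seq I) (F : I -> R) :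
  (forall i, 0 <= F i) -> uniq s -> {subset s <= t} ->
  \sum_(i <- s) F i <= \sum_(i <- t) F i.
Proof.
move=> F0; elim: s t => [|i s IH] t; first by rewrite big_nil sumr_ge0.
move=> /= /andP[nis us] st; have it : i \in t by apply: st; rewrite inE eqxx.
rewrite big_cons (big_rem i it)/= lerD2l; apply: IH => // j js.
have jt : j \in t by apply: st; rewrite inE js orbT.
rewrite -[j \in _]orFb -(_ : (j == i) = false).
  by have := perm_mem (perm_to_rem it) j; rewrite jt inE => <-.
by apply/negbTE; apply: contraNneq nis => <-.
Qed.

Lemma fin_min_radius (m : nat) (Q : 'I_m -> R -> Prop) :
  (forall j d d', d' <= d -> Q j d -> Q j d') ->
  (forall j, exists2 d, 0 < d & Q j d) -> exists2 d, 0 < d & forall j, Q j d.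
Proof.
move=> Qmono H.
suff [d d0 Hd] : exists2 d, 0 < d & forall j, j \in enum 'I_m -> Q j d.
  by exists d => // j; apply: Hd; rewrite mem_enum.
elim: (enum 'I_m) => [|i s [d d0 Hd]]; first by exists 1.
have [d' d'0 Hd'] := H i; exists (Num.min d d') => [|j]; first by rewrite lt_min d0.
rewrite inE => /predU1P[->|/Hd]; [apply: Qmono Hd'|apply: Qmono].
  by rewrite ge_min lexx orbT.
by rewrite ge_min lexx.
Qed.

End finite_sums.

(** * Greedy selection of disjoint balls *)

Section greedy.
Context {R : realType} (n : nat).
Variables (A : nat -> set 'rV[R]_n) (eps : R) (d : nat).

Definition well_separated (L : seq ('rV[R]_n * nat)) :=
  [/\ forall q, q \in L -> A q.2 q.1, uniq L &
      forall q q', q \in L -> q' \in L -> q != q' ->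
        cball q.1 (2 * dyad q.2) `&` cball q'.1 (2 * dyad q'.2) = set0].

Hypothesis well_separated_sum : forall L, well_separated L -> \sum_(q <- L) dyad q.2 ^+ d <= eps.

(** A maximal choice of new balls at level k exists because each costs 2^-kd and the total is at
    most eps: otherwise the list could be extended past eps / 2^-kd entries. *)
Lemma well_separated_extend k L : well_separated L -> exists s, [/\ well_separated (s ++ L),
  forall q, q \in s -> q.2 = k &
  forall x, A k x -> exists2 q, q \in s ++ L &
    cball x (2 * dyad k) `&` cball q.1 (2 * dyad q.2) !=set0].
Proof.
move=> sL; apply: contrapT => /forallNP H.
have ext s : well_separated (s ++ L) -> (forall q, q \in s -> q.2 = k) ->
    exists x, well_separated ((x, k) :: s ++ L).
  move=> ss sk; have /not_and3P[//|//|] := H s.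
  move=> /existsNP[x /not_implyP[Ax /forall2NP nx]]; exists x.
  have dis q : q \in s ++ L -> cball x (2 * dyad k) `&` cball q.1 (2 * dyad q.2) = set0.
    by move=> qs; apply: contrapT => /eqP/set0P ne; have [|] := nx q.
  have [sA us ds] := ss; split.
  - by move=> q; rewrite inE => /predU1P[->//|]; exact: sA.
  - rewrite /= us andbT; apply/negP => xs.
    have : (cball x (2 * dyad k) `&` cball x (2 * dyad k)) x.
      by split; rewrite /cball /= subrr normr0 mulr_ge0// ltW// dyad_gt0.
    by rewrite (dis _ xs).
  move=> q q'; rewrite !inE => /predU1P[->|qs] /predU1P[->|qs'] qq.
  - by rewrite eqxx in qq.
  - exact: dis.
  - by rewrite setIC; exact: dis.
  - exact: ds.
have long (N : nat) : exists s, [/\ well_separated (s ++ L), forall q, q \in s -> q.2 = k & size s = N].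
  elim: N => [|N [s [ss sk sN]]]; first by exists [::].
  have [x sx] := ext s ss sk; exists ((x, k) :: s); split => //=; last by rewrite sN.
  by move=> q; rewrite inE => /predU1P[->//|]; exact: sk.
have dk : 0 < dyad k ^+ d :> R by rewrite exprn_gt0// dyad_gt0.
have [s [ss sk sN]] := long (Num.truncn (eps / dyad k ^+ d)).+1.
have := well_separated_sum ss; rewrite big_cat /= big_seq.
rewrite (eq_bigr (fun=> dyad k ^+ d)); last by move=> q /sk ->.
rewrite -big_seq big_const_seq count_predT iter_addr_0 sN leNgt => /negP; apply.
apply: (@lt_le_trans _ _ (dyad k ^+ d *+ (Num.truncn (eps / dyad k ^+ d)).+1)).
  by rewrite -mulr_natl -ltr_pdivrMr//; exact: truncnS_gt.
by rewrite lerDl; apply: sumr_ge0 => q _; rewrite exprn_ge0// ltW// dyad_gt0.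
Qed.

(* Vitali's covering argument, one dyadic level after the other. *)
Lemma vitali_levels : exists S : nat -> seq ('rV[R]_n * nat),
  [/\ forall k q, q \in S k -> q.2 = k /\ A k q.1,
      forall K, \sum_(k <- iota 0 K) \sum_(q <- S k) dyad q.2 ^+ d <= eps &
      forall k x, A k x -> exists k' q, q \in S k' /\ cball q.1 (4 * dyad q.2) x].
Proof.
have H (kL : nat * seq ('rV[R]_n * nat)) : exists s, well_separated kL.2 ->
    [/\ well_separated (s ++ kL.2), forall q, q \in s -> q.2 = kL.1 &
    forall x, A kL.1 x -> exists2 q, q \in s ++ kL.2 &
      cball x (2 * dyad kL.1) `&` cball q.1 (2 * dyad q.2) !=set0].
  have [sL|nsL] := pselect (well_separated kL.2); last by exists [::].
  by have [s Hs] := well_separated_extend kL.1 sL; exists s.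
have [f Hf] := choice H.
(* [L k] collects the choices at all levels below k, and [S k] the new ones at level k. *)
pose L := fix L k := if k is j.+1 then f (j, L j) ++ L j else [::].
pose S k := f (k, L k).
have sepL k : well_separated (L k).
  by elim: k => [|k IH]; [split|have [] := Hf (k, L k) IH].
have Lmem k q : q \in L k -> exists2 k', (k' < k)%N & q \in S k'.
  elim: k => [//|k IH]; rewrite /= mem_cat => /orP[qS|/IH[k' kk qS]].
    by exists k.
  by exists k' => //; exact: ltnW.
have S2 k q : q \in S k -> q.2 = k by have [_ + _] := Hf (k, L k) (sepL k); exact.
exists S; split.
- move=> k q qS; have k2 := S2 k q qS; split => //.
  have [sA _ _] := sepL k.+1; rewrite -{1}k2; apply: sA.
  by rewrite /= mem_cat qS.
- move=> K; apply: le_trans (well_separated_sum (sepL K)).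
  elim: K => [|K IH]; first by rewrite !big_nil.
  rewrite -addn1 iotaD big_cat /= big_seq1 add0n addn1 /= big_cat /= addrC.
  by rewrite lerD2l.
move=> k x Ax; have [_ _ /(_ x Ax)[q qL [z [xz qz]]]] := Hf (k, L k) (sepL k).
have [k' kk qS] : exists2 k', (k' <= k)%N & q \in S k'.
  by apply: (Lmem k.+1); rewrite /=.
exists k', q; split => //; rewrite (S2 _ _ qS) in qz *.
(* The ball that is met was chosen at a level k' <= k, so its radius is no smaller, and 2 2^-k + 2
   2^-k' is at most 4 2^-k'. *)
have dd : dyad k <= dyad k' :> R.
  by rewrite /dyad ler_wiXn2l// ?invr_ge0// invf_le1// ler1n.
rewrite /cball /=; have -> : x - q.1 = (z - q.1) - (z - x) by apply/rowP => i; rewrite !mxE; ring.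
rewrite (le_trans (ler_normB _ _))//; have := lerD qz xz; rewrite /= => /le_trans; apply.
by move: dd; lra.
Qed.

End greedy.

Section remainder.
Context {R : realType} (n : nat) (u : 'rV[R]_n -> R) (g : 'rV[R]_n -> 'rV[R]_n).
Hypothesis n_gt0 : (0 < n)%N.
Hypothesis ug : admissible u g.
Variables (m : nat) (p E : 'I_m -> 'rV[R]_n) (rho : R).
Hypothesis rho2 : rho <= 2.
Hypothesis dirs : forall k, direction g (p k) (E k) rho.
Hypothesis g_range : forall x, exists k, g x = p k.
Variable theta : nat -> 'rV[R]_n.
Hypothesis dense_theta : forall x d, 0 < d -> exists i, `|theta i - x| <= d.

Lemma avoid_low x P : (forall j i, tilt u (p j) x <> tilt u (p j) (theta i)) ->
  exists2 d, 0 < d & forall j, cball x d `&` low u (p j) theta P = set0.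
Proof.
move=> Hx.
have [d d0 Hd] : exists2 d, 0 < d & forall j, forall (i : 'I_P) y, `|y - x| <= d ->
    tilt u (p j) y <> tilt u (p j) (theta i).
  apply: fin_min_radius => [j d d' dd H i y yx|j].
    by apply: H; exact: le_trans dd.
  apply: fin_min_radius => [i d d' dd H y yx|i].
    by apply: H; exact: le_trans dd.
  have cv := continuous_tilt ug (a := p j).
  case: (ltgtP (tilt u (p j) x) (tilt u (p j) (theta i))) => lt.
  - have [d d0 Hd] := continuous_lt_near cv lt; exists d => // y /Hd yx ye.
    by rewrite ye ltxx in yx.
  - have cN : continuous (fun y => - tilt u (p j) y).
      by move=> y; apply: (@cvgN _ _ _ _ (nbhs_filter y)); exact: cv.
    have lt' : - tilt u (p j) x < - tilt u (p j) (theta i) by rewrite ltrN2.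
    have [d d0 Hd] := continuous_lt_near cN lt'; exists d => // y /Hd yx ye.
    by rewrite ye ltxx in yx.
  - by case: (Hx j i).
exists d => // j; rewrite -subset0 => y [/= yx [i iP yi]].
exact: (Hd j (Ordinal iP) y yx yi).
Qed.

(** The packing bound is local, so the set is cut by the cubes of half-side r = 0, 1, 2, ..., the
    r-th with budget eps 2^-(r+1). In each cube the number P of avoided levels is fixed first;
    [avoid_low] then admits every point of the set as a centre at all fine enough levels. *)
Lemma hausdorff_remainder : hausdorff n.-1%:R
  [set x | singular_set u x /\ forall j i, tilt u (p j) x <> tilt u (p j) (theta i)] = 0%E.
Proof.
apply: hausdorff_eq0 => delta eps delta0 eps0.
have nR0 : 0 < n%:R :> R by rewrite ltr0n.
(* A sup-norm ball of radius 4 2^-k has Euclidean diameter at most 8 n 2^-k; [W] is the resulting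
   constant to the power n - 1. *)
pose W : R := (n%:R * 8) ^+ n.-1.
have W0 : 0 < W by rewrite exprn_gt0// mulr_gt0.
pose ep (r : nat) : R := eps * dyad r.+1.
have ep0 r : 0 < ep r by rewrite mulr_gt0// dyad_gt0.
have HS (r : nat) : exists S : nat -> seq ('rV[R]_n * nat),
   [/\ forall k q, q \in S k -> n%:R * (8 * dyad q.2) <= delta,
       forall K, \sum_(k <- iota 0 K) \sum_(q <- S k) W * dyad q.2 ^+ n.-1 <= ep r &
       forall x, singular_set u x -> (forall j i, tilt u (p j) x <> tilt u (p j) (theta i)) ->
         cube r%:R x -> exists k' q, q \in S k' /\ cball q.1 (4 * dyad q.2) x].
  (* The balls of radius 2 2^-k <= 2 about points of the r-th cube must fit in. *)
  have r0 : 0 <= r%:R + 2 :> R by rewrite addr_ge0.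
  have e0 : 0 < ep r / W by rewrite divr_gt0.
  have [P HP] := sum_packed_le n_gt0 ug rho2 dirs g_range dense_theta r0 e0.
  pose A k : set 'rV[R]_n := [set x | [/\ singular_set u x, cube r%:R x,
    n%:R * (8 * dyad k) <= delta &
    forall j, cball x (2 * dyad k) `&` low u (p j) theta P = set0]].
  have Hsep L : well_separated A L -> \sum_(q <- L) dyad q.2 ^+ n.-1 <= ep r / W.
    move=> [LA uL dL]; apply: HP => [j|q /LA[]//].
    split => // q /LA[_ rq _ lq]; last exact: lq.
    move=> y yq; have -> : y = q.1 + (y - q.1) by rewrite addrC subrK.
    apply: cubeD rq _.
    by rewrite (le_trans yq)// -[leRHS]mulr1 ler_wpM2l// dyad_le1.
  have [S [S1 S2 S3]] := vitali_levels Hsep.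
  exists S; split.
  - by move=> k q /S1[<- []].
  - move=> K; have := S2 K; rewrite ler_pdivlMr// => /(le_trans _); apply.
    rewrite mulr_suml; apply: ler_sum => k _; rewrite mulr_suml.
    by apply: ler_sum => q _; rewrite mulrC.
  move=> x sx nx rx.
  have [d d0 Hd] := avoid_low P nx.
  have [k Hk] : exists k, dyad k < Num.min (d / 2) (delta / (n%:R * 8)).
    by apply: dyad_small; rewrite lt_min !divr_gt0// mulr_gt0.
  apply: (S3 k); move: Hk; rewrite lt_min => /andP[k1 k2]; split => //.
    by rewrite mulrA mulrC -ler_pdivlMr ?mulr_gt0// ltW.
  move=> j; rewrite -subset0 -(Hd j); apply: setSI => y /= /le_trans; apply.
  by rewrite mulrC -ler_pdivlMr// ltW.
have [S HS'] := choice HS.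
pose q0 : 'rV[R]_n * nat := (0, 0%N).
(* An index is (cube, level, position in the list of balls); positions past the end of the list get
   the empty set and weight 0. *)
pose I := (nat * (nat * nat))%type.
pose ok (i : I) := (i.2.2 < size (S i.1 i.2.1))%N.
pose q (i : I) := nth q0 (S i.1 i.2.1) i.2.2.
pose C (i : I) := if ok i then cball (q i).1 (4 * dyad (q i).2) else set0.
pose b (i : I) : R := if ok i then W * dyad (q i).2 ^+ n.-1 else 0.
have dy0 k : 0 <= dyad k :> R by rewrite ltW// dyad_gt0.
have b0 i : 0 <= b i.
  by rewrite /b; case: ifP => // _; rewrite mulr_ge0 ?exprn_ge0// ltW.
apply: (@hausdorff_pre_cover _ _ I C b).
- move=> x [sx nx]; pose r := (Num.truncn `|x|).+1.
  have rx : cube r%:R x by rewrite /cube /= ltW// truncnS_gt.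
  have [_ _ H3] := HS' r; have [k [q' [qS qx]]] := H3 x sx nx rx.
  exists (r, (k, index q' (S r k))) => //.
  by rewrite /C /ok /q /= index_mem qS nth_index.
- move=> i; rewrite /C; case: ifP => oki; last first.
    rewrite (_ : ediam set0 = -oo%E) ?leNye// /ediam set0X image_set0.
    exact: ereal_sup0.
  apply: (le_trans (ediam_cball _ _)); rewrite lee_fin.
  have [H1 _ _] := HS' i.1; apply: le_trans (H1 i.2.1 (q i) (mem_nth _ oki)).
  by rewrite ler_wpM2l ?ler0n//; lra.
- move=> i; rewrite /C /b; case: ifP => oki; last by rewrite /diam_pow eqxx.
  have d40 : 0 <= 4 * dyad (q i).2 :> R by rewrite mulr_ge0.
  apply: (le_trans (diam_pow_cball _ _ d40)); rewrite lee_fin /W -exprMn.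
  by rewrite le_eqVlt; apply/orP; left; apply/eqP; congr (_ ^+ _); ring.
move=> t ut.
have [K Kt] : exists K, forall i, i \in t ->
    [/\ (i.1 < K)%N, (i.2.1 < K)%N & (i.2.2 < K)%N].
  exists (\max_(i <- t) maxn i.1 (maxn i.2.1 i.2.2)).+1 => i it.
  have : (maxn i.1 (maxn i.2.1 i.2.2) < (\max_(i <- t) maxn i.1 (maxn i.2.1 i.2.2)).+1)%N.
    by rewrite ltnS (big_rem i it)/= leq_maxl.
  by rewrite !gtn_max => /and3P[].
(* A finite set of indices sits in a grid, where the triple sum is bounded cube by cube. *)
pose box := [seq (r, kj) | r <- iota 0 K, kj <- [seq (k, j) | k <- iota 0 K, j <- iota 0 K]].
apply: (@le_trans _ _ (\sum_(i <- box) b i)).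
  apply: ler_sum_subset => // -[r [k j]] /Kt[/= h1 h2 h3].
  apply/allpairsP; exists (r, (k, j)); split; [by rewrite mem_iota| |by []].
  by apply/allpairsP; exists (k, j); split; [rewrite mem_iota|rewrite mem_iota|].
rewrite big_allpairs.
apply: (@le_trans _ _ (\sum_(r <- iota 0 K) ep r)).
  apply: ler_sum => r _; rewrite big_allpairs.
  have [_ H2 _] := HS' r; apply: le_trans (H2 K); apply: ler_sum => k _.
  rewrite [leRHS](big_nth q0) /index_iota subn0.
  rewrite (bigID (fun j => j < size (S r k))%N)/= [X in _ + X]big1 ?addr0; last first.
    by move=> j /negbTE nj; rewrite /b /ok /= nj.
  rewrite -big_filter.
  apply: (@le_trans _ _ (\sum_(j <- iota 0 (size (S r k))) b (r, (k, j)))).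
    apply: ler_sum_subset; [by move=> j; exact: b0|by apply: filter_uniq; exact: iota_uniq|].
    by move=> j; rewrite mem_filter => /andP[jS _]; rewrite mem_iota.
  rewrite big_seq [leRHS]big_seq; apply: ler_sum => j; rewrite mem_iota add0n => /andP[_ jS].
  by rewrite /b /ok /q /= jS.
rewrite -mulr_sumr ler_piMr ?(ltW eps0)//.
suff -> : \sum_(r <- iota 0 K) dyad r.+1 = 1 - dyad K :> R by rewrite lerBlDr lerDl.
elim: K {Kt box} => [|N IH]; first by rewrite big_nil /dyad expr0 subrr.
rewrite -addn1 iotaD big_cat /= big_seq1 IH add0n addn1 /dyad exprS.
by field.
Qed.

End remainder.

(** * Lipschitz graphs and separation *)

Lemma hausdorff0_sub {R : realType} n (s : R) (S S' : set 'rV[R]_n) :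
  S `<=` S' -> hausdorff s S' = 0%E -> hausdorff s S = 0%E.
Proof.
move=> SS' H0; apply: hausdorff_eq0 => d e d0 e0.
apply: (@le_trans _ _ (hausdorff_pre s d S')).
  apply: le_ereal_inf => _ [F [SF dF] <-]; exists F => //; split => //.
  exact: subset_trans SF.
apply: (@le_trans _ _ (hausdorff s S')); last by rewrite H0 lee_fin ltW.
by apply: ereal_sup_ubound; exists d.
Qed.

Section lipschitz_graph.
Context {R : realType}.

(* McShane's extension *)
Lemma lipschitz_extension (X : Type) (n : nat) (G : set X) (pi : X -> 'rV[R]_n)
    (t : X -> R) (L : R) : 0 <= L -> G !=set0 ->
  (forall x y, G x -> G y -> t x - t y <= L * `|pi x - pi y|) ->
  exists T : 'rV[R]_n -> R, (forall y z, `|T y - T z| <= L * `|y - z|) /\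
    forall x, G x -> T (pi x) = t x.
Proof.
move=> L0 [x0 Gx0] Ht.
pose V y := [set t x + L * `|y - pi x| | x in G].
have V0 y : V y !=set0 by exists (t x0 + L * `|y - pi x0|), x0.
have tri y x x' : L * `|pi x' - pi x| <= L * `|y - pi x| + L * `|y - pi x'|.
  rewrite -mulrDr ler_wpM2l//.
  have -> : pi x' - pi x = (y - pi x) - (y - pi x').
    by apply/rowP => i; rewrite !mxE; ring.
  exact: ler_normB.
have lbV y : has_lbound (V y).
  exists (t x0 - L * `|y - pi x0|) => _ [x Gx <-].
  by have := Ht x0 x Gx0 Gx; have := tri y x x0; lra.
have infV y : has_inf (V y) by split.
have half y z : inf (V y) - inf (V z) <= L * `|y - z|.
  rewrite lerBlDr -lerBlDl; apply: lb_le_inf => // _ [x Gx <-].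
  rewrite lerBlDl; apply: (@le_trans _ _ (t x + L * `|y - pi x|)).
    by apply: ge_inf => //; exists x.
  rewrite addrCA lerD2l -mulrDr ler_wpM2l//.
  by rewrite (le_trans _ (ler_normD _ _))// addrA subrK.
exists (fun y => inf (V y)); split => [y z|x Gx].
  rewrite ler_norml half andbT lerNl opprB distrC; exact: half.
apply/eqP; rewrite eq_le; apply/andP; split.
  by apply: ge_inf => //; exists x => //; rewrite subrr normr0 mulr0 addr0.
apply: lb_le_inf => // _ [y Gy <-].
by have := Ht x y Gx Gy; lra.
Qed.

(** Differences of points of [G] avoid an open cone about [e]. So the coordinate along [e] is a
    Lipschitz function, with constant 1 / rho, of the projection along [e]; its extension
    parametrizes a graph containing [G]. *)
Lemma cone_graph (n : nat) (G : set 'rV[R]_n.+1) (e : 'rV[R]_n.+1) (rho : R) :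
  0 < rho -> e != 0 ->
  (forall x y h, G x -> G y -> 0 < h -> rho * h <= `|y - x - h *: e|) ->
  exists f : 'rV[R]_n -> 'rV[R]_n.+1, elipschitz f /\ G `<=` range f.
Proof.
move=> rho0 e0 HG.
have [->|/set0P G0] := eqVneq G set0.
  exists (fun=> 0); split => //; exists 0 => x y.
  by rewrite subrr mul0r /enorm /dotr big1 ?sqrtr0// => i _; rewrite mxE mul0r.
have [i0 ei0] : exists i, e 0 i != 0.
  apply: contrapT => /forallNP H; move/negP: e0; apply; apply/eqP/rowP => i.
  by rewrite mxE; apply/eqP/negPn/negP; exact: H.
(* [t x] is chosen so that x - t(x) e has i0-th coordinate 0; [pi] deletes that coordinate and
   [iota] reinserts it as 0. *)
pose t (x : 'rV[R]_n.+1) := x 0 i0 / e 0 i0.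
pose iota (y : 'rV[R]_n) : 'rV[R]_n.+1 :=
  \row_i (if unlift i0 i is Some j then y 0 j else 0).
pose pi (x : 'rV[R]_n.+1) : 'rV[R]_n := \row_j (x - t x *: e) 0 (lift i0 j).
have iotaB y z : iota y - iota z = iota (y - z).
  by apply/rowP => i; rewrite !mxE; case: (unlift i0 i) => [j|]; rewrite ?mxE ?subrr.
have iota_norm y : `|iota y| <= `|y|.
  apply/rV_normP => // i; rewrite mxE; case: (unlift i0 i) => [j|].
    exact: coor_le_norm.
  by rewrite normr0.
have iotaK x : x = iota (pi x) + t x *: e.
  apply/rowP => i; rewrite !mxE; case: (unliftP i0 i) => [j|] ->.
    by rewrite !mxE subrK.
  by rewrite add0r /t divfK.
have [//|||T [Tlip TG]] := @lipschitz_extension _ n G pi t rho^-1.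
- by rewrite invr_ge0 ltW.
- exact: G0.
- move=> x y Gx Gy; have [xy|xy] := leP (t x - t y) 0.
    by rewrite (le_trans xy)// mulr_ge0// invr_ge0 ltW.
  (* The cone condition with h = t(x) - t(y): after subtracting h e from x - y only the difference
     of the projections is left. *)
  rewrite ler_pdivlMl//; apply: (le_trans (HG y x _ Gy Gx xy)).
  rewrite {1}[x]iotaK {1}[y]iotaK.
  have -> : iota (pi x) + t x *: e - (iota (pi y) + t y *: e) - (t x - t y) *: e =
      iota (pi x) - iota (pi y).
    by apply/rowP => i; rewrite !mxE; ring.
  by rewrite iotaB.
exists (fun y => iota y + T y *: e); split; last first.
  by move=> x Gx; exists (pi x) => //; rewrite TG.
exists (n.+1%:R * (1 + rho^-1 * `|e|)) => y z.
apply: (le_trans (enorm_le _)); rewrite -mulrA ler_wpM2l//.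
have -> : iota y + T y *: e - (iota z + T z *: e) =
    iota (y - z) + (T y - T z) *: e.
  by rewrite -iotaB; apply/rowP => i; rewrite !mxE; ring.
apply: (le_trans (ler_normD _ _)); rewrite normrZ.
apply: (@le_trans _ _ ((1 + rho^-1 * `|e|) * `|y - z|)).
  rewrite mulrDl mul1r mulrAC lerD ?ler_wpM2r//.
apply: ler_wpM2l; last exact: norm_le_enorm.
by rewrite addr_ge0// mulr_ge0// invr_ge0 ltW.
Qed.

End lipschitz_graph.

Section level_sets.
Context {R : realType} (n : nat) (u : 'rV[R]_n.+1 -> R) (g : 'rV[R]_n.+1 -> 'rV[R]_n.+1).
Hypothesis ug : admissible u g.
Variables (a e : 'rV[R]_n.+1) (rho : R).
Hypothesis dae : direction g a e rho.
Hypothesis e_neq0 : e != 0.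
Local Notation v := (tilt u a).

Definition level_edge (tau s : R) : set 'rV[R]_n.+1 :=
  [set x | v x = tau /\ forall h, 0 < h -> v (x + (s * h) *: e) <> tau].

(** Otherwise [v] keeps its value for some distance both ahead and behind, and the diamond centred
    at [x] makes [x] regular. *)
Lemma singular_level_edge x : singular_set u x ->
  level_edge (v x) 1 x \/ level_edge (v x) (-1) x.
Proof.
move=> sx; apply: contrapT => /not_orP[n1 n2]; apply: sx.
have /existsNP[h /not_implyP[h0 /contrapT vh]] :
    ~ forall h, 0 < h -> v (x + (1 * h) *: e) <> v x by move=> H; exact: n1.
have /existsNP[h' /not_implyP[h'0 /contrapT vh']] :
    ~ forall h, 0 < h -> v (x + (-1 * h) *: e) <> v x by move=> H; exact: n2.
rewrite mul1r in vh; rewrite mulN1r scaleNr in vh'.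
have k0 : 0 < Num.min h h' by rewrite lt_min h0.
have kh : Num.min h h' <= h by rewrite ge_min lexx.
have kh' : Num.min h h' <= h' by rewrite ge_min lexx orbT.
apply: (direction_regular ug dae k0 (z := x)).
  by rewrite subrr normr0 mulr_gt0// (dir_rho dae).
by rewrite (dir_const_fwd ug dae (ltW k0) kh vh) (dir_const_bwd ug dae (ltW k0) kh' vh').
Qed.

(** If [y] were in the open cone issuing from [x], there would be room to shorten: y - eps e is
    still in that cone, so [v] equals tau there and, by the same token, at x + eps e. The first
    contradicts the edge property of [y] for the sign -1, the second that of [x] for the sign 1. *)
Lemma level_edge_graph (tau : R) (b : bool) : exists f : 'rV[R]_n -> 'rV[R]_n.+1,
  elipschitz f /\ level_edge tau ((-1) ^+ b) `<=` range f.
Proof.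
have rho0 := dir_rho dae.
apply: (cone_graph rho0 e_neq0) => x y h [vx Hx] [vy Hy] h0.
rewrite leNgt; apply/negP => lt.
(* Half of the slack in the cone inequality, so that it survives with h - eps in place of h. *)
pose eps := (h - `|y - x - h *: e| / rho) / 2.
have eps0 : 0 < eps.
  by rewrite divr_gt0// subr_gt0 ltr_pdivrMr// mulrC.
have epsh : eps < h.
  rewrite /eps ltr_pdivrMr//.
  have : 0 <= `|y - x - h *: e| / rho by rewrite divr_ge0// ltW.
  by lra.
have cone : `|(y - x - eps *: e) - (h - eps) *: e| <= rho * (h - eps).
  have -> : y - x - eps *: e - (h - eps) *: e = y - x - h *: e.
    by apply/rowP => i; rewrite !mxE; ring.
  rewrite mulrC -ler_pdivrMr// /eps.
  have : 0 < h - `|y - x - h *: e| / rho by rewrite subr_gt0 ltr_pdivrMr// mulrC.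
  by lra.
have he0 : 0 < h - eps by rewrite subr_gt0.
case: b Hx Hy => /=; rewrite ?expr1 ?expr0 => Hx Hy.
  apply: (Hy eps eps0); rewrite mulN1r scaleNr; apply/eqP; rewrite eq_le; apply/andP; split.
    by rewrite -vy -[X in _ <= v X](subrK (eps *: e)) (dir_mono ug dae)// ltW.
  rewrite -vx; have -> : y - eps *: e = x + (y - x - eps *: e).
    by apply/rowP => i; rewrite !mxE; ring.
  exact: (cone_mono ug dae _ he0).
apply: (Hx eps eps0); rewrite mul1r; apply/eqP; rewrite eq_le; apply/andP; split.
  rewrite -vy; have -> : y = x + eps *: e + (y - x - eps *: e).
    by apply/rowP => i; rewrite !mxE; ring.
  exact: (cone_mono ug dae _ he0).
by rewrite -vx (dir_mono ug dae)// ltW.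
Qed.

End level_sets.

Section rectifiable.
Context {R : realType} (n : nat) (u : 'rV[R]_n.+1 -> R) (g : 'rV[R]_n.+1 -> 'rV[R]_n.+1).
Hypothesis ug : admissible u g.
Variables (m : nat) (p E : 'I_m -> 'rV[R]_n.+1) (rho : R).
Hypothesis rho2 : rho <= 2.
Hypothesis dirs : forall k, direction g (p k) (E k) rho.
Hypothesis E_neq0 : forall k, E k != 0.
Hypothesis g_range : forall x, exists k, g x = p k.

Lemma dense_rat_row : exists theta : nat -> 'rV[R]_n.+1,
  forall x d, 0 < d -> exists i, `|theta i - x| <= d.
Proof.
pose th k : 'rV[R]_n.+1 :=
  if unpickle k is Some q then map_mx (ratr : rat -> R) (q : 'rV[rat]_n.+1) else 0.
exists th => x d d0.
have H (i : 'I_n.+1) : exists q : rat, ratr q \in `](x 0 i - d), (x 0 i + d)[.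
  by apply: rat_in_itvoo; rewrite ltrD2l gtrN.
have [q Hq] := choice H.
exists (pickle (\row_i q i)); rewrite /th pickleK; apply/rV_normP; first exact: ltW.
move=> i; rewrite !mxE; have := Hq i; rewrite in_itv /= => /andP[h1 h2].
by rewrite ler_norml; apply/andP; split; lra.
Qed.

Lemma singular_rectifiable : countably_rectifiable n (singular_set u).
Proof.
have [theta dense_theta] := dense_rat_row.
pose I := ('I_m * nat * bool)%type.
have H (i : I) : exists f : 'rV[R]_n -> 'rV[R]_n.+1, elipschitz f /\
    level_edge u (p i.1.1) (E i.1.1) (tilt u (p i.1.1) (theta i.1.2)) ((-1) ^+ i.2) `<=` range f.
  exact: (level_edge_graph ug (dirs i.1.1) (E_neq0 _)).
have [F HF] := choice H.
pose f k := if @unpickle I k is Some i then F i else fun=> 0.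
exists f; split.
  move=> k; rewrite /f; case: (unpickle k) => [i|]; first by have [] := HF i.
  exists 0 => x y; rewrite subrr mul0r /enorm /dotr big1 ?sqrtr0// => i _.
  by rewrite mxE mul0r.
have HN := hausdorff_remainder (ltn0Sn n) ug rho2 dirs g_range dense_theta.
apply: (hausdorff0_sub _ HN) => x [sx nf]; split => // j i ji; apply: nf.
have fin (b : bool) : level_edge u (p j) (E j) (tilt u (p j) (theta i)) ((-1) ^+ b) x ->
    (\bigcup_k range (f k)) x.
  move=> lx; exists (pickle ((j, i, b) : I)) => //; rewrite /f pickleK.
  by have [_] := HF (j, i, b); exact.
have := singular_level_edge ug (dirs j) sx; rewrite ji => -[lx|lx].
  by apply: (fin false); rewrite expr0.
by apply: (fin true); rewrite expr1.
Qed.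

End rectifiable.

(** * Separating one value from the others *)

Section separation.
Context {R : realType}.

Lemma continuous_bigsum (T : topologicalType) (I : Type) (s : seq I) (F : I -> T -> R) :
  (forall i, continuous (F i)) -> continuous (fun x => \sum_(i <- s) F i x).
Proof.
move=> cF; elim: s => [|i s IH].
  under eq_fun do rewrite big_nil; move=> x; exact: cvg_cst.
under eq_fun do rewrite big_cons.
by move=> x; apply: cvgD; [exact: cF|exact: IH].
Qed.

Lemma dotr_gt0 n (x : 'rV[R]_n) : x != 0 -> 0 < dotr x x.
Proof.
move=> x0; rewrite lt_neqAle; apply/andP; split.
  rewrite eq_sym; apply: contra x0 => /eqP xx; apply/eqP/rowP => i; rewrite mxE.
  have := norm_le_enorm x; rewrite /enorm xx sqrtr0 normr_le0 => /eqP ->.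
  by rewrite mxE.
by apply: sumr_ge0 => i _; rewrite -expr2 sqr_ge0.
Qed.

(** First variation: the squared length along the ray has slope 2 D.F at t = 0. Were it negative,
    the [t] below would make the linear term outweigh t^2 F.F. *)
Lemma dotr_ray_min n (D F : 'rV[R]_n) :
  (forall t, 0 <= t -> t <= 1 -> dotr D D <= dotr (D + t *: F) (D + t *: F)) ->
  0 <= dotr D F.
Proof.
move=> min.
rewrite leNgt; apply/negP => DF0.
have FF : 0 <= dotr F F by apply: sumr_ge0 => i _; rewrite -expr2 sqr_ge0.
pose t := Num.min 1 (- dotr D F / (dotr F F + 1)).
have F1 : 0 < dotr F F + 1 by rewrite ltr_wpDl.
have t0 : 0 < t by rewrite lt_min ltr01/= divr_gt0// oppr_gt0.
have t1 : t <= 1 by rewrite ge_min lexx.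
have tF : t * (dotr F F + 1) <= - dotr D F.
  by rewrite -ler_pdivlMr// ge_min lexx orbT.
have := min t (ltW t0) t1.
have -> : dotr (D + t *: F) (D + t *: F) = dotr D D + t * (2 * dotr D F + t * dotr F F).
  by rewrite dotrDr dotrZr !(dotrC (D + _)) !dotrDr !dotrZr (dotrC F D); ring.
rewrite lerDl pmulr_rge0// => h.
by move: h tF; rewrite mulrDr mulr1; lra.
Qed.

Definition simplex k : set 'rV[R]_k := [set w | (forall i, 0 <= w 0 i) /\ \sum_i w 0 i = 1].

Lemma compact_simplex k : compact (@simplex k).
Proof.
apply: bounded_closed_compact.
  exists 1; split => [|M M1 w [w0 w1] /=]; first exact: num_real.
  apply: (@le_trans _ _ 1); last exact: ltW.
  apply/rV_normP => // i; rewrite ger0_norm// -w1 (bigD1 i)//= lerDl.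
  by apply: sumr_ge0 => j _.
have -> : @simplex k = \bigcap_(i in [set: 'I_k]) [set w : 'rV[R]_k | 0 <= w 0 i] `&`
    (fun w : 'rV[R]_k => \sum_i w 0 i) @^-1` [set y | y = 1].
  apply/seteqP; split => [w [w0 w1]|w [w0 w1]]; split => // i.
    by move=> _; exact: w0.
  exact: (w0 i Logic.I).
apply: closedI.
  apply: closed_bigI => i _.
  rewrite (_ : [set w : 'rV[R]_k | 0 <= w 0 i] =
    (fun w : 'rV[R]_k => w 0 i) @^-1` [set y | 0 <= y])//.
  by apply: closed_comp; [move=> x _; exact: coord_continuous|exact: closed_ge].
apply: closed_comp; last exact: closed_eq.
by move=> x _; apply: continuous_bigsum => i; exact: coord_continuous.
Qed.

(** [D] points from [a] to the nearest point q of the convex hull of [s], which exists because the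
    simplex of weights is compact and differs from [a] by convex independence. Minimality along the
    segment from q to [b] gives D.(b - q) >= 0, and adding D.(q - a) = D.D yields the claim. *)
Lemma separation n (A : set 'rV[R]_n) (a : 'rV[R]_n) (s : seq 'rV[R]_n) :
  (forall b, b \in s -> A b /\ b <> a) -> ~ convex_hull (A `\ a) a ->
  s != [::] -> exists2 D : 'rV[R]_n, D != 0 &
    forall b, b \in s -> dotr D D <= dotr D (b - a).
Proof.
move=> sA nh s0.
pose k := size s; have k0 : (0 < k)%N by rewrite lt0n size_eq0.
pose pt (i : 'I_k) := nth 0 s i.
have pts i : pt i \in s by exact: mem_nth.
pose q (w : 'rV[R]_k) : 'rV[R]_n := \sum_i w 0 i *: pt i.
have qE w j : q w 0 j = dotr (\row_i pt i 0 j) w.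
  by rewrite summxE; apply: eq_bigr => i _; rewrite !mxE mulrC.
have cPhi : continuous (fun w => dotr (q w - a) (q w - a)).
  apply: continuous_bigsum => j w.
  have c1 : continuous (fun w => (q w - a) 0 j).
    have -> : (fun w => (q w - a) 0 j) = (fun w => dotr (\row_i pt i 0 j) w - a 0 j).
      by apply/funext => x; rewrite mxE qE mxE.
    move=> x; exact: (cvgB (continuous_dotr (x := x)) (cvg_cst _)).
  exact: (cvgM (c1 w) (c1 w)).
have ne : @simplex k !=set0.
  exists (delta_mx 0 (Ordinal k0)); split => [i|].
    by rewrite mxE eqxx /=; case: (_ == _).
  rewrite (bigD1 (Ordinal k0))//= mxE !eqxx big1 ?addr0// => i ik.
  by rewrite mxE (negbTE ik) andbF.
have [w /[!inE] [[w0 w1]] wmin] := EVT_min_rV ne (@compact_simplex k)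
  (continuous_subspaceT cPhi).
exists (q w - a).
  rewrite subr_eq0; apply: contra_notN nh => /eqP qa.
  exists k, (fun i => w 0 i), pt; split => //.
  by move=> i; have [Ap ap] := sA _ (pts i); split.
move=> b /(nthP 0)[j jk jb]; pose oj : 'I_k := Ordinal jk.
have min t : 0 <= t -> t <= 1 -> dotr (q w - a) (q w - a) <=
    dotr ((q w - a) + t *: (b - q w)) ((q w - a) + t *: (b - q w)).
  move=> t0 t1; pose wt : 'rV[R]_k := (1 - t) *: w + t *: delta_mx 0 oj.
  have qwt : q wt - a = (q w - a) + t *: (b - q w).
    have -> : q wt = (1 - t) *: q w + t *: b.
      rewrite /q /wt (eq_bigr (fun i => (1 - t) *: (w 0 i *: pt i) +
          t *: ((i == oj)%:R *: pt i))); last first.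
        by move=> i _; rewrite !mxE eqxx /= [LHS]scalerDl -!scalerA.
      rewrite big_split /= -!scaler_sumr; congr (_ + _ *: _).
      rewrite (bigD1 oj)//= eqxx scale1r big1 ?addr0 -?jb// => i ij.
      by rewrite (negbTE ij) scale0r.
    by apply/rowP => i; rewrite !mxE; ring.
  rewrite -qwt; apply: wmin; rewrite inE; split => [i|].
    rewrite !mxE addr_ge0// mulr_ge0 ?subr_ge0 ?ler0n//.
  rewrite (eq_bigr (fun i => (1 - t) * w 0 i + t * (i == oj)%:R)); last first.
    by move=> i _; rewrite !mxE eqxx.
  rewrite big_split /= -!mulr_sumr w1 (bigD1 oj)//= eqxx big1 ?addr0 ?mulr1 ?subrK//.
  by move=> i /negbTE ->.
set D := q w - a in min *; set F := b - q w in min *.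
have DF := dotr_ray_min min.
have -> : b - a = F + D by rewrite /F /D addrA subrK.
by rewrite dotrDr lerDr.
Qed.

(** Normalizing the separating vector gives a direction with a positive gap. By continuity of linear
    forms the inequalities persist on a ball around it, and finitely many values allow a common
    radius. *)
Lemma directions_exist n (A : set 'rV[R]_n.+1) : finite_set A -> convex_independent A ->
  exists m (p E : 'I_m -> 'rV[R]_n.+1) rho, [/\ rho <= 2, forall k, E k != 0,
    forall b, A b -> exists k, b = p k &
    forall (g : 'rV[R]_n.+1 -> 'rV[R]_n.+1), (forall x, A (g x)) ->
      forall k, direction g (p k) (E k) rho].
Proof.
move=> /finite_seqP[s As] indA.
have sA b : b \in s -> A b by rewrite As.
pose p (k : 'I_(size s)) := nth 0 s k.
have ps k : p k \in s by exact: mem_nth.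
have H k : exists ed : 'rV[R]_n.+1 * R, [/\ `|ed.1| <= 1, ed.1 != 0, 0 < ed.2 &
    forall b, b \in s -> b <> p k -> ed.2 <= dotr b ed.1 - dotr (p k) ed.1].
  pose s' := [seq b <- s | b != p k].
  (* With a single value there is nothing to separate from, and any unit vector does. *)
  have [s'0|s'0] := eqVneq s' [::].
    exists (delta_mx 0 0, 1); split => //=; first exact: norm_delta_mx.
      by apply/eqP => /rowP/(_ 0); rewrite !mxE !eqxx => /eqP; rewrite oner_eq0.
    move=> b bs /eqP bp; have : b \in s' by rewrite mem_filter bp.
    by rewrite s'0.
  have s'A b : b \in s' -> A b /\ b <> p k.
    by rewrite mem_filter => /andP[/eqP bp bs]; split => //; exact: sA.
  have [D D0 HD] := separation s'A (indA _ (sA _ (ps k))) s'0.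
  have nD : 0 < `|D| by rewrite normr_gt0.
  exists (`|D|^-1 *: D, dotr D D / `|D|); split => /=.
  - by rewrite normrZ normfV normr_id mulVf// gt_eqF.
  - by rewrite scaler_eq0 negb_or D0 invr_eq0 gt_eqF.
  - by rewrite divr_gt0// dotr_gt0.
  move=> b bs /eqP bp; rewrite -dotrBl dotrZr mulrC ler_wpM2l ?invr_ge0//.
  by rewrite dotrC HD// mem_filter bp.
have [ed Hed] := choice H.
pose E k := (ed k).1.
have [rho rho0 Hrho] : exists2 rho, 0 < rho & forall k, forall y b, b \in s ->
    `|y - E k| <= rho -> dotr (p k) y <= dotr b y.
  apply: fin_min_radius => [k d d' dd Hd y b bs yE|k].
    by apply: Hd => //; exact: le_trans dd.
  have [e1 e0 d0 gap] := Hed k.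
  (* A bound for the norms of all the linear forms b - p k, so that moving by at most gap / K
     changes each of them by at most the gap. *)
  pose K := n.+1%:R * \sum_(b <- s) `|b - p k| + 1.
  have K0 : 0 < K by rewrite ltr_wpDl// mulr_ge0// sumr_ge0.
  exists ((ed k).2 / K); first by rewrite divr_gt0.
  move=> y b bs yE; have [->//|/eqP bp] := eqVneq b (p k).
  rewrite -subr_ge0 -dotrBl.
  have -> : dotr (b - p k) y = dotr (b - p k) (E k) + dotr (b - p k) (y - E k).
    by rewrite -dotrDr (addrC (E k)) subrK.
  have g1 := gap b bs bp; rewrite -dotrBl -/(E k) in g1.
  have : `|dotr (b - p k) (y - E k)| <= (ed k).2.
    apply: (le_trans (dotr_bound _ _)); rewrite mulrA.
    apply: (@le_trans _ _ (K * ((ed k).2 / K))).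
      apply: ler_pM => //.
      rewrite (@le_trans _ _ (n.+1%:R * \sum_(b <- s) `|b - p k|)) ?lerDl//.
      by rewrite ler_wpM2l// (big_rem b bs)/= lerDl sumr_ge0.
    by rewrite mulrCA divff ?mulr1// gt_eqF.
  by rewrite ler_norml => /andP[h1 h2]; lra.
exists (size s), p, E, (Num.min rho 2); split.
- by rewrite ge_min lexx orbT.
- by move=> k; have [] := Hed k.
- move=> b; rewrite As => /= /(nthP 0)[i ik <-]; by exists (Ordinal ik).
move=> g Ag k; have [e1 e0 d0 gap] := Hed k.
have gs x : g x \in s by have := Ag x; rewrite As.
split => //.
- by rewrite lt_min rho0/=.
- move=> x y yE; apply: Hrho => //.
  by rewrite (le_trans yE)// ge_min lexx.
by exists (ed k).2 => // x gx; exact: gap.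
Qed.

End separation.

(** * From the weak gradient to an everywhere defined one *)

Section everywhere_gradient.
Context {R : realType} (n : nat).
Notation mu := (@lebesgue_rV R n).

Lemma pairing_ae (w1 w2 psi : 'rV[R]_n -> R) :
  measurable_fun setT w1 -> measurable_fun setT w2 -> measurable_fun setT psi ->
  {ae mu, forall x, w1 x = w2 x} -> pairing w1 psi = pairing w2 psi.
Proof.
move=> m1 m2 mp ae12; rewrite /pairing /Rintegral; congr fine.
apply: ae_eq_integral => //.
- by apply/measurable_EFinP; exact: measurable_funM.
- by apply/measurable_EFinP; exact: measurable_funM.
by apply: filterS ae12 => x /= -> _.
Qed.

Lemma smooth_opp (phi : 'rV[R]_n -> R) dphi : smooth phi dphi ->
  smooth (fun x => - phi x) (fun i x => - dphi i x).
Proof.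
move=> sp; have := smoothM (@smooth_cst R n (-1)) sp.
rewrite (_ : (fun x => -1 * phi x) = fun x => - phi x); last first.
  by apply/funext => x; rewrite mulN1r.
rewrite (_ : (fun i x => -1 * dphi i x + phi x * 0) = fun i x => - dphi i x)//.
by apply/funext => i; apply/funext => x; rewrite mulr0 addr0 mulN1r.
Qed.

Lemma ae_nonempty (A : set 'rV[R]_n) (f : 'rV[R]_n -> 'rV[R]_n) :
  {ae mu, forall x, A (f x)} -> A !=set0.
Proof.
move=> aeA; apply: contrapT => A0.
have H : mu.-negligible (@cube R n 1).
  apply: negligibleS aeA => x _ /= Afx; apply: A0; by exists (f x).
have := vol_ball_gt0 (0 : 'rV[R]_n) (@ltr01 R).
rewrite vol_shift; last exact: measurable_cube.
by rewrite /vol (measure_negligible (@measurable_cube R n 1) H) ltxx.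
Qed.

(** The variation is tested with the matrix field whose only nonzero entry is [phi], at position (i,
    j). *)
Lemma pairing_le_variation (g : 'rV[R]_n -> 'rV[R]_n) (r : R) (V : set 'rV[R]_n)
    i j phi dphi :
  cube_integrable (fun x => g x 0 i) ->
  smooth phi dphi -> supp_in r phi -> cube r `<=` V -> (forall x, `|phi x| <= 1) ->
  (Defs.variation g V < +oo)%E ->
  pairing (fun x => g x 0 i) (dphi j) <= fine (Defs.variation g V).
Proof.
move=> lg sp sr rV p1 voo.
have td := smooth_d_testable j sp sr.
pose Phi (i' : 'I_n) (j' : 'I_n) (x : 'rV[R]_n) : R :=
  if (i' == i) && (j' == j) then phi x else 0.
pose dPhi (i' j' : 'I_n) (l : 'I_n) (x : 'rV[R]_n) : R :=
  if (i' == i) && (j' == j) then dphi l x else 0.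
have sPhi i' j' : smooth (Phi i' j') (dPhi i' j').
  rewrite /Phi /dPhi; case: (_ && _) => //; exact: smooth_cst.
have suPhi i' j' : supp_in r (Phi i' j').
  by move=> x nx; rewrite /Phi; case: ifP => // _; exact: sr.
pose I := (\int[mu]_x (g x 0 i * dphi j x)%:E)%E.
have I_fin : I \is a fin_num.
  exact: integrable_fin_num (integrable_pairing lg td).
have Ivar : (I <= Defs.variation g V)%E.
  apply: ereal_sup_ubound; exists Phi; split.
  - by move=> i' j'; exact: smooth_C1c (sPhi i' j') (suPhi i' j') rV.
  - move=> x; rewrite (bigD1 i)//= (bigD1 j)//= big1 ?addr0; last first.
      by move=> j' /negbTE jj; rewrite /Phi jj andbF expr0n.
    rewrite big1 ?addr0; last first.
      move=> i' /negbTE ii; rewrite big1// => j' _.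
      by rewrite /Phi ii expr0n.
    by rewrite /Phi !eqxx /= -real_normK ?num_real// exprn_ile1.
  rewrite integral_mkcond; apply: eq_integral => x _; rewrite patchE.
  have -> : \sum_(i' < n) g x 0 i' * (\sum_(j' < n) partial j' (Phi i' j') x) =
      g x 0 i * dphi j x.
    under eq_bigr => i' _ do under eq_bigr => j' _ do rewrite (smooth_partial j' (sPhi i' j')).
    rewrite (bigD1 i)//= (bigD1 j)//= big1 ?addr0; last first.
      by move=> j' /negbTE jj; rewrite /dPhi jj andbF.
    rewrite big1 ?addr0; last first.
      move=> i' /negbTE ii; rewrite big1 ?mulr0// => j' _.
      by rewrite /dPhi ii.
    by rewrite /dPhi !eqxx.
  case: ifPn => [//|]; rewrite notin_setE => nV.
  rewrite (smooth_d_supp j sp sr) ?mulr0//.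
  by move=> /rV.
rewrite -lee_fin; have -> : (pairing (fun x => g x 0 i) (dphi j))%:E = I.
  by rewrite /pairing /Rintegral fineK.
rewrite fineK// fin_numElt voo andbT; apply: lt_le_trans Ivar.
by rewrite ltNye_eq I_fin.
Qed.

(** [Du] is redefined by a fixed element of [A] where its value is not in [A]. This happens on a
    null set, so all pairings are unchanged. *)
Lemma everywhere_gradient (A : set 'rV[R]_n) (u : 'rV[R]_n -> R)
    (Du : 'rV[R]_n -> 'rV[R]_n) : finite_set A -> continuous u ->
  weak_gradient u Du -> BV_loc Du -> {ae mu, forall x, A (Du x)} ->
  exists2 g, admissible u g & forall x, A (g x).
Proof.
move=> finA cu [lu lDu gradu] [_ bvDu] aeA.
have [a0 Aa0] := ae_nonempty aeA.
pose g x := if `[< A (Du x) >] then Du x else a0.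
have Ag x : A (g x) by rewrite /g; case: asboolP.
have mDu i : measurable_fun setT (fun x => Du x 0 i) by have [] := lDu i.
have mD : measurable [set x | A (Du x)].
  have [s As] := (finite_seqP _).1 finA.
  rewrite (_ : [set x | _] = \bigcup_(b in [set` s]) \bigcap_(i in [set: 'I_n])
      [set x | Du x 0 i = b 0 i]).
    apply: fin_bigcup_measurable => [|b _]; first exact: finite_seq.
    apply: (@fin_bigcap_measurable _ (matrix R 1 n)); first exact: finite_finset.
    by move=> i _; exact: measurable_eq_set.
  apply/seteqP; split => [x /= AD|x [b bs H] /=].
    by exists (Du x) => //; rewrite -As.
  rewrite As /=; have -> : Du x = b by apply/rowP => i; exact: H.
  exact: bs.
have mg i : measurable_fun setT (fun x => g x 0 i).
  rewrite (_ : (fun x => _) = fun x => \1_[set x | A (Du x)] x * Du x 0 i +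
      (1 - \1_[set x | A (Du x)] x) * a0 0 i).
    have m1 : measurable_fun setT (\1_[set x | A (Du x)] : 'rV[R]_n -> R).
      exact: measurable_indic.
    apply: measurable_funD; first exact: measurable_funM.
    by apply: measurable_funM => //; exact: measurable_funB.
  apply/funext => x; rewrite /g indicE; case: asboolP => ADx.
    by rewrite mem_set// subrr mul1r mul0r addr0.
  by rewrite memNset// subr0 mul0r mul1r add0r.
have ae_g i : {ae mu, forall x, Du x 0 i = g x 0 i}.
  by apply: filterS aeA => x Ax; rewrite /g asboolT.
have lDuc i := loc_integrable_cube (lDu i).
exists g => //; split => //.
- by have [] := lu.
- by apply: sub_finite_set finA => _ [x _ <-].
- move=> i phi dphi r sp sr.
  rewrite -(pairing_ae (mDu i) (mg i) (smooth_meas sp) (ae_g i)).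
  have := gradu i phi (smooth_C1c sp sr (@subsetT _ _)).
  by rewrite (smooth_partial i sp) /pairing /Rintegral => ->; rewrite fineN.
(* An open cube with compact closure that contains the support; testing with -phi as well turns the
   upper bound into one for the absolute value. *)
move=> r; pose V : set 'rV[R]_n := [set x | `|x| < `|r| + 1].
have oV : open V.
  rewrite (_ : V = ball (0 : 'rV[R]_n) (`|r| + 1)); first exact: ball_open.
  by apply/seteqP; split => x; rewrite mx_norm_ball /ball_ /V /= sub0r normrN.
have cV : compact (closure V).
  apply: (@subclosed_compact _ _ (cube (`|r| + 1))); first exact: closed_closure.
    exact: cube_compact.
  have cc : closed (@cube R n (`|r| + 1)).
    apply: compact_closed; last exact: cube_compact.
    exact: norm_hausdorff.
  rewrite closureE; apply: smallest_sub => // x /=; exact: ltW.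
have Voo := bvDu V oV cV.
have rV : cube r `<=` V.
  by move=> x /= xr; rewrite /V /= (le_lt_trans xr)// (le_lt_trans (ler_norm r))// ltrDl.
have key i j phi dphi : smooth phi dphi -> supp_in r phi -> (forall x, `|phi x| <= 1) ->
    pairing (fun x => g x 0 i) (dphi j) <= fine (Defs.variation Du V).
  move=> sp sr p1.
  rewrite -(pairing_ae (mDu i) (mg i) (smooth_dmeas sp j) (ae_g i)).
  exact: (pairing_le_variation _ (lDuc i) sp sr rV p1 Voo).
have bounded b : cube_integrable (fun x => g x 0 b).
  have [s As] := (finite_seqP _).1 finA.
  apply: cube_integrable_bounded => // t; exists (\sum_(y <- s) `|y|) => x _.
  rewrite (le_trans (coor_le_norm _ _))//.
  have xs : g x \in s by have := Ag x; rewrite As.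
  by rewrite (big_rem _ xs)/= lerDl sumr_ge0.
exists `|fine (Defs.variation Du V)| => // i j phi dphi sp sr p1.
have tp := smooth_d_testable j sp sr.
rewrite ler_norml; apply/andP; split; last first.
  by rewrite (le_trans (key _ _ _ _ sp sr p1))// ler_norm.
rewrite lerNl.
have sr' : supp_in r (fun x => - phi x) by move=> x /sr ->; rewrite oppr0.
have p1' x : `|- phi x| <= 1 by rewrite normrN.
have := key i j _ _ (smooth_opp sp) sr' p1'.
rewrite (_ : (fun x => - dphi j x) = fun x => -1 * dphi j x); last first.
  by apply/funext => x; rewrite mulN1r.
rewrite pairingZr// mulN1r => /le_trans; apply; exact: ler_norm.
Qed.

End everywhere_gradient.

Theorem theorem3 (R : realType) (n : nat) (n_gt0 : (0 < n)%N)
    (A : set 'rV[R]_n) (finA : finite_set A) (indepA : convex_independent A)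
    (u : 'rV[R]_n -> R) (Du : 'rV[R]_n -> 'rV[R]_n)
    (cont_u : continuous u)
    (u_Du : weak_gradient u Du) (BV_Du : BV_loc Du)
    (Du_A : {ae lebesgue_rV n, forall x, A (Du x)}) :
  countably_rectifiable n.-1 (singular_set u).
Proof.
case: n n_gt0 => [//|n] _ in A finA indepA u Du cont_u u_Du BV_Du Du_A *.
have [g ug Ag] := everywhere_gradient finA cont_u u_Du BV_Du Du_A.
have [m [p [E [rho [rho2 E0 pA dirs]]]]] := directions_exist finA indepA.
by apply: (singular_rectifiable ug rho2 (dirs g Ag) E0) => x; exact: pA.
Qed.
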